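(* For every integer $n \ge 13$, there exists a finite simple graph $T_n$ on exactly $n$ vertices that is linklessly embeddable and Tutte-4-connected.
   Context: All graphs are finite and simple. A graph is intrinsically linked if every embedding of it in $\mathbb{R}^3$ contains a nontrivial link (a pair of disjoint cycles that are nontrivially linked); a graph is linklessly embeddable if it is not intrinsically linked, i.e. it admits an embedding in $\mathbb{R}^3$ in which no two disjoint cycles form a nontrivial link. A graph is called Tutte-4-connected if it is 4-connected and triangle-free (contains no cycle of length 3). *)

(* Defs.v *)
From HB Require Import structures.
From mathcomp Require Import all_boot all_order all_algebra.
From mathcomp Require Import all_classical all_reals topology normedtype.
From mathcomp Require Import Rstruct Rstruct_topology.
Set Implicit Arguments. Unset Strict Implicit. Unset Printing Implicit Defensive.
Import Order.TTheory GRing.Theory Num.Theory.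
Import numFieldNormedType.Exports.
Local Open Scope classical_set_scope.
Local Open Scope ring_scope.

Definition simple_graph (T : finType) (e : rel T) : Prop :=
  symmetric e /\ irreflexive e.

Definition connected_avoiding (T : finType) (e : rel T) (X : {set T}) : Prop :=
  forall x y : T, x \notin X -> y \notin X ->
    connect [rel u v | [&& e u v, u \notin X & v \notin X]] x y.

Definition k_connected (k : nat) (T : finType) (e : rel T) : Prop :=
  (k < #|T|)%N /\ forall X : {set T}, (#|X| < k)%N -> connected_avoiding e X.

Definition triangle_free (T : finType) (e : rel T) : Prop :=
  forall a b c : T, ~ [&& e a b, e b c & e c a].

Definition tutte4connected (T : finType) (e : rel T) : Prop :=
  k_connected 4 e /\ triangle_free e.

Section Embedding.
Variable R : realType.
Notation point := 'rV[R]_3.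

Definition mkpt (a b c : R) : point := \row_(i < 3) nth 0 [:: a; b; c] i.

Definition unit_I : set R := `[0%R, 1%R].
Definition open_I : set R := `]0%R, 1%R[.

(* An embedding of the (1-dimensional geometric realization of the) graph:
   p v is the image of vertex v, and  t |-> g u v t  (t in [0,1]) parametrizes
   the arc of edge uv, from p u to p v. *)
Record embedding (T : finType) (e : rel T) := Embedding {
  emb_pt : T -> point;
  emb_arc : T -> T -> R -> point }.

Definition is_embedding (T : finType) (e : rel T) (E : embedding e) : Prop :=
  let p := emb_pt E in let g := emb_arc E in
  injective p /\
  (forall u v, e u v ->
     [/\ {within unit_I, continuous g u v},
         g u v 0 = p u, g u v 1 = p v,
         (forall t, unit_I t -> g v u t = g u v (1 - t)) &
         {in unit_I &, injective (g u v)}]) /\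
  (forall u v w t, e u v -> open_I t -> g u v t <> p w) /\
  (forall u v u' v' t t', e u v -> e u' v' -> open_I t -> open_I t' ->
     ~ ((u == u') && (v == v') || (u == v') && (v == u')) ->
     g u v t <> g u' v' t').

Definition graph_cycle (T : finType) (e : rel T) (s : seq T) : Prop :=
  [/\ cycle e s, uniq s & (2 < size s)%N].

Definition cycle_image (T : finType) (e : rel T) (E : embedding e) (s : seq T)
  : set point :=
  [set x | exists2 u, u \in s & exists2 t, unit_I t & x = emb_arc E u (next s u) t].

Definition homeomorphism (f : point -> point) : Prop :=
  exists g : point -> point,
    [/\ cancel f g, cancel g f, continuous f & continuous g].

Definition unlink1 : set point :=
  [set x | exists a b : R, x = mkpt a b 0 /\ a ^+ 2 + b ^+ 2 = 1].
Definition unlink2 : set point :=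
  [set x | exists a b : R, x = mkpt (a + 3) b 0 /\ a ^+ 2 + b ^+ 2 = 1].

Definition trivial_link (K1 K2 : set point) : Prop :=
  exists H : R -> point -> point,
    [/\ continuous (fun q : R * point => H q.1 q.2),
        H 0 = id,
        (forall t, homeomorphism (H t)),
        H 1 @` K1 = unlink1 &
        H 1 @` K2 = unlink2].

Definition linkless_embedding (T : finType) (e : rel T) (E : embedding e) : Prop :=
  is_embedding E /\
  forall s1 s2 : seq T, graph_cycle e s1 -> graph_cycle e s2 ->
    (forall v, v \in s1 -> v \notin s2) -> trivial_link (cycle_image E s1) (cycle_image E s2).

Definition linklessly_embeddable (T : finType) (e : rel T) : Prop :=
  exists E : embedding e, linkless_embedding E.

End Embedding.

(* Main.v *)
From Stdlib Require Import ZArith.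
Require Import Defs.
From mathcomp Require Import all_boot all_order all_algebra.
From mathcomp Require Import all_classical all_reals Rstruct Rstruct_topology.
From mathcomp Require Import topology normedtype realfun derive.
From mathcomp Require Import ring lra zify ssrZ.
Set Implicit Arguments. Unset Strict Implicit. Unset Printing Implicit Defensive.
Import Order.TTheory GRing.Theory Num.Theory.
Import numFieldNormedType.Exports.
Local Open Scope classical_set_scope.
Local Open Scope ring_scope.

(* Replacing two sides xy, yz of a polygon by xz is an ambient isotopy as soon as
   the filled triangle xyz meets the rest of the link at most in x and z, and two
   disjoint filled triangles bound a trivial link.  Hence a straight-line drawing
   is linkless once every pair of disjoint cycles can be reduced, by cutting
   corners in this way, to a pair of disjoint triangles.

   For n >= 14 start from a tetrahedron and repeatedly subdivide a tetrahedron by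
   its barycentre.  In the resulting 1-skeleton the two neighbours, on a cycle, of
   the vertex inserted last span a face of the triangulation with it, so that
   vertex can always be cut off.  A long chain of such subdivisions, closed off by
   seven further vertices near its two ends, has a spanning subgraph that is
   4-connected and triangle-free.

   For n = 13 the circulant graph C13(1,3) has a straight-line drawing in which
   the reductions of all pairs of disjoint cycles are found by a verified search. *)

(** Ambient isotopies are built by hand only twice, both times as a monotone reparametrization of
    the lines parallel to the y-axis: flattening a tent ([squash]) and rounding a square
    ([round_diamond]). All others arise from these by affine changes of frame, composition and
    inversion.

    The graphs are triangle-free, so no cycle can be shortened to a triangle inside the graph
    itself. The cuts therefore run in a larger straight-line drawing: the whole 1-skeleton of the
    stacked complex, or, for n = 13, all segments between the points. The new side xz of a cut
    polygon need not be an edge of the graph.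

    The chain with its seven extra vertices has N + 8 vertices, where N >= 6. At N = 5 its two ends
    would subdivide the same tetrahedra ([N + 1] and [N + 4] would have the same parents), so 13
    vertices call for another graph. *)

Lemma continuous_pair (T U V : topologicalType) (f : T -> U) (g : T -> V) :
  continuous f -> continuous g -> continuous (fun x => (f x, g x)).
Proof.
move=> cf cg x A [[P Q] /= [nP nQ] sub].
near=> y; apply: sub => /=; split; near: y; [exact: cf|exact: cg].
Unshelve. all: by end_near. Qed.

Lemma continuousT_comp (T U V : topologicalType) (f : T -> U) (g : U -> V) :
  continuous f -> continuous g -> continuous (fun x => g (f x)).
Proof. by move=> cf cg x; apply: continuous_comp; [exact: cf|exact: cg]. Qed.

(** * Ambient isotopies of pairs of point sets *)

Section Isotopy.
Variable R : realType.
Notation point := 'rV[R]_3.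

Definition isotopic (K1 K2 L1 L2 : set point) : Prop :=
  exists H : R -> point -> point,
    [/\ continuous (fun q : R * point => H q.1 q.2), H 0 = id,
        (forall t, homeomorphism (H t)), H 1 @` K1 = L1 & H 1 @` K2 = L2].

Lemma isotopic_refl K1 K2 : isotopic K1 K2 K1 K2.
Proof.
exists (fun _ x => x); split; rewrite ?image_id //; first by move=> q; exact: cvg_snd.
by move=> t; exists id; split=> // q; exact: cvg_id.
Qed.

Lemma homeomorphism_comp (f g : point -> point) :
  homeomorphism f -> homeomorphism g -> homeomorphism (f \o g).
Proof.
move=> [f' [fK f'K cf cf']] [g' [gK g'K cg cg']].
exists (g' \o f'); split; [exact: can_comp|exact: can_comp| |].
  by move=> x; apply: continuous_comp; [exact: cg|exact: cf].
by move=> x; apply: continuous_comp; [exact: cf'|exact: cg'].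
Qed.

Lemma isotopic_trans K1 K2 L1 L2 M1 M2 :
  isotopic K1 K2 L1 L2 -> isotopic L1 L2 M1 M2 -> isotopic K1 K2 M1 M2.
Proof.
move=> [F [cF F0 hF F1 F2]] [G [cG G0 hG G1 G2]].
exists (fun t => G t \o F t); split.
- apply: (@continuousT_comp _ _ _
    (fun q : R * point => (q.1, F q.1 q.2)) (fun q => G q.1 q.2)) cG.
  by apply: continuous_pair => // q; exact: cvg_fst.
- by rewrite G0 F0.
- by move=> t; exact: homeomorphism_comp.
- by rewrite -G1 -F1 image_comp.
- by rewrite -G2 -F2 image_comp.
Qed.

Lemma isotopic_sym K1 K2 L1 L2 : isotopic K1 K2 L1 L2 -> isotopic L1 L2 K1 K2.
Proof.
move=> [F [cF F0 hF F1 F2]].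
have [G [FK GK cF1 cG]] := hF 1.
exists (fun t => F (1 - t) \o G); split.
- apply: (@continuousT_comp _ _ _
    (fun q : R * point => (1 - q.1, G q.2)) (fun q => F q.1 q.2)) cF.
  apply: continuous_pair.
    by move=> q; apply: cvgB; [exact: cvg_cst|exact: cvg_fst].
  by apply: (@continuousT_comp _ _ _ snd G) cG => q; exact: cvg_snd.
- by rewrite subr0; apply/funext => x; exact: GK.
- by move=> t; apply: homeomorphism_comp => //; exists (F 1).
- rewrite subrr F0 -F1 image_comp (_ : (id \o G) \o F 1 = id) ?image_id //.
  by apply/funext => x; exact: FK.
- rewrite subrr F0 -F2 image_comp (_ : (id \o G) \o F 1 = id) ?image_id //.
  by apply/funext => x; exact: FK.
Qed.

(** This allows a move to be carried out in a standard affine frame: every stage of the isotopy is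
    conjugated by [A]. *)
Lemma isotopic_conj (A : point -> point) K1 K2 L1 L2 : homeomorphism A ->
  isotopic (A @` K1) (A @` K2) (A @` L1) (A @` L2) -> isotopic K1 K2 L1 L2.
Proof.
move=> hA [F [cF F0 hF F1 F2]]; have [B [AK BK cA cB]] := hA.
have imK (K : set point) : B @` (A @` K) = K.
  by rewrite image_comp (_ : B \o A = id) ?image_id //; apply/funext.
exists (fun t => B \o F t \o A); split.
- apply: (@continuousT_comp _ _ _ (fun q : R * point => F q.1 (A q.2)) B) cB.
  apply: (@continuousT_comp _ _ _
    (fun q : R * point => (q.1, A q.2)) (fun q => F q.1 q.2)) cF.
  apply: continuous_pair; first by move=> q; exact: cvg_fst.
  by apply: (@continuousT_comp _ _ _ snd A) cA => q; exact: cvg_snd.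
- by rewrite F0; apply/funext => x; exact: AK.
- move=> t; apply: homeomorphism_comp => //; apply: homeomorphism_comp => //.
  by exists A.
- by rewrite -image_comp -image_comp F1 imK.
- by rewrite -image_comp -image_comp F2 imK.
Qed.

Lemma isotopic_swap K1 K2 L1 L2 : isotopic K1 K2 L1 L2 -> isotopic K2 K1 L2 L1.
Proof. by move=> [F [? ? ? ? ?]]; exists F. Qed.

Definition i0 : 'I_3 := @Ordinal 3 0 isT.
Definition i1 : 'I_3 := @Ordinal 3 1 isT.
Definition i2 : 'I_3 := @Ordinal 3 2 isT.
Definition cx (q : point) : R := q ord0 i0.
Definition cy (q : point) : R := q ord0 i1.
Definition cz (q : point) : R := q ord0 i2.

Lemma cx_mkpt a b c : cx (mkpt a b c) = a. Proof. by rewrite /cx /mkpt mxE. Qed.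
Lemma cy_mkpt a b c : cy (mkpt a b c) = b. Proof. by rewrite /cy /mkpt mxE. Qed.
Lemma cz_mkpt a b c : cz (mkpt a b c) = c. Proof. by rewrite /cz /mkpt mxE. Qed.
Definition c_mkpt := (cx_mkpt, cy_mkpt, cz_mkpt).

Lemma pointP (p q : point) : cx p = cx q -> cy p = cy q -> cz p = cz q -> p = q.
Proof.
move=> hx hy hz; apply/rowP => -[[|[|[|//]]] i].
- by rewrite (_ : Ordinal i = i0) //; apply: val_inj.
- by rewrite (_ : Ordinal i = i1) //; apply: val_inj.
- by rewrite (_ : Ordinal i = i2) //; apply: val_inj.
Qed.

Lemma mkpt_eta (q : point) : q = mkpt (cx q) (cy q) (cz q).
Proof. by apply: pointP; rewrite c_mkpt. Qed.

Lemma cxD p q : cx (p + q) = cx p + cx q. Proof. by rewrite /cx mxE. Qed.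
Lemma cyD p q : cy (p + q) = cy p + cy q. Proof. by rewrite /cy mxE. Qed.
Lemma czD p q : cz (p + q) = cz p + cz q. Proof. by rewrite /cz mxE. Qed.
Lemma cxN p : cx (- p) = - cx p. Proof. by rewrite /cx mxE. Qed.
Lemma cyN p : cy (- p) = - cy p. Proof. by rewrite /cy mxE. Qed.
Lemma czN p : cz (- p) = - cz p. Proof. by rewrite /cz mxE. Qed.
Lemma cxZ a p : cx (a *: p) = a * cx p. Proof. by rewrite /cx mxE. Qed.
Lemma cyZ a p : cy (a *: p) = a * cy p. Proof. by rewrite /cy mxE. Qed.
Lemma czZ a p : cz (a *: p) = a * cz p. Proof. by rewrite /cz mxE. Qed.
Definition cE := (c_mkpt, (cxD, cyD, czD), (cxN, cyN, czN), (cxZ, cyZ, czZ)).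

Lemma cx_continuous : continuous cx. Proof. exact: coord_continuous. Qed.
Lemma cy_continuous : continuous cy. Proof. exact: coord_continuous. Qed.
Lemma cz_continuous : continuous cz. Proof. exact: coord_continuous. Qed.

Lemma cvg_mkpt (T : Type) (F : set_system T) {FF : Filter F} (f g h : T -> R)
    (a b c : R) :
  f @ F --> a -> g @ F --> b -> h @ F --> c ->
  (fun x => mkpt (f x) (g x) (h x)) @ F --> mkpt a b c.
Proof.
move=> fa gb hc A [P nP sPA].
have Hx : \forall x \near F, P ord0 i0 (f x).
  by apply: fa; have := nP ord0 i0; rewrite /mkpt mxE.
have Hy : \forall x \near F, P ord0 i1 (g x).
  by apply: gb; have := nP ord0 i1; rewrite /mkpt mxE.
have Hz : \forall x \near F, P ord0 i2 (h x).
  by apply: hc; have := nP ord0 i2; rewrite /mkpt mxE.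
suff : \forall x \near F, A (mkpt (f x) (g x) (h x)) by [].
near=> x; apply: sPA => i [[|[|[|//]]] j]; rewrite /= /mkpt mxE /= (ord1 i).
- rewrite (_ : Ordinal j = i0); [by near: x|exact: val_inj].
- rewrite (_ : Ordinal j = i1); [by near: x|exact: val_inj].
- rewrite (_ : Ordinal j = i2); [by near: x|exact: val_inj].
Unshelve. all: by end_near. Qed.

(* The inverse of a fibrewise increasing bijection is continuous because the
   sign of [h] at the two ends of a small fibre interval is locally constant. *)
Lemma fibrewise_homeomorphism (h : point -> R) (C : R) :
  continuous h ->
  (forall x y y' z, y < y' -> h (mkpt x y z) < h (mkpt x y' z)) ->
  (forall q, `|h q - cy q| <= C) ->
  homeomorphism (fun q => mkpt (cx q) (h q) (cz q)).
Proof.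
move=> ch mh bh.
have C0 : 0 <= C by apply: le_trans (bh 0); exact: normr_ge0.
have hy x z : continuous (fun y => h (mkpt x y z)).
  move=> y; apply: (@continuous_comp _ _ _ (fun y => mkpt x y z) h); last exact: ch.
  by apply: cvg_mkpt; [exact: cvg_cst|exact: cvg_id|exact: cvg_cst].
have inv_ex (q : point) : {y | h (mkpt (cx q) y (cz q)) = cy q}.
  apply: cid.
  (* The bound [C] places [cy q] between the values of [h] at the two ends of this interval, so the
     intermediate value theorem provides a preimage. *)
  have le1 : cy q - C <= cy q + C by lra.
  have [||y _ yq] := @IVT R (fun y => h (mkpt (cx q) y (cz q))) _ _ (cy q) le1.
  - by apply: continuous_subspaceT; exact: hy.
  - have := bh (mkpt (cx q) (cy q - C) (cz q)).
    have := bh (mkpt (cx q) (cy q + C) (cz q)).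
    rewrite !cy_mkpt !ler_norml => /andP[a1 a2] /andP[a3 a4].
    by rewrite ge_min le_max; apply/andP; split; apply/orP; [left|right]; lra.
  - by exists y.
pose g q := sval (inv_ex q).
have gP q : h (mkpt (cx q) (g q) (cz q)) = cy q := svalP (inv_ex q).
have inj x z y y' : h (mkpt x y z) = h (mkpt x y' z) -> y = y'.
  move=> e; case: (ltgtP y y') => // l; have := mh x _ _ z l; by rewrite e ltxx.
exists (fun q => mkpt (cx q) (g q) (cz q)); split.
- move=> q; apply: pointP; rewrite ?c_mkpt //.
  apply: (inj (cx q) (cz q)); have := gP (mkpt (cx q) (h q) (cz q)).
  by rewrite !c_mkpt -mkpt_eta.
- by move=> q; rewrite !c_mkpt gP -mkpt_eta.
- by move=> q; exact: (cvg_mkpt (@cx_continuous q) (@ch q) (@cz_continuous q)).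
- move=> q; suff gq : {for q, continuous g}.
    exact: (cvg_mkpt (@cx_continuous q) gq (@cz_continuous q)).
  have FF : Filter (nbhs q) := nbhs_filter q.
  apply/(@cvgrPdist_lt _ _ _ (nbhs q) FF) => e e0.
  have hc (y : R) : (fun p : point => h (mkpt (cx p) y (cz p))) @ q -->
      h (mkpt (cx q) y (cz q)).
    apply: (@continuous_comp _ _ _ (fun p : point => mkpt (cx p) y (cz p)) h);
      last exact: ch.
    exact: (cvg_mkpt (@cx_continuous q) (@cvg_cst _ y _ _ _) (@cz_continuous q)).
  have up : \forall p \near q, h (mkpt (cx p) (g q + e) (cz p)) - cy p > 0.
    have := @cvgr_gt _ _ (nbhs q) FF _ _ (cvgB (hc (g q + e)) (@cy_continuous q)).
    by apply; rewrite subr_gt0 -{1}(gP q); apply: mh; lra.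
  have dn : \forall p \near q, h (mkpt (cx p) (g q - e) (cz p)) - cy p < 0.
    have := @cvgr_lt _ _ (nbhs q) FF _ _ (cvgB (hc (g q - e)) (@cy_continuous q)).
    by apply; rewrite subr_lt0 -[X in _ < X](gP q); apply: mh; lra.
  near=> p.
  have u : h (mkpt (cx p) (g q + e) (cz p)) - cy p > 0 by near: p.
  have d : h (mkpt (cx p) (g q - e) (cz p)) - cy p < 0 by near: p.
  rewrite -(gP p) subr_gt0 in u; rewrite -(gP p) subr_lt0 in d.
  have u' : g p < g q + e.
    rewrite ltNge le_eqVlt; apply/negP => /orP[/eqP E|/(mh (cx p) _ _ (cz p))]; last lra.
    by rewrite E ltxx in u.
  have d' : g q - e < g p.
    rewrite ltNge le_eqVlt; apply/negP => /orP[/eqP E|/(mh (cx p) _ _ (cz p))]; last lra.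
    by rewrite E ltxx in d.
  by rewrite ltr_norml; apply/andP; split; lra.
Unshelve. all: by end_near. Qed.

Lemma continuous_maxr (T : topologicalType) (f g : T -> R) :
  continuous f -> continuous g -> continuous (fun x => Num.max (f x) (g x)).
Proof. by move=> cf cg x; exact: (@continuous_max R T f g x (cf x) (cg x)). Qed.

Lemma continuous_minr (T : topologicalType) (f g : T -> R) :
  continuous f -> continuous g -> continuous (fun x => Num.min (f x) (g x)).
Proof. by move=> cf cg x; exact: (@continuous_min R T f g x (cf x) (cg x)). Qed.

(** An isotopy has to be a homeomorphism at every real time; clamping freezes it outside [0, 1]. *)
Definition clamp (t : R) : R := Num.max 0 (Num.min 1 t).

Lemma clamp_itv t : 0 <= clamp t <= 1.
Proof. by rewrite /clamp le_max lexx /= ge_max ler01 ge_min lexx. Qed.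
Lemma clamp0 : clamp 0 = 0. Proof. by rewrite /clamp (min_r ler01) maxxx. Qed.
Lemma clamp1 : clamp 1 = 1. Proof. by rewrite /clamp minxx (max_r ler01). Qed.

Lemma clamp_continuous : continuous clamp.
Proof.
apply: continuous_maxr; first by move=> t; exact: cvg_cst.
by apply: continuous_minr => t; [exact: cvg_cst|exact: cvg_id].
Qed.

(** Linear interpolation between [cy] and [h] remains increasing on each fibre and obeys the same
    bound [C], so every stage is again a fibrewise homeomorphism. *)
Lemma fibrewise_isotopy (h : point -> R) (C : R) (K1 K2 : set point) :
  continuous h ->
  (forall x y y' z, y < y' -> h (mkpt x y z) < h (mkpt x y' z)) ->
  (forall q, `|h q - cy q| <= C) ->
  isotopic K1 K2 ((fun q => mkpt (cx q) (h q) (cz q)) @` K1)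
                 ((fun q => mkpt (cx q) (h q) (cz q)) @` K2).
Proof.
move=> ch mh bh.
pose k t (q : point) := (1 - clamp t) * cy q + clamp t * h q.
have ck : continuous (fun q : R * point => k q.1 q.2).
  have c1 : continuous (fun q : R * point => clamp q.1).
    by move=> q; apply: (@continuous_comp _ _ _ fst clamp);
      [exact: cvg_fst|exact: clamp_continuous].
  have c2 (f : point -> R) : continuous f -> continuous (fun q : R * point => f q.2).
    by move=> cf q; apply: (@continuous_comp _ _ _ snd f); [exact: cvg_snd|exact: cf].
  move=> q; apply: cvgD; apply: cvgM.
  - by apply: cvgB; [exact: cvg_cst|exact: c1].
  - exact: (c2 _ cy_continuous).
  - exact: c1.
  - exact: (c2 _ ch).
exists (fun t q => mkpt (cx q) (k t q) (cz q)); split.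
- move=> q; apply: cvg_mkpt; [|exact: ck|].
  + by apply: (@continuous_comp _ _ _ snd cx); [exact: cvg_snd|exact: cx_continuous].
  + by apply: (@continuous_comp _ _ _ snd cz); [exact: cvg_snd|exact: cz_continuous].
- by apply/funext => q; rewrite /k clamp0 subr0 mul1r mul0r addr0 -mkpt_eta.
- move=> t; apply: (@fibrewise_homeomorphism (k t) C).
  + move=> q; apply: (@continuous_comp _ _ _ (fun q => (t, q)) (fun q : R * point => k q.1 q.2)).
      by apply: continuous_pair => x; [exact: cst_continuous|exact: cvg_id].
    exact: ck.
  + move=> x y y' z yy'; rewrite /k !c_mkpt; have := mh x _ _ z yy'.
    have /andP[] := clamp_itv t; move: (clamp t) => s s0 s1 hh.
    have p1 : 0 <= (1 - s) * (y' - y) by apply: mulr_ge0; lra.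
    have p2 : 0 <= s * (h (mkpt x y' z) - h (mkpt x y z)) by apply: mulr_ge0; lra.
    case: (ltP 0 s) => s00; last first.
      have -> : s = 0 by lra.
      by lra.
    have : 0 < s * (h (mkpt x y' z) - h (mkpt x y z)) by apply: mulr_gt0; lra.
    by lra.
  + move=> q; rewrite /k (_ : _ - _ = clamp t * (h q - cy q)); last by ring.
    have /andP[s0 s1] := clamp_itv t; rewrite normrM (ger0_norm s0).
    by apply: le_trans (bh q); apply: ler_piMl.
- by congr image; apply/funext => q; rewrite /k clamp1 subrr mul0r mul1r add0r.
- by congr image; apply/funext => q; rewrite /k clamp1 subrr mul0r mul1r add0r.
Qed.

End Isotopy.

(** * Flattening a tent: the corner cut in standard position *)

Section DeltaMove.
Variable R : realType.
Notation point := 'rV[R]_3.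
Implicit Types (a b c p q u v : point) (e : point * point) (s : seq (point * point)).

Definition seg u v : set point :=
  [set x | exists2 t : R, 0 <= t <= 1 & x = (1 - t) *: u + t *: v].

Definition tri a b c : set point :=
  [set x | exists l m n : R,
     [/\ 0 <= l, 0 <= m, 0 <= n, l + m + n = 1 & x = l *: a + m *: b + n *: c]].

Definition segs s : set point := [set x | exists2 e, e \in s & seg e.1 e.2 x].

Lemma segC u v : seg u v = seg v u.
Proof.
suff H w x : seg w x `<=` seg x w by apply/seteqP; split.
move=> _ [t t01 ->]; exists (1 - t); first by lra.
by rewrite addrC; congr (_ *: _ + _ *: _); ring.
Qed.

Lemma segs_cons e s : segs (e :: s) = seg e.1 e.2 `|` segs s.
Proof.
apply/seteqP; split=> x.
  by move=> [f]; rewrite inE => /orP[/eqP ->|fs fx]; [left|right; exists f].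
move=> [ex|[f fs fx]]; first by exists e; rewrite ?mem_head.
by exists f; rewrite // inE fs orbT.
Qed.

(** The height of a roof over the (x, z)-plane that coincides with the tent at z = 0 and vanishes at
    distance [eps] from that plane. *)
Definition tau (eps : R) q : R := Num.max 0 (1 - `|cx q| - `|cz q| / eps).

(** On each vertical line the two affine pieces cross at height [tau], where both vanish, and they
    meet the diagonal at [- (eps * tau)] and [(1 + eps) * tau]. Between these heights [max] lies
    below the diagonal and sends [tau] to 0; beyond them [min] restores the identity. *)
Definition squash (eps : R) q : R :=
  Num.min (cy q) (Num.max (eps / (1 + eps) * (cy q + eps * tau eps q) - eps * tau eps q)
                          ((1 + eps) / eps * (cy q - tau eps q))).

Definition outside (eps : R) q : Prop :=
  cy q <= - (eps * tau eps q) \/ (1 + eps) * tau eps q <= cy q.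

Lemma tau_ge0 eps q : 0 <= tau eps q.
Proof. by rewrite le_max lexx. Qed.

Lemma tau_le eps q : 0 < eps -> tau eps q <= Num.max 0 (1 - `|cx q|).
Proof.
move=> e0; rewrite ge_max !le_max lexx /=; apply/orP; right.
by rewrite lerBlDr lerDl divr_ge0 // ltW.
Qed.

Lemma squash_id eps q : 0 < eps -> outside eps q -> squash eps q = cy q.
Proof.
move=> e0 o; apply: min_l; have t0 := tau_ge0 eps q.
rewrite le_max; apply/orP; case: o => o; [left|right].
  have -> : eps / (1 + eps) = 1 - (1 + eps)^-1 by field; lra.
  have : 0 <= (1 + eps)^-1 * - (cy q + eps * tau eps q).
    by apply: mulr_ge0; [rewrite invr_ge0; lra|lra].
  by lra.
have -> : (1 + eps) / eps = 1 + eps^-1 by field; lra.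
have : 0 <= eps^-1 * (cy q - (1 + eps) * tau eps q).
  by apply: mulr_ge0; [rewrite invr_ge0; lra|lra].
have -> : eps^-1 * (cy q - (1 + eps) * tau eps q) =
   eps^-1 * cy q - eps^-1 * tau eps q - tau eps q by field; lra.
by lra.
Qed.

Lemma squash_arc eps x : 0 < eps -> `|x| <= 1 ->
  squash eps (mkpt x (1 - `|x|) 0) = 0.
Proof.
move=> e0 x1; rewrite /squash /tau !c_mkpt normr0 mul0r subr0.
have -> : Num.max 0 (1 - `|x|) = 1 - `|x| by apply: max_r; rewrite subr_ge0.
have -> : eps / (1 + eps) * (1 - `|x| + eps * (1 - `|x|)) - eps * (1 - `|x|) = 0.
  by field; lra.
by rewrite subrr mulr0 maxxx min_r // subr_ge0.
Qed.

Lemma squash_continuous eps : continuous (squash eps).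
Proof.
have cn (f : point -> R) : continuous f -> continuous (fun q => `|f q|).
  by move=> cf q; exact: (cvg_norm (cf q)).
have ca (f g : point -> R) : continuous f -> continuous g -> continuous (fun q => f q + g q).
  by move=> cf cg q; exact: (cvgD (cf q) (cg q)).
have cN (f : point -> R) : continuous f -> continuous (fun q => - f q).
  by move=> cf q; exact: (cvgN (cf q)).
have cm (k : R) (f : point -> R) : continuous f -> continuous (fun q => k * f q).
  by move=> cf q; exact: (cvgM (@cst_continuous _ _ k q) (cf q)).
have ct : continuous (tau eps).
  apply: continuous_maxr; first exact: cst_continuous.
  apply: (ca _ _); last first.
    apply: (cN (fun q => `|cz q| / eps)) => q.
    exact: (cvgM (cn _ (@cz_continuous R) q) (@cst_continuous _ _ eps^-1 q)).
  by apply: (ca _ _); [exact: cst_continuous|exact: (cN _ (cn _ (@cx_continuous R)))].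
apply: continuous_minr; first exact: cy_continuous.
apply: continuous_maxr.
  apply: (ca (fun q => eps / (1 + eps) * (cy q + eps * tau eps q))
             (fun q => - (eps * tau eps q))).
    by apply: (cm _); apply: (ca _ _); [exact: cy_continuous|exact: (cm _)].
  by apply: (cN _); exact: (cm _).
by apply: (cm _); apply: (ca _ _); [exact: cy_continuous|exact: (cN _)].
Qed.

Lemma squash_mono eps x y y' z : 0 < eps -> y < y' ->
  squash eps (mkpt x y z) < squash eps (mkpt x y' z).
Proof.
move=> e0 yy'; rewrite /squash /tau !c_mkpt.
set T := Num.max 0 _.
have k1 : 0 < eps / (1 + eps) by rewrite divr_gt0 //; lra.
have k2 : 0 < (1 + eps) / eps by rewrite divr_gt0 //; lra.
have d1 : 0 < eps / (1 + eps) * (y' - y) by rewrite mulr_gt0 //; lra.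
have d2 : 0 < (1 + eps) / eps * (y' - y) by rewrite mulr_gt0 //; lra.
rewrite lt_min !gt_min yy' /= gt_max !lt_max; apply/orP; right.
by apply/andP; split; apply/orP; [left|right]; lra.
Qed.

Lemma squash_bound eps q : 0 < eps -> `|squash eps q - cy q| <= 1 + 2 * eps.
Proof.
move=> e0; case: (leP (cy q) (- (eps * tau eps q))) => o1.
  by rewrite squash_id ?subrr ?normr0 //; [lra|left].
case: (leP ((1 + eps) * tau eps q) (cy q)) => o2.
  by rewrite squash_id ?subrr ?normr0 //; [lra|right].
have t1 : tau eps q <= 1.
  apply: le_trans (tau_le q e0) _; rewrite ge_max ler01 /=.
  by have := normr_ge0 (cx q); lra.
have t0 := tau_ge0 eps q.
have et : eps * tau eps q <= eps by apply: ler_piMr; lra.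
have sy : squash eps q <= cy q by rewrite ge_min lexx.
have sl : - eps <= squash eps q.
  rewrite le_min; apply/andP; split; first by lra.
  rewrite le_max; apply/orP; left.
  have : 0 <= eps / (1 + eps) * (cy q + eps * tau eps q).
    by apply: mulr_ge0; [rewrite divr_ge0; lra|lra].
  by lra.
by rewrite ler_norml; apply/andP; split; lra.
Qed.

(** Demanding this for all small [eps] lets finitely many segments share one [eps]. *)
Definition avoids (K : set point) : Prop :=
  exists2 e0 : R, 0 < e0 & forall eps, 0 < eps <= e0 -> forall q, K q -> outside eps q.

Lemma avoids_segs s : (forall e, e \in s -> avoids (seg e.1 e.2)) -> avoids (segs s).
Proof.
elim: s => [|e s IH] h; first by exists 1 => // eps _ q [].
have [e1 e10 h1] := h e (mem_head _ _).
have [|e2 e20 h2] := IH; first by move=> f fs; apply: h; rewrite inE fs orbT.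
exists (Num.min e1 e2) => [|eps /andP[eps0]]; first by rewrite lt_min e10.
rewrite le_min => /andP[l1 l2] q; rewrite segs_cons => -[]; [apply: h1|apply: h2];
  exact/andP.
Qed.

Definition std_tri q := [/\ cz q = 0, 0 <= cy q & cy q <= 1 - `|cx q|].

(** The function [phi] is at most 0 exactly on the standard triangle. By compactness it has a
    positive minimum on the segment, whereas a point that is not [outside] for [eps] has [phi] below
    [eps]. *)
Lemma avoids_disjoint u v : (forall q, seg u v q -> ~ std_tri q) -> avoids (seg u v).
Proof.
move=> dis.
pose pt (t : R) := (1 - t) *: u + t *: v.
pose phi (t : R) := Num.max `|cz (pt t)| (Num.max (- cy (pt t)) (cy (pt t) + `|cx (pt t)| - 1)).
have cpt (f : point -> R) : (forall p q, f (p + q) = f p + f q) ->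
    (forall k p, f (k *: p) = k * f p) -> continuous (fun t => f (pt t)).
  move=> fD fZ t; rewrite /pt.
  have -> : (fun t => f ((1 - t) *: u + t *: v)) = (fun t : R => (1 - t) * f u + t * f v).
    by apply/funext => r; rewrite fD !fZ.
  apply: cvgD; apply: cvgM; try exact: cvg_cst; last exact: cvg_id.
  by apply: cvgB; [exact: cvg_cst|exact: cvg_id].
have cphi : continuous phi.
  have cX := cpt _ (@cxD R) (@cxZ R).
  have cY := cpt _ (@cyD R) (@cyZ R).
  have cZ := cpt _ (@czD R) (@czZ R).
  apply: continuous_maxr; first by move=> t; apply: cvg_norm; exact: cZ.
  apply: continuous_maxr; first by move=> t; apply: cvgN; exact: cY.
  move=> t; apply: cvgB; last exact: cvg_cst.
  by apply: cvgD; [exact: cY|apply: cvg_norm; exact: cX].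
have [||t0 t01 tmin] := @EVT_min R phi 0 1; first exact: ler01.
  by apply: continuous_subspaceT.
have sp t : t \in `[0, 1]%R -> seg u v (pt t).
  by rewrite in_itv /= => t1; exists t.
have pos : 0 < phi t0.
  rewrite ltNge; apply/negP; rewrite !ge_max => /and3P[z0 y0 xy0].
  apply: (dis _ (sp _ t01)); split; [|lra|lra].
  by apply/eqP; rewrite -normr_eq0 eq_le z0 normr_ge0.
exists (phi t0) => // eps /andP[e0 ele] q [t t1 ->]; rewrite -/(pt t).
have := tmin t; rewrite in_itv /= => /(_ t1) => le0.
case: (leP (cy (pt t)) (- (eps * tau eps (pt t)))) => o1; first by left.
case: (leP ((1 + eps) * tau eps (pt t)) (cy (pt t))) => o2; first by right.
exfalso.
have T0 := tau_ge0 eps (pt t).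
have tpos : 0 < tau eps (pt t).
  rewrite lt_neqAle T0 andbT; apply/eqP => E; rewrite -E in o1 o2; lra.
have tE : tau eps (pt t) = 1 - `|cx (pt t)| - `|cz (pt t)| / eps.
  by apply: max_r; rewrite ltW //; move: tpos; rewrite lt_max ltxx.
have zz : 0 <= `|cz (pt t)| / eps by rewrite divr_ge0 // ltW.
have xx := normr_ge0 (cx (pt t)).
have et : eps * tau eps (pt t) <= eps by apply: ler_piMr; lra.
have zlt : `|cz (pt t)| < eps.
  by rewrite -[ltRHS]mul1r -ltr_pdivrMr //; lra.
suff : phi t < eps by lra.
by rewrite !gt_max zlt /=; apply/andP; split; lra.
Qed.

(** Along the segment [tau] is at most [t * al], and the coordinates are linear in [t] as well.
    Comparing slopes shows how the segment leaves the moving region: to the left, out of the plane,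
    below or above. *)
Lemma avoids_left v : let a := mkpt (-1) 0 0 in
  (forall q, seg a v q -> std_tri q -> q = a) -> avoids (seg a v).
Proof.
move=> a dis.
pose al := cx v + 1.
have cxq t : cx ((1 - t) *: a + t *: v) = -1 + t * al by rewrite !cE /al; ring.
have cyq t : cy ((1 - t) *: a + t *: v) = t * cy v by rewrite !cE; ring.
have czq t : cz ((1 - t) *: a + t *: v) = t * cz v by rewrite !cE; ring.
have tle eps t : 0 < eps -> 0 <= t -> 0 <= al ->
    tau eps ((1 - t) *: a + t *: v) <= t * al.
  move=> e0 t0 a0; apply: le_trans (tau_le _ e0) _; rewrite cxq ge_max mulr_ge0 //=.
  by have := ler_norm (- (-1 + t * al)); rewrite normrN; lra.
have out0 eps q : tau eps q = 0 -> outside eps q.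
  by move=> E; rewrite /outside E !mulr0 oppr0; apply/orP; exact: le_total.
case: (leP al 0) => al0.
  exists 1 => // eps /andP[e0 _] _ [t /andP[t0 t1] ->]; apply: out0.
  apply: le_anti; rewrite tau_ge0 andbT; apply: le_trans (tau_le _ e0) _.
  rewrite cxq ge_max lexx /=.
  have : t * al <= 0 by rewrite mulr_ge0_le0.
  by have := ler_norm (- (-1 + t * al)); rewrite normrN; lra.
have [z0|z0] := eqVneq (cz v) 0; last first.
  exists (`|cz v| / al) => [|eps /andP[e0 el] _ [t /andP[t0 t1] ->]].
    by rewrite divr_gt0 // normr_gt0.
  apply: out0; apply: max_l; rewrite cxq czq normrM (ger0_norm t0).
  have : t * al <= t * `|cz v| / eps.
    rewrite -mulrA; apply: ler_wpM2l => //.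
    by rewrite ler_pdivlMr // mulrC -ler_pdivlMr.
  by have := ler_norm (- (-1 + t * al)); rewrite normrN; lra.
case: (ltP (cy v) 0) => y0.
  exists (- cy v / al) => [|eps /andP[e0 el] _ [t /andP[t0 t1] ->]].
    by rewrite divr_gt0 //; lra.
  left; rewrite cyq; have := tle eps t e0 t0 (ltW al0).
  move: (tau _ _) => T Tle; rewrite ler_pdivlMr // in el.
  have : eps * T <= eps * (t * al) by rewrite ler_wpM2l // ltW.
  have : t * (eps * al) <= t * - cy v by rewrite ler_wpM2l.
  by lra.
case: (ltP al (cy v)) => y1.
  exists ((cy v - al) / al) => [|eps /andP[e0 el] _ [t /andP[t0 t1] ->]].
    by rewrite divr_gt0 //; lra.
  right; rewrite cyq; have := tle eps t e0 t0 (ltW al0).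
  move: (tau _ _) => T Tle; rewrite ler_pdivlMr // in el.
  have : (1 + eps) * T <= (1 + eps) * (t * al) by rewrite ler_wpM2l //; lra.
  have : t * (eps * al) <= t * (cy v - al) by rewrite ler_wpM2l.
  by lra.
exfalso.
(* All other slopes point into the triangle. This parameter keeps the x-coordinate at most 0, hence
   under the left side of the tent, and gives a second common point. *)
pose t0 := Num.min 1 al^-1.
have t00 : 0 < t0 by rewrite lt_min ltr01 invr_gt0.
have t01 : t0 <= 1 by rewrite ge_min lexx.
have ta : t0 * al <= 1.
  have : t0 <= al^-1 by rewrite ge_min lexx orbT.
  by rewrite -[X in _ <= X -> _]mul1r -ler_pdivlMr ?invr_gt0 // invrK div1r -ler_pdivlMr ?div1r ?invr_gt0 // invrK.
have tapos : 0 < t0 * al by rewrite mulr_gt0.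
have E : (1 - t0) *: a + t0 *: v = a.
  apply: dis; first by exists t0; rewrite // t01 ltW.
  split; rewrite ?cxq ?cyq ?czq ?z0 ?mulr0 //; first by rewrite mulr_ge0 // ltW.
  have : t0 * cy v <= t0 * al by rewrite ler_pM2l.
  by rewrite ler0_norm; lra.
by move/(congr1 (@cx R)): E; rewrite cxq !cE; lra.
Qed.

Lemma avoids_right v : let c := mkpt 1 0 0 in
  (forall q, seg c v q -> std_tri q -> q = c) -> avoids (seg c v).
Proof.
move=> c dis; pose r q := mkpt (- cx q) (cy q) (cz q).
have rK q : r (r q) = q by apply: pointP; rewrite !cE ?opprK.
have rT q : std_tri q -> std_tri (r q) by rewrite /std_tri !cE normrN.
have rl u w t : r ((1 - t) *: u + t *: w) = (1 - t) *: r u + t *: r w.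
  by apply: pointP; rewrite !cE //; ring.
have rc : r (mkpt (-1) 0 0) = c by apply: pointP; rewrite !cE ?opprK.
have [|e0 e00 h] := @avoids_left (r v).
  move=> q [t t01 qE] Tq; rewrite -(rK q) -(rK (mkpt _ _ _)) rc; congr r.
  apply: dis; last exact: rT.
  by exists t => //; rewrite qE rl rc rK.
exists e0 => // eps he q [t t01 qE].
have : outside eps (r q).
  by apply: h => //; exists t => //; rewrite qE rl -rc rK.
by rewrite /outside /tau !cE normrN.
Qed.

Definition tent : set point := [set x | exists2 t, `|t| <= 1 & x = mkpt t (1 - `|t|) 0].
Definition tent_base : set point := [set x | exists2 t, `|t| <= 1 & x = mkpt t 0 0].

Lemma delta_std (K1 K2 : set point) : avoids K1 -> avoids K2 ->
  isotopic (tent `|` K1) K2 (tent_base `|` K1) K2.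
Proof.
move=> [e1 e10 h1] [e2 e20 h2]; pose eps := Num.min e1 e2.
have e0 : 0 < eps by rewrite lt_min e10.
pose f q := mkpt (cx q) (squash eps q) (cz q).
have fK q : outside eps q -> f q = q by move=> o; rewrite /f squash_id // -mkpt_eta.
have f1 : f @` K1 = K1.
  have o q : K1 q -> outside eps q by apply: h1; rewrite e0 ge_min lexx.
  apply/seteqP; split=> [_ [q Kq <-]|q Kq]; first by rewrite fK //; exact: o.
  by exists q => //; rewrite fK //; exact: o.
have f2 : f @` K2 = K2.
  have o q : K2 q -> outside eps q by apply: h2; rewrite e0 ge_min lexx orbT.
  apply/seteqP; split=> [_ [q Kq <-]|q Kq]; first by rewrite fK //; exact: o.
  by exists q => //; rewrite fK //; exact: o.
have fa : f @` tent = tent_base.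
  apply/seteqP; split=> [_ [_ [t t1 ->] <-]|_ [t t1 ->]].
    by exists t => //; rewrite /f squash_arc // !c_mkpt.
  exists (mkpt t (1 - `|t|) 0); first by exists t.
  by rewrite /f squash_arc // !c_mkpt.
rewrite -fa -{2}f1 -{2}f2 -image_setU.
apply: (@fibrewise_isotopy R (squash eps) (1 + 2 * eps)).
- exact: squash_continuous.
- by move=> *; exact: squash_mono.
- by move=> q; exact: squash_bound.
Qed.

End DeltaMove.

(** * Affine frames *)

Section Frames.
Variable R : realType.
Notation point := 'rV[R]_3.
Implicit Types (a b c p q u v : point) (e : point * point) (s : seq (point * point)).

Lemma cx0 : cx (0 : point) = 0. Proof. by rewrite /cx mxE. Qed.
Lemma cy0 : cy (0 : point) = 0. Proof. by rewrite /cy mxE. Qed.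
Lemma cz0 : cz (0 : point) = 0. Proof. by rewrite /cz mxE. Qed.
Definition cE0 := (cx0, cy0, cz0, cE).

Definition nondeg a b c : Prop := forall l m n : R,
  l + m + n = 0 -> l *: a + m *: b + n *: c = 0 -> [/\ l = 0, m = 0 & n = 0].

Definition dot p q : R := cx p * cx q + cy p * cy q + cz p * cz q.
Definition cross p q : point :=
  mkpt (cy p * cz q - cz p * cy q) (cz p * cx q - cx p * cz q) (cx p * cy q - cy p * cx q).

Lemma dot_self_eq0 p : dot p p = 0 -> p = 0.
Proof.
rewrite /dot -!expr2 => E.
have := sqr_ge0 (cx p); have := sqr_ge0 (cy p); have := sqr_ge0 (cz p) => hz hy hx.
have x0 : cx p ^+ 2 = 0 by lra.
have y0 : cy p ^+ 2 = 0 by lra.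
have z0 : cz p ^+ 2 = 0 by lra.
by apply: pointP; rewrite cE0; apply/eqP; rewrite -sqrf_eq0 ?x0 ?y0 ?z0.
Qed.

Lemma nondeg_cross a b c : nondeg a b c -> cross (b - a) (c - a) <> 0.
Proof.
move=> nd E.
have h (s t : R) : s *: (b - a) + t *: (c - a) = 0 -> s = 0 /\ t = 0.
  move=> st; have [||_ s0 t0] := nd (- s - t) s t; [by ring| |by []].
  by rewrite -st; apply: pointP; rewrite !cE; ring.
(* When the cross product is zero, [k (c - a)] and [- k (b - a)] are the coefficients of a linear
   relation between b - a and c - a, for each coordinate [k]. *)
have g (k : point -> R) : k = @cx R \/ k = @cy R \/ k = @cz R -> k (b - a) = 0.
  move=> hk; have [|_ /eqP] := h (k (c - a)) (- k (b - a)); last by rewrite oppr_eq0 => /eqP.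
  have := congr1 (@cx R) E; have := congr1 (@cy R) E; have := congr1 (@cz R) E.
  by rewrite !cE0 => e1 e2 e3; apply: pointP; case: hk => [->|[->|->]]; rewrite !cE0; lra.
have b0 : b - a = 0 by apply: pointP; rewrite cx0 + rewrite cy0 + rewrite cz0; apply: g; tauto.
have [|/eqP] := h 1 0; last by rewrite oner_eq0.
by rewrite b0 scaler0 scale0r addr0.
Qed.

Lemma dot_affine (l k r D : R) p q u v w : l + k + r = 1 ->
  dot (l *: p + k *: q + r *: u - v) w / D =
  l * (dot (p - v) w / D) + k * (dot (q - v) w / D) + r * (dot (u - v) w / D).
Proof.
move=> S; have lE : l = 1 - k - r by lra.
by rewrite lE !mulrA -!mulrDl; congr (_ / _); rewrite /dot !cE; ring.
Qed.

Lemma cross_frame u v p : let n := cross u v in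
  dot p (cross v n) *: u + (dot p (cross n u) *: v + dot p n *: n) = dot n n *: p.
Proof. by apply: pointP; rewrite /dot /cross !cE; ring. Qed.

(** The frame has its origin at the midpoint of [a] and [c], axes from there to [c] and to [b], and
    their cross product as third axis; the coordinates come from Cramer's rule. *)
Lemma std_frame a b c : nondeg a b c ->
  exists A : point -> point,
    [/\ homeomorphism A,
        forall (l m n : R) p q r, l + m + n = 1 ->
          A (l *: p + m *: q + n *: r) = l *: A p + m *: A q + n *: A r,
        A a = mkpt (-1) 0 0, A b = mkpt 0 1 0 & A c = mkpt 1 0 0].
Proof.
move=> nd; have := nondeg_cross nd.
have -> : cross (b - a) (c - a) = (-2) *: cross (2^-1 *: (c - a)) (b - 2^-1 *: (a + c)).
  by apply: pointP; rewrite !cE; field.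
set m := 2^-1 *: (a + c); set u := 2^-1 *: (c - a); set w := b - m.
set n := cross u w => n0.
have N0 : dot n n != 0.
  by apply/eqP => /dot_self_eq0 E; apply: n0; rewrite E scaler0.
pose wn := cross w n; pose nu := cross n u.
pose A q := mkpt (dot (q - m) wn / dot n n) (dot (q - m) nu / dot n n) (dot (q - m) n / dot n n).
pose B q := m + cx q *: u + cy q *: w + cz q *: n.
have cdot (v p : point) : continuous (fun q => dot (q - v) p / dot n n).
  have -> : (fun q => dot (q - v) p / dot n n) = (fun q => (cx q - cx v) * (cx p / dot n n) +
      (cy q - cy v) * (cy p / dot n n) + (cz q - cz v) * (cz p / dot n n)).
    by apply/funext => q; rewrite {1}/dot !cE; ring.
  have cl (f : point -> R) k l : continuous f -> continuous (fun q => (f q - k) * l).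
    move=> cf q; apply: (cvgM (cvgB (cf q) (@cst_continuous _ _ k q)) (@cst_continuous _ _ l q)).
  move=> q.
  exact: (cvgD (cvgD (cl _ _ _ (@cx_continuous R) q) (cl _ _ _ (@cy_continuous R) q))
               (cl _ _ _ (@cz_continuous R) q)).
have AB : cancel B A.
  move=> q; rewrite /A /B; apply: pointP; rewrite !c_mkpt.
  - rewrite (_ : dot _ wn = cx q * dot n n) ?mulfK //.
    by rewrite /dot /wn /n /cross !cE; ring.
  - rewrite (_ : dot _ nu = cy q * dot n n) ?mulfK //.
    by rewrite /dot /nu /n /cross !cE; ring.
  - rewrite (_ : dot _ n = cz q * dot n n) ?mulfK //.
    by rewrite /dot /n /cross !cE; ring.
have BA : cancel A B.
  move=> q; rewrite /A /B !c_mkpt; set d := q - m.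
  have -> : q = m + d by rewrite /d addrC subrK.
  rewrite -!addrA; congr (_ + _).
  have k (x : R) (p : point) : (x / dot n n) *: p = (dot n n)^-1 *: (x *: p).
    by rewrite scalerA mulrC.
  rewrite !k -!scalerDr; apply: (scalerI N0); rewrite scalerA divff // scale1r.
  exact: cross_frame.
exists A; split.
- exists B; split=> //.
    by move=> q; exact: (cvg_mkpt (cdot m wn q) (cdot m nu q) (cdot m n q)).
  have -> : B = (fun q => mkpt (cx m + cx q * cx u + cy q * cx w + cz q * cx n)
      (cx m * 0 + cy m + cx q * cy u + cy q * cy w + cz q * cy n)
      (cz m + cx q * cz u + cy q * cz w + cz q * cz n)).
    by apply/funext => q; apply: pointP; rewrite /B !cE ?mulr0 ?add0r.
  have cl (k0 k1 k2 k3 : R) : continuous (fun q : point => k0 + cx q * k1 + cy q * k2 + cz q * k3).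
    have cm (f : point -> R) k : continuous f -> continuous (fun q => f q * k).
      by move=> cf q; exact: (cvgM (cf q) (@cst_continuous _ _ k q)).
    move=> q; exact: (cvgD (cvgD (cvgD (@cst_continuous _ _ k0 q) (cm _ k1 (@cx_continuous R) q))
      (cm _ k2 (@cy_continuous R) q)) (cm _ k3 (@cz_continuous R) q)).
  by move=> q; exact: (cvg_mkpt (cl _ _ _ _ q) (cl _ _ _ _ q) (cl _ _ _ _ q)).
- by move=> l k r p q t S; apply: pointP; rewrite /A !cE; exact: dot_affine.
- by rewrite -[RHS]AB; congr A; apply: pointP; rewrite /B /w /u /m !cE; field.
- by rewrite -[RHS]AB; congr A; apply: pointP; rewrite /B /w /u /m !cE; field.
- by rewrite -[RHS]AB; congr A; apply: pointP; rewrite /B /w /u /m !cE; field.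
Qed.

End Frames.

(** * Corner cuts at an arbitrary triangle *)

Section Moves.
Variable R : realType.
Notation point := 'rV[R]_3.
Implicit Types (a b c d p q u v w : point) (e : point * point) (s : seq (point * point)).

(** The second case admits the edges of the link that end at [a] or [c]; naming the touching end [w]
    covers both orientations of [e]. *)
Definition clear a b c e : Prop :=
  (forall q, seg e.1 e.2 q -> ~ tri a b c q) \/
  exists w v, [/\ seg e.1 e.2 = seg w v, w = a \/ w = c &
    forall q, seg w v q -> tri a b c q -> q = w].

Lemma image_seg (A : point -> point) u v :
  (forall (l m n : R) p q r, l + m + n = 1 ->
     A (l *: p + m *: q + n *: r) = l *: A p + m *: A q + n *: A r) ->
  A @` seg u v = seg (A u) (A v).
Proof.
move=> lA; have l2 (t : R) : A ((1 - t) *: u + t *: v) = (1 - t) *: A u + t *: A v.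
  by have := lA (1 - t) t 0 u v v; rewrite !scale0r !addr0; apply; ring.
apply/seteqP; split=> [_ [_ [t t01 ->] <-]|_ [t t01 ->]]; first by exists t; rewrite ?l2.
by exists ((1 - t) *: u + t *: v); [exists t|rewrite l2].
Qed.

Lemma image_segs (A : point -> point) s :
  (forall (l m n : R) p q r, l + m + n = 1 ->
     A (l *: p + m *: q + n *: r) = l *: A p + m *: A q + n *: A r) ->
  A @` segs s = segs [seq (A e.1, A e.2) | e <- s].
Proof.
move=> lA; apply/seteqP; split=> [_ [x [e es ex] <-]|x [_ /mapP[e es ->]] /=].
  by exists (A e.1, A e.2); [exact: map_f|rewrite /= -image_seg //; exists x].
by rewrite -image_seg // => -[y ey <-]; exists y => //; exists e.
Qed.

Lemma seg_arc : seg (mkpt (-1) 0 0) (mkpt 0 1 0) `|` seg (mkpt 0 1 0) (mkpt 1 0 0) = @tent R.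
Proof.
apply/seteqP; split=> [x|_ [t t1 ->]].
  move=> [[t /andP[t0 t1] ->]|[t /andP[t0 t1] ->]].
    exists (t - 1); first by rewrite ler0_norm; lra.
    by rewrite ler0_norm; last lra; apply: pointP; rewrite !cE; ring.
  exists t; first by rewrite ger0_norm.
  by rewrite ger0_norm //; apply: pointP; rewrite !cE; ring.
rewrite ler_norml in t1; case: (leP 0 t) => t0; [right|left].
  by exists t; [lra|rewrite ger0_norm //; apply: pointP; rewrite !cE; ring].
by exists (t + 1); [lra|rewrite ltr0_norm //; apply: pointP; rewrite !cE; ring].
Qed.

Lemma seg_base : seg (mkpt (-1) 0 0) (mkpt 1 0 0) = @tent_base R.
Proof.
apply/seteqP; split=> [_ [t /andP[t0 t1] ->]|_ [t t1 ->]].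
  exists (2 * t - 1); first by rewrite ler_norml; lra.
  by apply: pointP; rewrite !cE; ring.
rewrite ler_norml in t1; exists ((t + 1) / 2); first by lra.
by apply: pointP; rewrite !cE; field.
Qed.

Lemma delta_move a b c s1 s2 : nondeg a b c ->
  (forall e, e \in s1 ++ s2 -> clear a b c e) ->
  isotopic (seg a b `|` seg b c `|` segs s1) (segs s2) (seg a c `|` segs s1) (segs s2).
Proof.
move=> nd cl; have [A [hA lA Aa Ab Ac]] := std_frame nd.
have [B [AB BA _ _]] := hA.
apply: (isotopic_conj hA).
rewrite !image_setU !image_seg // !image_segs // Aa Ab Ac seg_arc seg_base.
have triA q : std_tri (A q) -> tri a b c q.
  move=> [z0 y0 xy]; exists ((1 - cx (A q) - cy (A q)) / 2), (cy (A q)), ((1 + cx (A q) - cy (A q)) / 2).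
  move: xy; rewrite lerBrDr addrC -lerBrDr ler_norml => /andP[x1 x2].
  split; [lra|by []|lra|by field|].
  apply: (can_inj AB); rewrite lA; last by field.
  by rewrite Aa Ab Ac; apply: pointP; rewrite !cE ?z0; field.
suff H e : e \in s1 ++ s2 -> avoids (seg (A e.1) (A e.2)).
  by apply: delta_std; apply: avoids_segs => _ /mapP[e es ->] /=; apply: H;
    rewrite mem_cat es ?orbT.
move=> /cl [dis|[w [v [ewv wac h]]]].
  apply: avoids_disjoint => q; rewrite -image_seg // => -[x ex <-] /triA.
  exact: dis.
have -> : seg (A e.1) (A e.2) = seg (A w) (A v).
  by rewrite -!image_seg //; congr image.
have h' q : seg (A w) (A v) q -> std_tri q -> q = A w.
  by rewrite -image_seg // => -[x wx <-] /triA /(h _ wx) ->.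
by case: wac h' => ->; rewrite ?Aa ?Ac => h'; [exact: avoids_left|exact: avoids_right].
Qed.

End Moves.

(** * Volumes, and moving one vertex of a triangle *)

Section Triangles.
Variable R : realType.
Notation point := 'rV[R]_3.
Implicit Types (a b c d k p q u v w : point) (e : point * point) (s : seq (point * point)).

(** Six times the signed volume of the tetrahedron abcd. *)
Definition vol a b c d : R := dot (cross (b - a) (c - a)) (d - a).

Lemma vol_rot a b c d : vol b c a d = vol a b c d.
Proof. by rewrite /vol /dot /cross !cE; ring. Qed.
Lemma vol_swap a b c d : vol b a c d = - vol a b c d.
Proof. by rewrite /vol /dot /cross !cE; ring. Qed.
Lemma vol_last a b c d : vol a b d c = - vol a b c d.
Proof. by rewrite /vol /dot /cross !cE; ring. Qed.

Lemma vol_indep a b c d (l m n r : R) : vol a b c d != 0 -> l + m + n + r = 0 ->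
  l *: a + m *: b + n *: c + r *: d = 0 -> [/\ l = 0, m = 0, n = 0 & r = 0].
Proof.
have H a' b' c' d' (l' m' n' r' : R) : vol a' b' c' d' != 0 -> l' + m' + n' + r' = 0 ->
    l' *: a' + m' *: b' + n' *: c' + r' *: d' = 0 -> r' = 0.
  move=> v0 S E; have lE : l' = - m' - n' - r' by lra.
  apply/eqP; rewrite -(mulIr_eq0 _ (mulIf v0)); apply/eqP.
  have -> : r' * vol a' b' c' d' = dot (cross (b' - a') (c' - a'))
      (l' *: a' + m' *: b' + n' *: c' + r' *: d').
    by rewrite lE /vol /dot /cross !cE; ring.
  by rewrite E /dot !cE0; ring.
move=> v0 S E; split.
- apply: (H d b c a r m n l); rewrite ?(addrC r) ?(addrC _ l) //.
  + by rewrite (_ : vol d b c a = - vol a b c d) ?oppr_eq0 //; rewrite /vol /dot /cross !cE; ring.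
  + by lra.
  + by rewrite -E; apply: pointP; rewrite !cE; ring.
- apply: (H a d c b l r n m).
  + by rewrite (_ : vol a d c b = - vol a b c d) ?oppr_eq0 //; rewrite /vol /dot /cross !cE; ring.
  + by lra.
  + by rewrite -E; apply: pointP; rewrite !cE; ring.
- apply: (H a b d c l m r n).
  + by rewrite vol_last oppr_eq0.
  + by lra.
  + by rewrite -E; apply: pointP; rewrite !cE; ring.
- exact: (H a b c d l m n r).
Qed.

Lemma vol_nondeg a b c d : vol a b c d != 0 -> nondeg a b c.
Proof.
move=> v0 l m n S E; have [||] := @vol_indep a b c d l m n 0 v0; [by rewrite addr0| |by []].
by rewrite scale0r addr0.
Qed.

Lemma seg_tri_vol w x y v q : vol w x y v != 0 -> seg w v q -> tri w x y q -> q = w.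
Proof.
move=> v0 [t t01 ->] [l [m [n [l0 m0 n0 S E]]]].
have [||_ _ _ t0] := @vol_indep w x y v (1 - t - l) (- m) (- n) t v0; first by lra.
  rewrite (_ : _ + _ + _ + _ = (1 - t) *: w + t *: v - (l *: w + m *: x + n *: y)).
    by rewrite E subrr.
  by apply: pointP; rewrite !cE; ring.
by rewrite t0 subr0 scale1r scale0r addr0.
Qed.

Lemma triC a b c : tri a b c = tri b a c.
Proof.
suff H a' b' c' x : tri a' b' c' x -> tri b' a' c' x by apply/seteqP; split=> x; exact: H.
move=> [l [m [n [l0 m0 n0 S ->]]]]; exists m, l, n; split=> //; first by lra.
by rewrite [m *: _ + _]addrC.
Qed.

Lemma tri_rot a b c : tri a b c = tri b c a.
Proof.
apply/seteqP; split=> x [l [m [n [l0 m0 n0 S ->]]]].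
  by exists m, n, l; split=> //; [lra|rewrite -addrA addrC].
by exists n, l, m; split=> //; [lra|rewrite addrC addrA].
Qed.

Lemma delta_segs a b c s1 s2 : nondeg a b c ->
  (forall e, e \in s1 ++ s2 -> clear a b c e) ->
  isotopic (segs ((a, b) :: (b, c) :: s1)) (segs s2) (segs ((a, c) :: s1)) (segs s2).
Proof. by move=> nd cl; rewrite !segs_cons setUA; exact: delta_move. Qed.

Lemma segs_sub s s' :
  (forall e, e \in s -> e \in s' \/ (e.2, e.1) \in s') -> segs s `<=` segs s'.
Proof.
move=> h x [e es ex]; case: (h e es) => e'; first by exists e.
by exists (e.2, e.1) => //=; rewrite segC.
Qed.

Definition bd a b c : seq (point * point) := [:: (a, b); (b, c); (c, a)].

Lemma bd_rot a b c : segs (bd a b c) = segs (bd b c a).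
Proof.
by apply/seteqP; split; apply: segs_sub => e; rewrite !inE => /or3P[] /eqP -> /=; left;
  rewrite ?eqxx ?orbT.
Qed.

Lemma bd_swap a b c : segs (bd a b c) = segs (bd b a c).
Proof.
by apply/seteqP; split; apply: segs_sub => e; rewrite !inE => /or3P[] /eqP -> /=; right;
  rewrite ?eqxx ?orbT.
Qed.

(** Two corner cuts: [a'] is inserted in the side ca, which is a cut run backwards, and then [a] is
    cut off. The nonzero volume makes the remaining sides of the polygon meet each filled triangle
    in a corner only. *)
Lemma move_vertex a b c a' s : vol a b c a' != 0 ->
  (forall e, e \in s -> forall q, seg e.1 e.2 q -> ~ tri c a' a q /\ ~ tri a' a b q) ->
  isotopic (segs (bd a b c)) (segs s) (segs (bd a' b c)) (segs s).
Proof.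
move=> v0 dis.
have v1 : vol c a' a b != 0.
  by rewrite (_ : vol c a' a b = vol a b c a') //; rewrite /vol /dot /cross !cE; ring.
have v2 : vol a' a b c != 0.
  by rewrite (_ : vol a' a b c = - vol a b c a') ?oppr_eq0 //; rewrite /vol /dot /cross !cE; ring.
apply: (@isotopic_trans _ _ _ (segs [:: (c, a'); (a', a); (a, b); (b, c)]) (segs s)).
  have -> : segs (bd a b c) = segs [:: (c, a); (a, b); (b, c)] by rewrite -bd_rot -bd_rot.
  apply: isotopic_sym; apply: delta_segs; first exact: vol_nondeg v1.
  move=> e; rewrite !inE => /or3P[/eqP ->|/eqP ->|es] /=.
  - right; exists a, b; split; [by []|by right|move=> q].
    rewrite tri_rot tri_rot; apply: seg_tri_vol.
    by rewrite (_ : vol a c a' b = vol a b c a') //; rewrite /vol /dot /cross !cE; ring.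
  - right; exists c, b; split; [exact: segC|by left|move=> q].
    exact: seg_tri_vol.
  - by left=> q /(dis _ es)[].
have -> : segs [:: (c, a'); (a', a); (a, b); (b, c)] = segs [:: (a', a); (a, b); (b, c); (c, a')].
  by apply/seteqP; split; apply: segs_sub => e; rewrite !inE => /or4P[] /eqP -> /=; left;
    rewrite ?eqxx ?orbT.
have -> : segs (bd a' b c) = segs [:: (a', b); (b, c); (c, a')] by [].
apply: delta_segs; first exact: vol_nondeg v2.
move=> e; rewrite !inE => /or3P[/eqP ->|/eqP ->|es] /=.
- right; exists b, c; split; [by []|by right|move=> q].
  rewrite tri_rot tri_rot; apply: seg_tri_vol.
  by rewrite (_ : vol b a' a c = - vol a b c a') ?oppr_eq0 //; rewrite /vol /dot /cross !cE; ring.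
- right; exists a', c; split; [exact: segC|by left|move=> q].
  exact: seg_tri_vol.
- by left=> q /(dis _ es)[].
Qed.

(* An affine functional is given by its gradient and its constant term. *)
Definition aff (f : point * R) q : R := dot f.1 q + f.2.

Lemma aff_comb f (l m n : R) p q w : l + m + n = 1 ->
  aff f (l *: p + m *: q + n *: w) = l * aff f p + m * aff f q + n * aff f w.
Proof.
move=> S; have lE : l = 1 - m - n by lra.
by rewrite lE /aff /dot !cE; ring.
Qed.

Lemma tri_neg f a b c q : aff f a < 0 -> aff f b < 0 -> aff f c < 0 ->
  tri a b c q -> aff f q < 0.
Proof.
move=> a0 b0 c0 [l [m [n [l0 m0 n0 S ->]]]]; rewrite aff_comb //.
have h (x y : R) : 0 <= x -> y < 0 -> x * y <= 0 by move=> x0 y0; exact: (mulr_ge0_le0 x0 (ltW y0)).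
have := h _ _ l0 a0; have := h _ _ m0 b0; have := h _ _ n0 c0.
move=> hn hm hl; have [l1|l1] := ltP 0 l.
  have hl' : l * aff f a < 0 by rewrite pmulr_rlt0.
  by lra.
have [m1|m1] := ltP 0 m.
  have hm' : m * aff f b < 0 by rewrite pmulr_rlt0.
  by lra.
have hn' : n * aff f c < 0 by rewrite pmulr_rlt0 //; lra.
by lra.
Qed.

Lemma seg_nonneg f u v q : 0 <= aff f u -> 0 <= aff f v -> seg u v q -> 0 <= aff f q.
Proof.
move=> u0 v0 [t /andP[t0 t1] ->]; have := @aff_comb f (1 - t) t 0 u v v.
rewrite !scale0r !addr0 mul0r addr0 => ->; last by ring.
by rewrite addr_ge0 // mulr_ge0 //; lra.
Qed.

Definition nonneg f s := forall e, e \in s -> 0 <= aff f e.1 /\ 0 <= aff f e.2.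

Lemma move_vertex_aff f a b c a' s : vol a b c a' != 0 ->
  aff f a < 0 -> aff f b < 0 -> aff f c < 0 -> aff f a' < 0 -> nonneg f s ->
  isotopic (segs (bd a b c)) (segs s) (segs (bd a' b c)) (segs s).
Proof.
move=> v0 a0 b0 c0 a'0 ns; apply: move_vertex => // e es q eq.
have [e1 e2] := ns _ es; have := seg_nonneg e1 e2 eq => q0.
by split=> tq; [have := tri_neg c0 a'0 a0 tq|have := tri_neg a'0 a0 b0 tq]; rewrite ltNge q0.
Qed.

End Triangles.

(** * Pairs of triangles separated by a plane *)

Section Standardization.
Variable R : realType.
Notation point := 'rV[R]_3.
Implicit Types (a b c d k p q u v w : point) (e : point * point) (s : seq (point * point)).
Implicit Types (f g : point * R).

Lemma dotDr p q w : dot p (q + w) = dot p q + dot p w.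
Proof. by rewrite /dot !cE; ring. Qed.
Lemma dotZr p q (t : R) : dot p (t *: q) = t * dot p q.
Proof. by rewrite /dot !cE; ring. Qed.
Lemma dotC p q : dot p q = dot q p.
Proof. by rewrite /dot; ring. Qed.

Lemma transverse_vector n n' : n <> 0 -> n' <> 0 ->
  exists v, dot n v != 0 /\ dot n' v != 0.
Proof.
have nz (x : point) : x <> 0 -> dot x x != 0.
  by move=> x0; apply/eqP => /dot_self_eq0.
move=> /nz n0 /nz n'0; case: (eqVneq (dot n' n) 0) => [E|E]; last by exists n.
by exists (n + n'); rewrite !dotDr E (dotC n n') E addr0 add0r.
Qed.

(** The point moves away from [a] in a direction transverse to both planes. The first volume
    vanishes only at time 0 and the second at most once, so one of the times [e0] and [e0 / 2] is
    good. *)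
Lemma generic_point f a b c a' b' c' : nondeg a b c -> nondeg a' b' c' -> aff f a < 0 ->
  exists p, [/\ aff f p < 0, vol a b c p != 0 & vol a' b' c' p != 0].
Proof.
move=> /nondeg_cross n0 /nondeg_cross n'0 a0.
have [v [v0 v'0]] := transverse_vector n0 n'0.
pose D := `|dot f.1 v| + 1.
have D0 : 0 < D by rewrite /D ltr_wpDl.
pose e0 := - aff f a / D.
have e00 : 0 < e0 by rewrite divr_gt0 // oppr_gt0.
have fE (t : R) : aff f (a + t *: v) = aff f a + t * dot f.1 v.
  by rewrite /aff dotDr dotZr; ring.
have ok (t : R) : 0 < t -> t <= e0 -> aff f (a + t *: v) < 0.
  move=> t0; rewrite fE /e0 ler_pdivlMr // /D mulrDr mulr1 => h.
  have : t * dot f.1 v <= t * `|dot f.1 v| by rewrite ler_pM2l // ler_norm.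
  by lra.
have vE (t : R) : vol a b c (a + t *: v) = t * dot (cross (b - a) (c - a)) v.
  by rewrite /vol /dot !cE; ring.
have v'E (t : R) : vol a' b' c' (a + t *: v) = vol a' b' c' a + t * dot (cross (b' - a') (c' - a')) v.
  by rewrite /vol /dot !cE; ring.
case: (eqVneq (vol a' b' c' (a + e0 *: v)) 0) => [E|E].
  exists (a + (e0 / 2) *: v); split; first by apply: ok; lra.
    by rewrite vE mulf_neq0 // gt_eqF //; lra.
  rewrite v'E; apply/eqP => E2; rewrite v'E in E.
  have : e0 / 2 * dot (cross (b' - a') (c' - a')) v = 0 by lra.
  by apply/eqP; rewrite mulf_neq0 // gt_eqF //; lra.
exists (a + e0 *: v); split=> //; first exact: ok.
by rewrite vE mulf_neq0 // gt_eqF.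
Qed.

Definition tneg f a b c : Prop := [/\ aff f a < 0, aff f b < 0 & aff f c < 0].

(** Both triangles receive the same new vertex, and the triples are rotated so that three steps
    replace every vertex. *)
Lemma transport_step f a b c a' b' c' s : nondeg a b c -> nondeg a' b' c' ->
  tneg f a b c -> tneg f a' b' c' -> nonneg f s ->
  exists p, [/\ isotopic (segs (bd a b c)) (segs s) (segs (bd b c p)) (segs s),
      isotopic (segs (bd a' b' c')) (segs s) (segs (bd b' c' p)) (segs s),
      nondeg b c p, nondeg b' c' p & aff f p < 0].
Proof.
move=> nd nd' [a0 b0 c0] [a'0 b'0 c'0] ns.
have [p [p0 vp v'p]] := generic_point nd nd' a0.
exists p; split=> //.
- by rewrite -(bd_rot p b c); exact: (@move_vertex_aff _ f).
- by rewrite -(bd_rot p b' c'); exact: (@move_vertex_aff _ f).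
- apply: (@vol_nondeg _ _ _ _ a); rewrite (_ : vol b c p a = - vol a b c p) ?oppr_eq0 //.
  by rewrite /vol /dot /cross !cE; ring.
- apply: (@vol_nondeg _ _ _ _ a'); rewrite (_ : vol b' c' p a' = - vol a' b' c' p) ?oppr_eq0 //.
  by rewrite /vol /dot /cross !cE; ring.
Qed.

(** After three common replacements both triangles have become pqw. *)
Lemma transport f a b c a' b' c' s : nondeg a b c -> nondeg a' b' c' ->
  tneg f a b c -> tneg f a' b' c' -> nonneg f s ->
  isotopic (segs (bd a b c)) (segs s) (segs (bd a' b' c')) (segs s).
Proof.
move=> nd nd' tn tn' ns.
have [p [i1 j1 n1 m1 p0]] := transport_step nd nd' tn tn' ns.
case: (tn) (tn') => a0 b0 c0 [a'0 b'0 c'0].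
have [q [i2 j2 n2 m2 q0]] := transport_step n1 m1 (And3 b0 c0 p0) (And3 b'0 c'0 p0) ns.
have [w [i3 j3 n3 m3 w0]] := transport_step n2 m2 (And3 c0 p0 q0) (And3 c'0 p0 q0) ns.
apply: isotopic_trans i1 _; apply: isotopic_trans i2 _; apply: isotopic_trans i3 _.
by apply: isotopic_sym; apply: isotopic_trans j1 _; apply: isotopic_trans j2 _.
Qed.

Definition opp_aff f : point * R := (- f.1, - f.2).

Lemma aff_opp f q : aff (opp_aff f) q = - aff f q.
Proof. by rewrite /aff /dot /= !cE; ring. Qed.

(** Far out along [v] both functionals are very negative; [L] is large enough to beat the constant
    terms and the variation over a triangle with unit legs. *)
Lemma small_triangle f g v : dot f.1 v < 0 -> dot g.1 v < 0 ->
  exists a b c, [/\ nondeg a b c, tneg f a b c & tneg g a b c].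
Proof.
move=> f0 g0.
pose M (h : point * R) : R := `|h.2| + `|cx h.1| + `|cy h.1| + 1.
have M1 (h : point * R) : 1 <= M h by rewrite /M lerDr !addr_ge0.
pose L := M f / - dot f.1 v + M g / - dot g.1 v.
have Lf : M f <= L * - dot f.1 v.
  rewrite /L mulrDl divfK; last by rewrite gt_eqF //; lra.
  rewrite lerDl mulr_ge0 ?divr_ge0 //; last by lra.
    by have := M1 g; lra.
  by lra.
have Lg : M g <= L * - dot g.1 v.
  rewrite /L mulrDl divfK; last by rewrite gt_eqF //; lra.
  rewrite lerDr mulr_ge0 ?divr_ge0 //; last by lra.
    by have := M1 f; lra.
  by lra.
have T (h : point * R) : M h <= L * - dot h.1 v ->
    tneg h (L *: v) (L *: v + mkpt 1 0 0) (L *: v + mkpt 0 1 0).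
  rewrite /M => hM; have E0 : aff h (L *: v) = L * dot h.1 v + h.2 by rewrite /aff dotZr.
  have E1 : aff h (L *: v + mkpt 1 0 0) = L * dot h.1 v + cx h.1 + h.2.
    by rewrite /aff dotDr dotZr /dot !cE; ring.
  have E2 : aff h (L *: v + mkpt 0 1 0) = L * dot h.1 v + cy h.1 + h.2.
    by rewrite /aff dotDr dotZr /dot !cE; ring.
  have := ler_norm h.2; have := ler_norm (cx h.1); have := ler_norm (cy h.1).
  have := normr_ge0 h.2; have := normr_ge0 (cx h.1); have := normr_ge0 (cy h.1) => *.
  by split; rewrite ?E0 ?E1 ?E2; lra.
exists (L *: v), (L *: v + mkpt 1 0 0), (L *: v + mkpt 0 1 0); split; try exact: T.
apply: (@vol_nondeg _ _ _ _ (L *: v + mkpt 0 0 1)).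
by rewrite (_ : vol _ _ _ _ = 1) ?oner_eq0 // /vol /dot /cross !cE; ring.
Qed.

Lemma tneg_nonneg f a b c : tneg (opp_aff f) a b c -> nonneg f (bd a b c).
Proof.
rewrite /tneg !aff_opp => -[a0 b0 c0] e.
by rewrite !inE => /or3P[] /eqP -> /=; split; lra.
Qed.

Lemma opp_affK f : opp_aff (opp_aff f) = f.
Proof. by case: f => k x; rewrite /opp_aff /= !opprK. Qed.

(** One triangle is sent far out along [v] and the other along [- v], where both planes separate
    them; then [g] can take over from [f]. *)
Lemma change_functional f g v a b c a' b' c' : dot f.1 v < 0 -> dot g.1 v < 0 ->
  nondeg a b c -> nondeg a' b' c' -> tneg f a b c -> tneg (opp_aff f) a' b' c' ->
  exists a1 b1 c1 a2 b2 c2, [/\ nondeg a1 b1 c1, nondeg a2 b2 c2,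
    tneg g a1 b1 c1, tneg (opp_aff g) a2 b2 c2 &
    isotopic (segs (bd a b c)) (segs (bd a' b' c'))
             (segs (bd a1 b1 c1)) (segs (bd a2 b2 c2))].
Proof.
move=> fv gv nd nd' tf tf'.
have [a1 [b1 [c1 [n1 t1 u1]]]] := small_triangle fv gv.
have [|| a2 [b2 [c2 [n2 t2 u2]]]] := @small_triangle (opp_aff f) (opp_aff g) (- v).
- by rewrite (_ : dot _ _ = dot f.1 v) // /dot /= !cE; ring.
- by rewrite (_ : dot _ _ = dot g.1 v) // /dot /= !cE; ring.
exists a1, b1, c1, a2, b2, c2; split=> //.
apply: (isotopic_trans (transport nd n1 tf t1 (tneg_nonneg tf'))).
apply: isotopic_swap; apply: (transport nd' n2 tf' t2).
by apply: tneg_nonneg; rewrite opp_affK.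
Qed.

(** The plane x = 3/2 runs between the two circles of the standard unlink. *)
Definition fx : point * R := (mkpt 1 0 0, - (3 / 2)).
Definition fy : point * R := (mkpt 0 1 0, 0).

(** No direction is negative for both [f] and [fx] when their gradients are opposite, hence the
    detour through [fy]. It is blocked only when the gradient of [f] is opposite to that of [fy],
    and then the direct exchange works. *)
Lemma separated_standard f a b c a' b' c' : f.1 <> 0 ->
  nondeg a b c -> nondeg a' b' c' -> tneg f a b c -> tneg (opp_aff f) a' b' c' ->
  exists a1 b1 c1 a2 b2 c2, [/\ nondeg a1 b1 c1, nondeg a2 b2 c2,
    tneg fx a1 b1 c1, tneg (opp_aff fx) a2 b2 c2 &
    isotopic (segs (bd a b c)) (segs (bd a' b' c'))
             (segs (bd a1 b1 c1)) (segs (bd a2 b2 c2))].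
Proof.
move=> f0 nd nd' tf tf'.
have dx v : dot fx.1 v = cx v by rewrite /dot /= !cE; ring.
have dy v : dot fy.1 v = cy v by rewrite /dot /= !cE; ring.
have via v : dot f.1 v < 0 -> cy v < 0 -> exists a1 b1 c1 a2 b2 c2,
    [/\ nondeg a1 b1 c1, nondeg a2 b2 c2, tneg fx a1 b1 c1, tneg (opp_aff fx) a2 b2 c2 &
    isotopic (segs (bd a b c)) (segs (bd a' b' c'))
             (segs (bd a1 b1 c1)) (segs (bd a2 b2 c2))].
  move=> fv yv; have [||] := @change_functional f fy v _ _ _ _ _ _ _ _ nd nd' tf tf'; rewrite ?dy //.
  move=> a1 [b1 [c1 [a2 [b2 [c2 [n1 n2 t1 t2 i]]]]]].
  have [||] := @change_functional fy fx (mkpt (-1) (-1) 0) _ _ _ _ _ _ _ _ n1 n2 t1 t2.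
  - by rewrite dy !cE; lra.
  - by rewrite dx !cE; lra.
  move=> a3 [b3 [c3 [a4 [b4 [c4 [n3 n4 t3 t4 j]]]]]].
  by exists a3, b3, c3, a4, b4, c4; split=> //; exact: isotopic_trans i j.
have [x0|x0] := eqVneq (cx f.1) 0; last first.
  apply: (via (mkpt ((cy f.1 - 1) / cx f.1) (-1) 0)); rewrite ?cE; last lra.
  by rewrite /dot !cE mulrC divfK //; lra.
have [z0|z0] := eqVneq (cz f.1) 0; last first.
  apply: (via (mkpt 0 (-1) ((cy f.1 - 1) / cz f.1))); rewrite ?cE; last lra.
  by rewrite /dot !cE [cz _ * _]mulrC divfK //; lra.
have [y0|y0] := ltP 0 (cy f.1).
  by apply: (via (mkpt 0 (-1) 0)); rewrite ?cE /dot ?cE; lra.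
have y1 : cy f.1 < 0.
  rewrite lt_neqAle y0 andbT; apply/eqP => y1.
  by apply: f0; apply: pointP; rewrite ?cx0 ?cy0 ?cz0.
apply: (@change_functional f fx (mkpt (-1) 1 0)) nd nd' tf tf'; rewrite ?dx ?cE; last lra.
by rewrite /dot !cE; lra.
Qed.

Lemma aff_shrink f a b : aff f a < 0 ->
  exists2 t : R, 0 < t < 1 & aff f ((1 - t) *: a + t *: b) < 0.
Proof.
move=> a0; pose D := `|aff f b| - aff f a.
have D0 : 0 < D by rewrite /D; have := normr_ge0 (aff f b); lra.
have E (t : R) : aff f ((1 - t) *: a + t *: b) = (1 - t) * aff f a + t * aff f b.
  by rewrite /aff /dot !cE; ring.
exists (- aff f a / (2 * D)).
  have D2 : 0 < 2 * D by lra.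
  rewrite divr_gt0 //= ?ltr_pdivrMr //; last by lra.
  by rewrite mul1r /D; have := normr_ge0 (aff f b); lra.
rewrite E; set t := _ / _.
have tE : t * (2 * D) = - aff f a by rewrite /t divfK // gt_eqF //; lra.
have t0 : 0 < t by rewrite /t divr_gt0 //; lra.
have : t * (aff f b - aff f a) <= t * D.
  by rewrite ler_pM2l // /D; have := ler_norm (aff f b); lra.
by lra.
Qed.

Lemma nondeg_rot a b c : nondeg a b c -> nondeg b c a.
Proof.
move=> nd l m n S E; have [||n0 l0 m0] := nd n l m; [by lra| |by []].
by rewrite -E; apply: pointP; rewrite !cE; ring.
Qed.

Lemma nondeg_swap a b c : nondeg a b c -> nondeg b a c.
Proof.
move=> nd l m n S E; have [||n0 l0 m0] := nd m l n; [by lra| |by []].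
by rewrite -E; apply: pointP; rewrite !cE; ring.
Qed.

Lemma nondeg_sub a b c (t : R) : 0 < t -> nondeg a b c -> nondeg a ((1 - t) *: a + t *: b) c.
Proof.
move=> t0 nd l m n S E.
have [||l0 m0 n0] := nd (l + m * (1 - t)) (m * t) n.
- by lra.
- by rewrite -E; apply: pointP; rewrite !cE; ring.
have m1 : m = 0 by apply/eqP; move/eqP: m0; rewrite mulf_eq0 (gt_eqF t0) orbF.
by split=> //; move: l0; rewrite m1 mul0r addr0.
Qed.

Lemma tri_sub a b c (t : R) : 0 < t < 1 -> tri a ((1 - t) *: a + t *: b) c `<=` tri a b c.
Proof.
move=> t01 _ [l [m [n [l0 m0 n0 S ->]]]].
exists (l + m * (1 - t)), (m * t), n; split=> //.
- by rewrite addr_ge0 // mulr_ge0 //; lra.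
- by rewrite mulr_ge0 //; lra.
- by lra.
- by apply: pointP; rewrite !cE; ring.
Qed.

(** The side ab is subdivided at [b'], and the corner [b] of the resulting quadrilateral is cut off.
    Uniqueness of barycentric coordinates shows that the sides ca and ab' touch the triangle b'bc
    only in [c] and in [b']. *)
Lemma shrink_edge a b c (t : R) s : 0 < t < 1 -> nondeg a b c ->
  (forall e, e \in s -> forall q, seg e.1 e.2 q -> ~ tri a b c q) ->
  isotopic (segs (bd a b c)) (segs s) (segs (bd a ((1 - t) *: a + t *: b) c)) (segs s).
Proof.
move=> t01 nd dis; set b' := _ + _.
have split_ab : seg a b = seg a b' `|` seg b' b.
  apply/seteqP; split=> [_ [r r01 ->]|_ [[r r01 ->]|[r r01 ->]]].
  - case: (leP r t) => rt; [left; exists (r / t)|right; exists ((r - t) / (1 - t))].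
    + by rewrite divr_ge0 ?ler_pdivrMr ?mul1r //; lra.
    + by rewrite /b'; apply: pointP; rewrite !cE; field; lra.
    + by rewrite divr_ge0 ?ler_pdivrMr ?mul1r //; lra.
    + by rewrite /b'; apply: pointP; rewrite !cE; field; lra.
  - exists (r * t); last by rewrite /b'; apply: pointP; rewrite !cE; ring.
    by rewrite mulr_ge0 ?mulr_ile1 //; lra.
  - exists (t + r * (1 - t)); last by rewrite /b'; apply: pointP; rewrite !cE; ring.
    have r1 : 0 <= r * (1 - t) by rewrite mulr_ge0; lra.
    have r2 : 0 <= (1 - r) * (1 - t) by rewrite mulr_ge0; lra.
    by lra.
have -> : segs (bd a b c) = segs [:: (b', b); (b, c); (c, a); (a, b')].
  rewrite !segs_cons /= split_ab; apply/seteqP; split=> x; rewrite /setU /=; tauto.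
have -> : segs (bd a b' c) = segs [:: (b', c); (c, a); (a, b')].
  by rewrite -bd_rot -bd_rot -bd_rot /bd (bd_rot a b' c).
have nd' : nondeg b' b c.
  rewrite /b' addrC -{1}(subKr 1 t); apply: nondeg_swap; apply: nondeg_sub; first lra.
  exact: nondeg_swap.
have subT : tri b' b c `<=` tri a b c.
  move=> x; rewrite triC /b' addrC -{1}(subKr 1 t) => /tri_sub; rewrite triC; apply; lra.
have ind (l m n l' m' n' : R) : l + m + n = 1 -> l' + m' + n' = 1 ->
    l *: a + m *: b + n *: c = l' *: a + m' *: b + n' *: c -> [/\ l = l', m = m' & n = n'].
  move=> S S' E; have [||e1 e2 e3] := nd (l - l') (m - m') (n - n'); first by lra.
    rewrite (_ : _ + _ + _ = l *: a + m *: b + n *: c - (l' *: a + m' *: b + n' *: c)).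
      by rewrite E subrr.
    by apply: pointP; rewrite !cE; ring.
  by split; lra.
apply: delta_segs => // e; rewrite !inE => /or3P[/eqP ->|/eqP ->|es] /=.
- right; exists c, a; split; [by []|by right|].
  move=> q [r r01 ->] [l [m [n [l0 m0 n0 S E]]]].
  have [|||e1 e2 e3] := @ind r 0 (1 - r) (l * (1 - t)) (l * t + m) n; first by ring.
  + by lra.
  + rewrite (_ : r *: a + 0 *: b + (1 - r) *: c = (1 - r) *: c + r *: a).
      by rewrite E /b'; apply: pointP; rewrite !cE; ring.
    by apply: pointP; rewrite !cE; ring.
  have l1 : 0 <= l * t by rewrite mulr_ge0 //; lra.
  have lt0 : l * t = 0 by lra.
  have {}l0 : l = 0.
    by apply/eqP; move/eqP: lt0; rewrite mulf_eq0 => /orP[//|/eqP]; lra.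
  have r0 : r = 0 by rewrite e1 l0 mul0r.
  by rewrite r0; apply: pointP; rewrite !cE; ring.
- right; exists b', a; split; [exact: segC|by left|].
  move=> q [r r01 ->] [l [m [n [l0 m0 n0 S E]]]].
  have [|||e1 e2 e3] := @ind (r + (1 - r) * (1 - t)) ((1 - r) * t) 0 (l * (1 - t)) (l * t + m) n.
  + by ring.
  + by lra.
  + rewrite (_ : l * (1 - t) *: a + (l * t + m) *: b + n *: c = l *: b' + m *: b + n *: c).
      by rewrite -E /b'; apply: pointP; rewrite !cE; ring.
    by rewrite /b'; apply: pointP; rewrite !cE; ring.
  have r0 : r = 0.
    have h1 : (l - 1 + r) * t = - m by lra.
    have h2 : l = 1 - m by lra.
    have h3 : r * t = - m * (1 - t) by rewrite h2 in h1; lra.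
    have h4 : 0 <= r * t by rewrite mulr_ge0; lra.
    have h5 : 0 <= m * (1 - t) by rewrite mulr_ge0; lra.
    have h6 : r * t = 0 by lra.
    by apply/eqP; move/eqP: h6; rewrite mulf_eq0 => /orP[//|/eqP]; lra.
  by rewrite r0; apply: pointP; rewrite !cE; ring.
- by left=> q eq /subT; exact: dis eq.
Qed.

End Standardization.

(** * Rounding a square to a circle *)

Section Unlink.
Variable R : realType.
Notation point := 'rV[R]_3.
Implicit Types (p q u v w : point) (e : point * point) (s : seq (point * point)).
Implicit Types (f g : point * R).

Definition circle (x0 : R) : set point :=
  [set x | exists a b : R, x = mkpt (a + x0) b 0 /\ a ^+ 2 + b ^+ 2 = 1].

Definition diamond (x0 : R) : set point :=
  [set x | exists a b : R, x = mkpt (a + x0) b 0 /\ `|a| + `|b| = 1].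

Section Rounding.
Variable x0 : R.
(** Over the abscissa x, [rad] and [1 - xi] are the half-heights of circle and square, and [del] is
    their difference. [rnd] scales by [kap] up to height [rad] and shifts by [del] beyond it.
    Writing [kap] as a root keeps it continuous where [rad] vanishes. *)
Let xi (x : R) : R := Num.min 1 `|x - x0|.
Let rad (x : R) : R := Num.sqrt (1 - xi x ^+ 2).
Let kap (x : R) : R := Num.sqrt ((1 - xi x) / (1 + xi x)).
Let del (x : R) : R := rad x - (1 - xi x).
Let rnd q : R := Num.min (Num.max (kap (cx q) * cy q) (cy q - del (cx q))) (cy q + del (cx q)).

Let xi_ge0 x : 0 <= xi x.
Proof. by rewrite le_min ler01 normr_ge0. Qed.
Let xi_le1 x : xi x <= 1.
Proof. by rewrite ge_min lexx. Qed.
Let kap_rad x : kap x * rad x = 1 - xi x.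
Proof.
have := xi_ge0 x; have := xi_le1 x; rewrite /kap /rad => x1 x0'.
rewrite -sqrtrM; last by rewrite divr_ge0 //; lra.
have -> : (1 - xi x) / (1 + xi x) * (1 - xi x ^+ 2) = (1 - xi x) ^+ 2 by field; lra.
by rewrite sqrtr_sqr ger0_norm //; lra.
Qed.
Let rad_ge0 x : 0 <= rad x. Proof. exact: sqrtr_ge0. Qed.
Let kap_ge0 x : 0 <= kap x. Proof. exact: sqrtr_ge0. Qed.
Let kap_le1 x : kap x <= 1.
Proof.
have := xi_ge0 x; have := xi_le1 x => x1 x0'.
rewrite /kap -[leRHS]sqrtr1 ler_wsqrtr // ler_pdivrMr; lra.
Qed.
Let del_ge0 x : 0 <= del x.
Proof. by rewrite /del subr_ge0 -kap_rad ler_piMl. Qed.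
Let rad_le1 x : rad x <= 1.
Proof.
by rewrite /rad -[leRHS]sqrtr1 ler_wsqrtr // lerBlDr lerDl sqr_ge0.
Qed.
Let del_le1 x : del x <= 1.
Proof. by rewrite /del; have := rad_le1 x; have := xi_le1 x; lra. Qed.

Let rnd_continuous : continuous rnd.
Proof.
have cxi : continuous (fun q : point => xi (cx q)).
  apply: continuous_minr; first exact: cst_continuous.
  move=> q.
  exact: (cvg_norm (cvgB (@cx_continuous R q) (@cst_continuous _ _ x0 q))).
have c1 : continuous (fun q : point => 1 - xi (cx q)).
  by move=> q; exact: (cvgB (@cst_continuous point R (1 : R) q) (cxi q)).
have c2 : continuous (fun q : point => 1 + xi (cx q)).
  by move=> q; exact: (cvgD (@cst_continuous point R (1 : R) q) (cxi q)).
have ck : continuous (fun q : point => kap (cx q)).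
  apply: (@continuousT_comp _ _ _ (fun q : point => (1 - xi (cx q)) / (1 + xi (cx q))) Num.sqrt);
    last exact: sqrt_continuous.
  move=> q; apply: (cvgM (c1 q)); apply: (cvgV _ (c2 q)).
  by have h := xi_ge0 (cx q); rewrite gt_eqF //; lra.
have cr : continuous (fun q : point => rad (cx q)).
  apply: (@continuousT_comp _ _ _ (fun q : point => 1 - xi (cx q) ^+ 2) Num.sqrt);
    last exact: sqrt_continuous.
  by move=> q; exact: (cvgB (@cst_continuous point R (1 : R) q) (cvgM (cxi q) (cxi q))).
have cd : continuous (fun q : point => del (cx q)).
  by move=> q; exact: (cvgB (cr q) (c1 q)).
apply: continuous_minr.
  apply: continuous_maxr => q.
    exact: (cvgM (ck q) (@cy_continuous R q)).
  exact: (cvgB (@cy_continuous R q) (cd q)).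
by move=> q; exact: (cvgD (@cy_continuous R q) (cd q)).
Qed.

Let xi1_id q : xi (cx q) = 1 -> rnd q = cy q.
Proof.
move=> E; rewrite /rnd /del /rad /kap E expr1n subrr mul0r sqrtr0 mul0r !subr0 addr0.
by case: (leP 0 (cy q)) => y0; [rewrite minxx|rewrite min_r // ltW].
Qed.

Let rnd_mono x y y' z : y < y' -> rnd (mkpt x y z) < rnd (mkpt x y' z).
Proof.
move=> yy'; have [E|E] := eqVneq (xi x) 1; first by rewrite !xi1_id ?c_mkpt.
have k0 : 0 < kap x.
  rewrite sqrtr_gt0 divr_gt0 //; last by have := xi_ge0 x; lra.
  by rewrite subr_gt0 lt_neqAle E xi_le1.
have d1 : kap x * y < kap x * y' by rewrite ltr_pM2l.
rewrite /rnd !c_mkpt lt_min !gt_min gt_max !lt_max; apply/andP; split.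
  by apply/orP; left; apply/andP; split; apply/orP; [left|right]; lra.
by apply/orP; right; lra.
Qed.

Let rnd_bound q : `|rnd q - cy q| <= 1.
Proof.
have h1 : rnd q <= cy q + del (cx q) by rewrite ge_min lexx orbT.
have h2 : cy q - del (cx q) <= rnd q.
  by rewrite le_min le_max lexx orbT /=; have := del_ge0 (cx q); lra.
by have := del_le1 (cx q); rewrite ler_norml => *; apply/andP; split; lra.
Qed.

(** The map [rnd] carries the circle to the diamond, so its isotopy is used backwards; it fixes
    every point whose abscissa is at distance at least 1 from [x0]. *)
Lemma round_diamond (K : set point) : (forall q, K q -> 1 <= `|cx q - x0|) ->
  isotopic (diamond x0) K (circle x0) K.
Proof.
move=> hK; apply: isotopic_sym.
pose F q := mkpt (cx q) (rnd q) (cz q).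
have rp x z : rnd (mkpt x (rad x) z) = 1 - xi x.
  rewrite /rnd !c_mkpt kap_rad {1}/del subKr maxxx min_l //.
  by have := kap_le1 x; have := del_ge0 x; rewrite /del; lra.
have rn x z : rnd (mkpt x (- rad x) z) = - (1 - xi x).
  have d0 := del_ge0 x; rewrite /rnd !c_mkpt mulrN kap_rad max_l; last by rewrite /del in d0 *; lra.
  by rewrite min_l // /del; lra.
have xiE (a : R) : `|a| <= 1 -> xi (a + x0) = `|a| by move=> a1; rewrite /xi addrK min_r.
have FC : diamond x0 = F @` circle x0.
  apply/seteqP; split=> [_ [a [b [-> ab]]]|_ [_ [a [b [-> ab]]] <-]].
    have a1 : `|a| <= 1 by have := normr_ge0 b; lra.
    have rE : rad (a + x0) = Num.sqrt (1 - a ^+ 2) by rewrite /rad xiE // real_normK ?num_real.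
    have n0 : 0 <= 1 - a ^+ 2 by rewrite subr_ge0 -[a ^+ 2]real_normK ?num_real // expr_le1.
    case: (leP 0 b) => b0.
      exists (mkpt (a + x0) (rad (a + x0)) 0).
        by exists a, (rad (a + x0)); rewrite rE sqr_sqrtr //; split=> //; ring.
      by rewrite /F rp !c_mkpt xiE //; congr mkpt; rewrite (ger0_norm b0) in ab; lra.
    exists (mkpt (a + x0) (- rad (a + x0)) 0).
      by exists a, (- rad (a + x0)); rewrite rE sqrrN sqr_sqrtr //; split=> //; ring.
    by rewrite /F rn !c_mkpt xiE //; congr mkpt; rewrite (ltr0_norm b0) in ab; lra.
  have a1 : `|a| <= 1.
    by rewrite -(@expr_le1 _ 2) // real_normK ?num_real //; have := sqr_ge0 b; lra.
  have rE : rad (a + x0) = `|b|.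
    by rewrite /rad xiE // real_normK ?num_real // (_ : 1 - a ^+ 2 = b ^+ 2) ?sqrtr_sqr //; lra.
  exists a, (rnd (mkpt (a + x0) b 0)); rewrite /F !c_mkpt; split=> //.
  have [b0|b0] := leP 0 b.
    have -> : b = rad (a + x0) by rewrite rE ger0_norm.
    by rewrite rp xiE // [`|1 - _|]ger0_norm; lra.
  rewrite (_ : b = - rad (a + x0)); last by rewrite rE ltr0_norm ?opprK.
  by rewrite rn xiE // normrN [`|1 - _|]ger0_norm; lra.
have FK q : K q -> F q = q.
  move=> /hK h; rewrite /F xi1_id -?mkpt_eta //.
  by rewrite /xi min_l.
have FKK : F @` K = K.
  apply/seteqP; split=> [_ [q Kq <-]|q Kq]; first by rewrite FK.
  by exists q => //; rewrite FK.
rewrite FC -{2}FKK.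
exact: (@fibrewise_isotopy R rnd 1).
Qed.

End Rounding.
End Unlink.

(** * Disjoint filled triangles bound a trivial link *)

Section SplitTriangles.
Variable R : realType.
Notation point := 'rV[R]_3.
Implicit Types (a b c p q u v w : point) (e : point * point) (s : seq (point * point)).
Implicit Types (f g : point * R).

Let W (x0 : R) : point := mkpt (x0 - 1) 0 0.
Let N (x0 : R) : point := mkpt x0 1 0.
Let E (x0 : R) : point := mkpt (x0 + 1) 0 0.
Let S (x0 : R) : point := mkpt x0 (-1) 0.
Let dia (x0 : R) : seq (point * point) := [:: (E x0, S x0); (S x0, W x0); (W x0, N x0); (N x0, E x0)].

Lemma segs_diamond (x0 : R) : segs (dia x0) = diamond x0.
Proof.
apply/seteqP; split=> [q [e]|_ [a [b [-> ab]]]].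
  rewrite !inE => /or4P[] /eqP -> /= [t /andP[t0 t1] ->];
    [exists (1 - t), (- t)|exists (- t), (t - 1)|exists (t - 1), t|exists t, (1 - t)];
    (split; first by apply: pointP; rewrite !cE; ring).
  - by rewrite normrN ger0_norm ?ger0_norm; lra.
  - by rewrite normrN ger0_norm ?ler0_norm; lra.
  - by rewrite ler0_norm ?ger0_norm; lra.
  - by rewrite ger0_norm ?ger0_norm; lra.
have na := normr_ge0 a; have nb := normr_ge0 b.
case: (leP 0 a) => a0; case: (leP 0 b) => b0;
  rewrite ?(ger0_norm a0) ?(ger0_norm b0) ?(ltr0_norm a0) ?(ltr0_norm b0) in ab na nb.
- exists (N x0, E x0); first by rewrite !inE eqxx !orbT.
  by exists a; [lra|apply: pointP; rewrite !cE; lra].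
- exists (E x0, S x0); first by rewrite !inE eqxx.
  by exists (- b); [lra|apply: pointP; rewrite !cE; lra].
- exists (W x0, N x0); first by rewrite !inE eqxx !orbT.
  by exists b; [lra|apply: pointP; rewrite !cE; lra].
- exists (S x0, W x0); first by rewrite !inE eqxx !orbT.
  by exists (- a); [lra|apply: pointP; rewrite !cE; lra].
Qed.

Lemma nondeg_std (x0 : R) : nondeg (W x0) (N x0) (E x0).
Proof.
apply: (@vol_nondeg _ _ _ _ (mkpt x0 0 1)).
by rewrite (_ : vol _ _ _ _ = - 2) ?oppr_eq0 ?pnatr_eq0 // /vol /dot /cross !cE; ring.
Qed.

(** A corner cut in reverse: the side from E to W acquires the corner S. *)
Lemma triangle_to_diamond (x0 : R) s : (forall q, segs s q -> 1 < `|cx q - x0|) ->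
  isotopic (segs (bd (W x0) (N x0) (E x0))) (segs s) (diamond x0) (segs s).
Proof.
move=> far; rewrite -segs_diamond -bd_rot; apply: isotopic_sym.
have far' e q : e \in s -> seg e.1 e.2 q -> 1 < `|cx q - x0| by move=> es eq; apply: far; exists e.
apply: delta_segs.
  apply: (@vol_nondeg _ _ _ _ (mkpt x0 0 1)).
  by rewrite (_ : vol _ _ _ _ = - 2) ?oppr_eq0 ?pnatr_eq0 // /vol /dot /cross !cE; ring.
move=> e; rewrite !inE => /or3P[/eqP ->|/eqP ->|es] /=.
- right; exists (W x0), (N x0); split; [by []|by right|].
  move=> q [t /andP[t0 t1] ->] [l [m [n [l0 m0 n0 _ /(congr1 (@cy R))]]]]; rewrite !cE => h.
  have -> : t = 0 by lra.
  by rewrite subr0 scale1r scale0r addr0.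
- right; exists (E x0), (N x0); split; [exact: segC|by left|].
  move=> q [t /andP[t0 t1] ->] [l [m [n [l0 m0 n0 _ /(congr1 (@cy R))]]]]; rewrite !cE => h.
  have -> : t = 0 by lra.
  by rewrite subr0 scale1r scale0r addr0.
- left=> q /(far' _ _ es) h [l [m [n [l0 m0 n0 L qE]]]].
  have xE : cx q - x0 = l - n.
    have lE : l = 1 - m - n by lra.
    by rewrite qE lE !cE; ring.
  have : `|cx q - x0| <= 1 by rewrite xE ler_norml; apply/andP; split; lra.
  by rewrite leNgt h.
Qed.

(** The components become diamonds one after the other, then circles. Their abscissae stay within
    distance 1 of 0 and of 3, so the component at rest is never touched. *)
Lemma standard_triangles :
  trivial_link (segs (bd (W 0) (N 0) (E 0))) (segs (bd (W 3) (N 3) (E 3))).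
Proof.
have far u v (x0 d : R) q : seg u v q -> cx u - x0 <= d -> cx v - x0 <= d -> cx q - x0 <= d.
  move=> [t /andP[t0 t1] ->] ud vd; rewrite !cE.
  have h1 : (1 - t) * (cx u - x0) <= (1 - t) * d by rewrite ler_wpM2l //; lra.
  have h2 : t * (cx v - x0) <= t * d by rewrite ler_wpM2l.
  by lra.
have far' u v (x0 d : R) q : seg u v q -> d <= cx u - x0 -> d <= cx v - x0 -> d <= cx q - x0.
  move=> [t /andP[t0 t1] ->] ud vd; rewrite !cE.
  have h1 : (1 - t) * d <= (1 - t) * (cx u - x0) by rewrite ler_wpM2l //; lra.
  have h2 : t * d <= t * (cx v - x0) by rewrite ler_wpM2l.
  by lra.
apply: (@isotopic_trans _ _ _ (diamond 0) (segs (bd (W 3) (N 3) (E 3)))).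
  apply: triangle_to_diamond => q [e]; rewrite !inE => /or3P[] /eqP -> /= eq;
    by (have := far' _ _ 0 2 _ eq; rewrite !cE => h; rewrite ger0_norm; lra).
apply: (@isotopic_trans _ _ _ (diamond 0) (diamond 3)).
  apply: isotopic_swap; rewrite -(segs_diamond 0); apply: triangle_to_diamond => q [e].
  rewrite !inE => /or4P[] /eqP -> /= eq;
    by (have := far _ _ 3 (-2) _ eq; rewrite !cE => h; rewrite ler0_norm; lra).
apply: (@isotopic_trans _ _ _ (circle 0) (diamond 3)).
  apply: round_diamond => _ [a [b [-> ab]]]; rewrite !cE subr0.
  have nb := normr_ge0 b; have : `|a| <= 1 by lra.
  by rewrite ler_norml => /andP[h1 h2]; rewrite ger0_norm; lra.
apply: (@isotopic_trans _ _ _ (circle 0) (circle 3)).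
  apply: isotopic_swap; apply: round_diamond => _ [a [b [-> ab]]]; rewrite !cE addr0.
  have : `|a| <= 1.
    by rewrite -(@expr_le1 _ 2) // real_normK ?num_real //; have := sqr_ge0 b; lra.
  by rewrite ler_norml => /andP[h1 h2]; rewrite ler0_norm; lra.
have c0 : circle 0 = @unlink1 R.
  by apply/seteqP; split=> _ [a [b [-> ab]]]; exists a, b; rewrite addr0.
rewrite c0; exact: isotopic_refl.
Qed.

(** [trivial_link] unfolds to [isotopic] with the standard unlink as its target. *)
Lemma isotopic_trivial K1 K2 L1 L2 : isotopic K1 K2 L1 L2 ->
  @trivial_link R L1 L2 -> @trivial_link R K1 K2.
Proof. exact: isotopic_trans. Qed.

Lemma separated_triangles f a b c a' b' c' : f.1 <> 0 ->
  nondeg a b c -> nondeg a' b' c' -> tneg f a b c -> tneg (opp_aff f) a' b' c' ->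
  trivial_link (segs (bd a b c)) (segs (bd a' b' c')).
Proof.
move=> f0 nd nd' tf tf'.
have [a1 [b1 [c1 [a2 [b2 [c2 [n1 n2 t1 t2 i]]]]]]] := separated_standard f0 nd nd' tf tf'.
apply: (isotopic_trivial i); apply: isotopic_trivial standard_triangles.
have s1 : tneg (fx R) (W 0) (N 0) (E 0) by rewrite /tneg /aff /dot /= !cE; split; lra.
have s2 : tneg (opp_aff (fx R)) (W 3) (N 3) (E 3).
  by rewrite /tneg /aff /dot /= !cE; split; lra.
apply: (isotopic_trans (transport n1 (@nondeg_std 0) t1 s1 (tneg_nonneg t2))).
apply: isotopic_swap; apply: (transport n2 (@nondeg_std 3) t2 s2).
by apply: tneg_nonneg; rewrite opp_affK.
Qed.

(** Sliding [b] and [c] towards [a] inside the filled triangle, which misses the other one, brings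
    abc strictly to one side of the plane. Shifting [f] by half of the margin gained then separates
    the triangles strictly. *)
Lemma triangle_off_plane f a b c a' b' c' : nondeg a b c -> nondeg a' b' c' ->
  (forall q, tri a b c q -> ~ tri a' b' c' q) ->
  f.1 <> 0 -> aff f a < 0 -> aff f a' = 0 -> aff f b' = 0 -> aff f c' = 0 ->
  trivial_link (segs (bd a b c)) (segs (bd a' b' c')).
Proof.
move=> nd nd' dis f0 a0 a'0 b'0 c'0.
have sT e q : e \in bd a' b' c' -> seg e.1 e.2 q -> tri a' b' c' q.
  rewrite !inE => /or3P[] /eqP -> /= [t /andP[t0 t1] ->].
  - exists (1 - t), t, 0; split=> //; [lra|lra|by rewrite scale0r addr0].
  - exists 0, (1 - t), t; split=> //; [lra|lra|by rewrite scale0r add0r].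
  - exists t, 0, (1 - t); split=> //; [lra|lra|by rewrite scale0r addr0 addrC].
have [t t01 b0] := aff_shrink b a0.
have [r r01 c0] := aff_shrink c a0.
move: b0 c0; set b1 := _ + _ *: b; set c1 := _ + _ *: c => b0 c0.
have nb : nondeg a c b1.
  have h : nondeg a b1 c by apply: nondeg_sub nd; case/andP: t01.
  exact: nondeg_rot (nondeg_rot (nondeg_swap (nondeg_rot h))).
apply: (@isotopic_trivial _ _ (segs (bd a b1 c)) (segs (bd a' b' c'))).
  by apply: shrink_edge => // e es q eq tq; apply: (dis q tq); exact: sT es eq.
have -> : segs (bd a b1 c) = segs (bd a c b1) by rewrite bd_swap bd_rot.
apply: (@isotopic_trivial _ _ (segs (bd a c1 b1)) (segs (bd a' b' c'))).
  apply: shrink_edge => // e es q eq tq; apply: (dis q _ (sT _ _ es eq)).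
  by rewrite triC tri_rot in tq; exact: tri_sub t01 _ tq.
pose d := (Num.min (- aff f a) (Num.min (- aff f b1) (- aff f c1))) / 2.
have m0 : 0 < Num.min (- aff f a) (Num.min (- aff f b1) (- aff f c1)).
  by rewrite !lt_min !oppr_gt0 a0 b0.
have := lexx (Num.min (- aff f a) (Num.min (- aff f b1) (- aff f c1))).
rewrite {1}le_min [in X in _ && X]le_min => /and3P[ma mb mc].
have shift q : aff (f.1, f.2 + d) q = aff f q + d by rewrite /aff addrA.
have dE : 2 * d = Num.min (- aff f a) (Num.min (- aff f b1) (- aff f c1)).
  by rewrite /d; field.
apply: (@separated_triangles (f.1, f.2 + d)) => //.
- by apply: nondeg_sub; [case/andP: r01|].
- by rewrite /tneg !shift; split; lra.
- by rewrite /tneg !aff_opp !shift a'0 b'0 c'0; split; lra.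
Qed.

Lemma plane_seg f u v q : aff f u = 0 -> aff f v = 0 -> seg u v q -> aff f q = 0.
Proof.
move=> u0 v0 [t _ ->]; have := @aff_comb _ f (1 - t) t 0 u v v.
by rewrite !scale0r !addr0 mul0r addr0 u0 v0 !mulr0 addr0; apply; ring.
Qed.

(** The functional [f] cuts out the plane of a'b'c'. If some vertex of abc is off this plane, the
    previous lemma applies after a rotation. If the triangles are coplanar, [a] is first lifted
    along [v]; the lifted triangle meets the plane only in bc, so it stays disjoint from the other
    one. *)
Lemma disjoint_triangles_unlinked a b c a' b' c' : nondeg a b c -> nondeg a' b' c' ->
  (forall q, tri a b c q -> ~ tri a' b' c' q) ->
  trivial_link (segs (bd a b c)) (segs (bd a' b' c')).
Proof.
move=> nd nd' dis.
pose f : point * R := (cross (b' - a') (c' - a'), - dot (cross (b' - a') (c' - a')) a').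
have fE q : aff f q = vol a' b' c' q by rewrite /aff /f /vol /dot /cross /= !cE; ring.
have f0 : f.1 <> 0 := nondeg_cross nd'.
have of0 : (opp_aff f).1 <> 0.
  by move=> E0; apply: f0; rewrite -[f.1]opprK; move: E0; rewrite /opp_aff /= => ->; rewrite oppr0.
have fa' : aff f a' = 0 by rewrite fE /vol /dot !cE; ring.
have fb' : aff f b' = 0 by rewrite fE /vol /dot /cross !cE; ring.
have fc' : aff f c' = 0 by rewrite fE /vol /dot /cross !cE; ring.
have key x y z : nondeg x y z -> (forall q, tri x y z q -> ~ tri a' b' c' q) ->
    aff f x != 0 -> trivial_link (segs (bd x y z)) (segs (bd a' b' c')).
  move=> ndx disx; rewrite neq_lt => /orP[x0|x0].
    exact: (@triangle_off_plane f).
  by apply: (@triangle_off_plane (opp_aff f)) => //; rewrite aff_opp ?fa' ?fb' ?fc' ?oppr0 //; lra.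
have [a0|a0] := eqVneq (aff f a) 0; last exact: key.
have [b0|b0] := eqVneq (aff f b) 0; last first.
  rewrite bd_rot; apply: (key b c a (nondeg_rot nd) _ b0) => q.
  by rewrite -tri_rot; exact: dis.
have [c0|c0] := eqVneq (aff f c) 0; last first.
  rewrite bd_rot bd_rot; apply: (key c a b (nondeg_rot (nondeg_rot nd)) _ c0) => q.
  by rewrite -tri_rot -tri_rot; exact: dis.
have [v [v0 v'0]] := transverse_vector (nondeg_cross nd) f0.
have volv : vol a b c (a + v) != 0.
  by rewrite (_ : vol a b c (a + v) = dot (cross (b - a) (c - a)) v) // /vol /dot !cE; ring.
have fv : aff f (a + v) != 0.
  rewrite (_ : aff f (a + v) = dot f.1 v) //.
  by rewrite -[RHS]add0r -a0 /aff dotDr; ring.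
have fcomb (l m n : R) (x y z : point) : l + m + n = 1 -> aff f x = 0 -> aff f z = 0 ->
    aff f (l *: x + m *: y + n *: z) = 0 -> aff f y != 0 -> m = 0.
  move=> lmn x0 z0; rewrite aff_comb // x0 z0 !mulr0 add0r addr0 => /eqP.
  by rewrite mulf_eq0 => /orP[/eqP //|/eqP ->]; rewrite eqxx.
have sT e q : e \in bd a' b' c' -> seg e.1 e.2 q -> aff f q = 0 /\ tri a' b' c' q.
  rewrite !inE => /or3P[] /eqP -> /= sq; (split; first exact: plane_seg sq);
    case: sq => t /andP[t0 t1] ->.
  - by exists (1 - t), t, 0; split=> //; [lra|lra|rewrite scale0r addr0].
  - by exists 0, (1 - t), t; split=> //; [lra|lra|rewrite scale0r add0r].
  - by exists t, 0, (1 - t); split=> //; [lra|lra|rewrite scale0r addr0 addrC].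
have i1 : isotopic (segs (bd a b c)) (segs (bd a' b' c'))
                   (segs (bd (a + v) b c)) (segs (bd a' b' c')).
  apply: move_vertex => // e es q eq; have [q0 Tq] := sT _ _ es eq.
  split=> -[l [m [n [l0 m0 n0 lmn qE]]]]; apply: (dis q _ Tq).
    have mz : m = 0 by apply: (fcomb l m n c (a + v) a) => //; rewrite -qE.
    exists n, 0, l; split=> //; first by lra.
    by rewrite qE mz; apply: pointP; rewrite !cE; ring.
  have lz : l = 0.
    apply: (fcomb m l n a (a + v) b) => //; first lra.
    by rewrite -q0 qE; congr aff; apply: pointP; rewrite !cE; ring.
  exists m, n, 0; split=> //; first by lra.
  by rewrite qE lz; apply: pointP; rewrite !cE; ring.
apply: (isotopic_trivial i1); apply: key => //.
  apply: nondeg_rot; apply: nondeg_rot.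
  apply: (@vol_nondeg _ _ _ _ a).
  by rewrite (_ : vol b c (a + v) a = - vol a b c (a + v)) ?oppr_eq0 // /vol /dot /cross !cE; ring.
move=> q [l [m [n [l0 m0 n0 lmn qE]]]] Tq.
have q0 : aff f q = 0.
  case: (Tq) => l' [m' [n' [_ _ _ S' ->]]]; rewrite aff_comb // fa' fb' fc'; ring.
have lz : l = 0.
  apply: (fcomb m l n b (a + v) c) => //; first lra.
  by rewrite -q0 qE; congr aff; apply: pointP; rewrite !cE; ring.
apply: (dis q _ Tq); exists 0, m, n; split=> //; first by lra.
by rewrite qE lz; apply: pointP; rewrite !cE; ring.
Qed.

End SplitTriangles.

Lemma mem_zip_sides (T1 T2 : eqType) (s : seq T1) (t : seq T2) u v :
  (u, v) \in zip s t -> u \in s /\ v \in t.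
Proof.
elim: s t => [|x s IH] [|y t] //=; rewrite !inE => /orP[/eqP[-> ->]|/IH[us vt]].
  by rewrite !eqxx.
by rewrite us vt !orbT.
Qed.

(** * Polygons on labelled points *)

Section Polygons.
Variables (R : realType) (T : eqType) (p : T -> 'rV[R]_3).
Notation point := 'rV[R]_3.
Implicit Types (x y z u v w : T) (s l : seq T).

Definition edges s : seq (T * T) := zip s (rot 1 s).

Definition polygon s : set point := segs [seq (p e.1, p e.2) | e <- edges s].

Lemma edges_cons x l : edges (x :: l) = zip (x :: l) (rcons l x).
Proof. by rewrite /edges rot1_cons. Qed.

Lemma edges_next s : uniq s -> edges s = [seq (u, next s u) | u <- s].
Proof.
case: s => // x l U; rewrite edges_cons.
have S1 : size (x :: l) = size (rcons l x) by rewrite size_rcons.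
apply: (@eq_from_nth _ (x, x)); first by rewrite size_zip size_map -S1 minnn.
move=> i; rewrite size_zip -S1 minnn => il.
rewrite nth_zip // (nth_map x) // next_nth mem_nth // index_uniq // nth_rcons.
by congr pair; case: ltngtP => // [li|->]; rewrite nth_default // ltnW.
Qed.

Lemma polygon_rot i s : uniq s -> polygon (rot i s) = polygon s.
Proof.
move=> U; rewrite /polygon !edges_next ?rot_uniq //.
apply/seteqP; split=> q [e /mapP[f /mapP[u us ->] ->] eq].
  exists (p u, p (next s u)); last by rewrite next_rot // in eq.
  apply/mapP; exists (u, next s u) => //; apply/mapP; exists u => //.
  by rewrite -(mem_rot i).
exists (p u, p (next s u)) => //.
apply/mapP; exists (u, next (rot i s) u); last by rewrite next_rot.
by apply/mapP; exists u => //; rewrite mem_rot.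
Qed.

Lemma polygon_rev x s : polygon (x :: rev s) = polygon (x :: s).
Proof.
rewrite /polygon !edges_cons.
have -> : zip (x :: rev s) (rcons (rev s) x) = rev (zip (rcons s x) (x :: s)).
  by rewrite rev_zip ?size_rcons // rev_rcons rev_cons.
have zs (a b : seq T) u v : (u, v) \in zip a b = ((v, u) \in zip b a).
  elim: a b => [|a0 a IH] [|b0 b] //=; rewrite !inE !xpair_eqE IH.
  by congr orb; exact: andbC.
apply/seteqP; split=> q [e /mapP[[u v] uv ->] eq];
  (exists (p v, p u); last by rewrite /= segC); apply/mapP; exists (v, u) => //.
  by rewrite zs -mem_rev.
by rewrite mem_rev zs.
Qed.

Lemma edges_mem s u v : (u, v) \in edges s -> u \in s /\ v \in s.
Proof. by move=> /mem_zip_sides[us]; rewrite mem_rot. Qed.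

Definition edge_clear x y z u v : Prop :=
  forall q, seg (p u) (p v) q -> tri (p x) (p y) (p z) q ->
    exists2 w, w \in [:: u; v] & w \in [:: x; y; z] /\ q = p w.

(** Since [l] is nonempty, xz is the only edge of the shortened polygon that joins two corners of
    the triangle; the edges next to it touch the triangle in [x] or in [z] alone. *)
Lemma corner_move x y z l s2 : uniq (x :: y :: z :: l) -> l != [::] ->
  nondeg (p x) (p y) (p z) ->
  (forall w, w \in s2 -> w \notin [:: x; y; z]) ->
  (forall u v, (u, v) \in edges (x :: z :: l) ++ edges s2 -> (u, v) != (x, z) ->
     edge_clear x y z u v) ->
  isotopic (polygon (x :: y :: z :: l)) (polygon s2) (polygon (x :: z :: l)) (polygon s2).
Proof.
move=> U l0 nd dis cl; rewrite /polygon !edges_cons /=.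
apply: delta_segs => // e; rewrite mem_cat => /orP[]/mapP[[u v] uv ->] /=; last first.
  left=> q eq tq; have [||w] := cl u v _ _ q eq tq; first by rewrite mem_cat uv orbT.
    apply/eqP => -[uE vE]; have [us _] := edges_mem uv.
    by have := dis _ us; rewrite uE mem_head.
  have [us vs] := edges_mem uv => wuv [wt _].
  have ws : w \in s2 by move: wuv; rewrite !inE => /orP[]/eqP ->.
  by have := dis _ ws; rewrite wt.
move: U; rewrite /= !inE !negb_or -!andbA => /and5P[xy xz xl yz /andP[yl /andP[zl Ul]]].
have mem : (u, v) \in edges (x :: z :: l).
  by rewrite edges_cons /= inE uv orbT.
have uvn : (u, v) != (x, z).
  apply/eqP => -[uE vE]; have [us _] := mem_zip_sides uv.
  by move: us; rewrite uE inE (negbTE xz) (negbTE xl).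
have cuv := cl u v _ uvn; rewrite mem_cat mem in cuv; have {}cuv := cuv isT.
have [us vs] := mem_zip_sides uv.
have ux : u != x by apply/eqP => E; move: us; rewrite E inE (negbTE xz) (negbTE xl).
have uy : u != y by apply/eqP => E; move: us; rewrite E inE (negbTE yz) (negbTE yl).
have vy : v != y.
  by apply/eqP => E; move: vs; rewrite E mem_rcons inE eq_sym (negbTE xy) (negbTE yl).
have vz : v != z.
  by apply/eqP => E; move: vs; rewrite E mem_rcons inE eq_sym (negbTE xz) (negbTE zl).
have [uE|uz] := eqVneq u z.
  right; exists (p u), (p v); split; [by []|by right; rewrite uE|].
  move=> q eq tq; have [w + [+ ->]] := cuv q eq tq.
  rewrite !inE => /orP[/eqP -> //|/eqP ->]; rewrite (negbTE vy) (negbTE vz) !orbF => /eqP vx.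
  exfalso; move: uv; rewrite uE vx; case: (l) l0 xl zl Ul => // h l' _ xl zl Ul.
  rewrite /= inE => /orP[/eqP[xh]|/mem_zip_sides[zl' _]].
    by move: xl; rewrite xh mem_head.
  by move: zl; rewrite zl'.
have [vE|vx] := eqVneq v x.
  right; exists (p v), (p u); split; [exact: segC|by left; rewrite vE|].
  move=> q; rewrite segC => eq tq; have [w + [+ ->]] := cuv q eq tq.
  rewrite !inE => /orP[/eqP ->|/eqP -> //].
  by rewrite (negbTE ux) (negbTE uy) (negbTE uz).
left=> q eq tq; have [w + [+ _]] := cuv q eq tq.
rewrite !inE => /orP[]/eqP ->; first by rewrite (negbTE ux) (negbTE uy) (negbTE uz).
by rewrite (negbTE vx) (negbTE vy) (negbTE vz).
Qed.

Lemma polygon3 x y z : polygon [:: x; y; z] = segs (bd (p x) (p y) (p z)).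
Proof. by []. Qed.

End Polygons.

(** * Straight-line embeddings *)

Section StraightEmbedding.
Variables (R : realType) (T : finType) (e : rel T) (p : T -> 'rV[R]_3).
Notation point := 'rV[R]_3.

Definition straight : embedding R e :=
  {| emb_pt := p; emb_arc := fun u v t => (1 - t) *: p u + t *: p v |}.

Lemma cycle_image_polygon s : uniq s -> cycle_image straight s = polygon p s.
Proof.
move=> U; rewrite /polygon edges_next //; apply/seteqP; split=> q.
  move=> [u us [t t01 ->]]; exists (p u, p (next s u)).
    by apply/mapP; exists (u, next s u) => //; apply/mapP; exists u.
  by exists t => //; move: t01; rewrite /unit_I /= in_itv.
move=> [f /mapP[g /mapP[u us ->] ->] [t t01 ->]] /=.
by exists u => //; exists t => //; rewrite /unit_I /= in_itv.
Qed.

Hypothesis e_irr : irreflexive e.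
Hypothesis disjoint_edges : forall u v u' v' (t t' : R), e u v -> e u' v' ->
  0 < t < 1 -> 0 <= t' <= 1 ->
  (1 - t) *: p u + t *: p v = (1 - t') *: p u' + t' *: p v' ->
  ((u == u') && (v == v') || (u == v') && (v == u')).
Hypothesis p_inj : injective p.
Hypothesis no_isolated : forall w, exists w', e w w'.

(** That an open edge misses a vertex [w] is the disjointness of edges applied to some edge at [w]
    and the parameter 0. This is why [disjoint_edges] takes [t'] in the closed interval and why
    isolated vertices are excluded. *)
Lemma straight_is_embedding : is_embedding straight.
Proof.
have inc (t : R) : 0 < t < 1 -> 0 <= t <= 1 by lra.
split=> [//|]; split.
  move=> u v uv; have puv : p u != p v.
    by apply/eqP => /p_inj E; rewrite E e_irr in uv.
  split=> /=.
  - apply: continuous_subspaceT => t.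
    apply: cvgD; apply: cvgZl.
      by apply: cvgB; [exact: cvg_cst|exact: cvg_id].
    exact: cvg_id.
  - by rewrite subr0 scale1r scale0r addr0.
  - by rewrite subrr scale0r scale1r add0r.
  - by move=> t _; rewrite subKr addrC.
  - move=> t t' _ _ E; apply/eqP; rewrite -subr_eq0.
    have : (t - t') *: (p v - p u) = 0.
      have -> : (t - t') *: (p v - p u) = ((1 - t) *: p u + t *: p v) - ((1 - t') *: p u + t' *: p v).
        by apply: pointP; rewrite !cE; ring.
      by rewrite E subrr.
    by move/eqP; rewrite scaler_eq0 [p v - _ == 0]subr_eq0 [p v == _]eq_sym (negbTE puv) orbF.
split.
  move=> u v w t uv; rewrite /open_I /= in_itv /= => t01 E.
  have [w' ww'] := no_isolated w.
  have := @disjoint_edges u v w w' t 0 uv ww' t01; rewrite subr0 scale1r scale0r addr0 lexx ler01.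
  move=> /(_ isT E) /orP[]/andP[/eqP uE /eqP vE].
    move: E; rewrite uE => E; have : t *: (p v - p w) = 0.
      have -> : t *: (p v - p w) = ((1 - t) *: p w + t *: p v) - p w.
        by apply: pointP; rewrite !cE; ring.
      by rewrite E subrr.
    move/eqP; rewrite scaler_eq0 subr_eq0 => /orP[/eqP|/eqP /p_inj vw]; first lra.
    by rewrite uE vw e_irr in uv.
  move: E; rewrite vE => E; have : (1 - t) *: (p u - p w) = 0.
    have -> : (1 - t) *: (p u - p w) = ((1 - t) *: p u + t *: p w) - p w.
      by apply: pointP; rewrite !cE; ring.
    by rewrite E subrr.
  move/eqP; rewrite scaler_eq0 [p u - _ == 0]subr_eq0 => /orP[/eqP|/eqP /p_inj vw]; first lra.
  by rewrite vE vw e_irr in uv.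
move=> u v u' v' t t' uv u'v'; rewrite /open_I /= !in_itv /= => t01 t'01 n E.
by apply: n; exact: (@disjoint_edges u v u' v' t t' uv u'v' t01 (inc _ t'01) E).
Qed.

End StraightEmbedding.

(** * Stacked tetrahedra *)

Section Stacked.
Variables (R : realType) (par : nat -> seq nat) (p : nat -> 'rV[R]_3) (N : nat).
Notation point := 'rV[R]_3.
Implicit Types (f g : seq nat) (w : nat -> R) (i j k u v x y z : nat).

(** Facets are increasing lists, so that equality of lists is equality of sets; appending [v] keeps
    the order because [v] exceeds every entry of [par v]. *)
Definition new_facet v f : Prop :=
  if v == 3 then f = [:: 0; 1; 2; 3]%N
  else exists2 i, i \in par v & f = rcons (rem i (par v)) v.

(* [f] is created by the insertion of vertex [v < k] and has not been
   subdivided by a vertex before [k]; vertices 0..3 span the initial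
   tetrahedron. *)
Definition facet k f : Prop := exists v,
  [/\ (3 <= v < k)%N, new_facet v f & forall u, (v < u < k)%N -> par u <> f].

Hypothesis N4 : (4 <= N)%N.
Hypothesis par_ok : forall k, (4 <= k < N)%N ->
  [/\ sorted ltn (par k), size (par k) = 4, {in par k, forall j, (j < k)%N} & facet k (par k)].
Hypothesis p_base : vol (p 0) (p 1) (p 2) (p 3) != 0.
Hypothesis p_rec : forall k, (4 <= k < N)%N -> p k = 4^-1 *: \sum_(j <- par k) p j.

Lemma sorted_rem_rcons s i v : sorted ltn s -> {in s, forall j, (j < v)%N} ->
  sorted ltn (rcons (rem i s) v).
Proof.
move=> srt lt; rewrite sorted_pairwise; last exact: ltn_trans.
rewrite pairwise_rcons; apply/andP; split.
  by apply/allP => j /mem_rem /lt.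
rewrite -sorted_pairwise; last exact: ltn_trans.
by apply: (subseq_sorted ltn_trans) srt; exact: rem_subseq.
Qed.

Lemma facet_ok k f : (k <= N)%N -> facet k f ->
  [/\ sorted ltn f, size f = 4 & {in f, forall j, (j < k)%N}].
Proof.
move=> kN [v [/andP[v3 vk]]]; rewrite /new_facet; case: eqP => [-> -> _|/eqP v3n].
  by split=> // j; rewrite !inE => /or4P[] /eqP ->; lia.
have v4 : (4 <= v < N)%N by lia.
have [srt sz lt _] := par_ok v4.
move=> [i ip ->] _; split; first exact: sorted_rem_rcons.
  by rewrite size_rcons size_rem // sz.
move=> j; rewrite mem_rcons inE => /orP[/eqP -> //|/mem_rem /lt jv].
exact: ltn_trans jv vk.
Qed.

Lemma facet_mono k f : facet k.+1 f ->
  new_facet k f \/ (facet k f /\ par k <> f).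
Proof.
move=> [v [/andP[v3 vk] nf h]]; have [E|vk'] := eqVneq v k; first by left; rewrite -E.
right; split; last by apply: h; lia.
by exists v; split=> //; [lia|move=> u uk; apply: h; lia].
Qed.

Lemma facet_missing k f : (k <= N)%N -> facet k f -> forall g, sorted ltn g -> size g = 4 ->
  g <> f -> exists2 i, i \in g & i \notin f.
Proof.
move=> kN /(facet_ok kN)[srt sz _] g srtg szg gf.
have [/allP s|/allPn[i ig nf]] := boolP (all (mem f) g); last by exists i.
exfalso; apply: gf; apply: (irr_sorted_eq ltn_trans ltnn) => //.
have ug : uniq g := sorted_uniq ltn_trans ltnn srtg.
by have [] := uniq_min_size ug s; rewrite ?sz ?szg.
Qed.

Definition wsum (V : lmodType R) w (q : nat -> V) : V := \sum_(i < N) w i *: q i.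

(** A point of the complex in barycentric coordinates, recorded as weights on all labels so that
    points of different facets can be compared. *)
Definition simplex k w : Prop :=
  [/\ forall i, 0 <= w i, \sum_(i < N) w i = 1 &
      exists2 f, facet k f & forall i, i \notin f -> w i = 0].

Lemma sum_indicator (V : lmodType R) s (q : nat -> V) : uniq s -> {in s, forall j, (j < N)%N} ->
  \sum_(i < N) ((i : nat) \in s)%:R *: q i = \sum_(j <- s) q j.
Proof.
move=> us lt; rewrite (eq_bigr (fun i : 'I_N => if (i : nat) \in s then q i else 0)).
  rewrite -big_mkcond /= -(big_mkord (fun i => i \in s) (fun i => q i)) -big_filter.
  apply: perm_big; apply: uniq_perm => //; first by rewrite filter_uniq // iota_uniq.
  move=> i; rewrite mem_filter mem_index_iota /=.
  by case: (boolP (i \in s)) => //= /lt ->.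
by move=> i _; case: ifP; rewrite ?scale1r ?scale0r.
Qed.

(* Barycentric weight on the new vertex [k] is spread evenly over the old facet [par k]. *)
Definition spread k w i : R :=
  (if i == k then 0 else w i) + (i \in par k)%:R * (w k / 4).

(** Stated for any module: for the constant 1 it shows that spreading preserves the total weight,
    and for [p] that it preserves the point. *)
Lemma wsum_spread (V : lmodType R) k w (q : nat -> V) : (4 <= k < N)%N ->
  wsum (spread k w) q = wsum w q - w k *: q k + (w k / 4) *: \sum_(j <- par k) q j.
Proof.
move=> k4; have [srt sz lt _] := par_ok k4.
have up : uniq (par k) := sorted_uniq ltn_trans ltnn srt.
have kN : (k < N)%N by lia.
rewrite -sum_indicator //; last by move=> j /lt; lia.
have -> : w k *: q k = \sum_(i < N) (if (i : nat) == k then w i *: q i else 0).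
  rewrite (bigD1 (Ordinal kN)) //= eqxx big1 ?addr0 // => i /eqP ik.
  by case: eqP => // E; case: ik; exact: val_inj.
rewrite /wsum scaler_sumr -sumrB -big_split /=; apply: eq_bigr => i _.
rewrite /spread scalerDl scalerA [_ * (w k / 4)]mulrC; congr (_ + _).
by case: eqP => [->|_]; rewrite ?subrr ?scale0r ?subr0.
Qed.

(** A facet of the next stage either contains [k] and omits a vertex of [par k], or is an old facet
    other than [par k]. In both cases some vertex of [par k] has weight 0. *)
Lemma simplex_spread k w : (4 <= k < N)%N -> simplex k.+1 w ->
  simplex k (spread k w) /\ exists2 i, i \in par k & w i = 0.
Proof.
move=> k4 [w0 w1 [f ff fw]].
have [srt sz lt fpar] := par_ok k4.
have nk : k \notin par k by apply/negP => /lt; rewrite ltnn.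
have s0 i : 0 <= spread k w i.
  apply: addr_ge0; first by case: ifP.
  by apply: mulr_ge0; [exact: ler0n|apply: divr_ge0].
have s1 : \sum_(i < N) spread k w i = 1.
  have := @wsum_spread R^o k w (fun=> 1) k4; rewrite /wsum.
  have e (g : nat -> R) : \sum_(i < N) g i *: (1 : R^o) = \sum_(i < N) g i.
    by apply: eq_bigr => i _; rewrite /GRing.scale /= mulr1.
  rewrite !e w1 big_const_seq /= count_predT sz /= => ->.
  by rewrite /GRing.scale /=; field.
case: (facet_mono ff) => [|[fk npf]].
  rewrite /new_facet; case: eqP => [E|_]; first by lia.
  move=> [i ip fE]; split; last first.
    exists i => //; apply: fw; rewrite fE mem_rcons inE negb_or.
    rewrite mem_rem_uniqF; last exact: sorted_uniq ltn_trans ltnn _ srt.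
    by rewrite andbT; apply/eqP => E; rewrite E in ip; rewrite ip in nk.
  split=> //; exists (par k) => // j jp; rewrite /spread (negbTE jp) mul0r addr0.
  case: eqP => // /eqP jk; apply: fw; rewrite fE mem_rcons inE negb_or jk /=.
  by apply/negP => /mem_rem; apply/negP.
have kN : (k <= N)%N by lia.
have [_ _ flt] := facet_ok kN fk.
have wk : w k = 0 by apply: fw; apply/negP => /flt; rewrite ltnn.
have sE i : spread k w i = w i.
  by rewrite /spread wk mul0r mulr0 addr0; case: eqP => // ->.
split; last first.
  by have [i ip nf] := facet_missing kN fk srt sz npf; exists i => //; exact: fw.
by split=> //; exists f => // j /fw; rewrite sE.
Qed.

Lemma facet4 f : facet 4 f -> f = [:: 0; 1; 2; 3]%N.
Proof.
move=> [v [v3]]; have -> : v = 3%N by lia.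
by [].
Qed.

Lemma wsum_base (V : lmodType R) w (q : nat -> V) : simplex 4 w ->
  wsum w q = w 0%N *: q 0%N + w 1%N *: q 1%N + w 2%N *: q 2%N + w 3%N *: q 3%N.
Proof.
move=> [_ _ [f /facet4 -> fw]].
transitivity (\sum_(i < N) ((i : nat) \in [:: 0; 1; 2; 3]%N)%:R *: (w i *: q i)).
  apply: eq_bigr => i _; case: (boolP ((i : nat) \in _)) => [_|/fw ->].
    by rewrite scale1r.
  by rewrite !scale0r.
rewrite (sum_indicator (fun i => w i *: q i)) //; last first.
  by move=> j; rewrite !inE => /or4P[] /eqP ->; lia.
by rewrite !big_cons big_nil addr0 !addrA.
Qed.

(** Spreading the weight of [k] reduces the claim to the stage before. That weight is recovered as
    four times the least spread weight on [par k], since some vertex of [par k] had weight 0 to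
    begin with. *)
Lemma simplex_inj k w w' : (4 <= k <= N)%N -> simplex k w -> simplex k w' ->
  wsum w p = wsum w' p -> forall i, w i = w' i.
Proof.
elim: k w w' => [|k IH] w w'; first by lia.
case: (ltnP k 4) => [k3 kN|k4 kN]; last first.
  have k4N : (4 <= k < N)%N by lia.
  move=> sw sw' E.
  have [s1 [i ip wi]] := simplex_spread k4N sw.
  have [s1' [j jp w'j]] := simplex_spread k4N sw'.
  have [srt sz lt _] := par_ok k4N.
  have pE (h : nat -> R) : wsum (spread k h) p = wsum h p.
    by rewrite wsum_spread // p_rec // scalerA subrK.
  have S := IH _ _ _ s1 s1'; have {}S : forall i, spread k w i = spread k w' i.
    by apply: S; [lia|rewrite !pE].
  have [w0 _ _] := sw; have [w'0 _ _] := sw'.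
  have nk : k \notin par k by apply/negP => /lt; rewrite ltnn.
  have ik : (i == k) = false by apply/eqP => E'; move: nk; rewrite -{1}E' ip.
  have jk : (j == k) = false by apply/eqP => E'; move: nk; rewrite -{1}E' jp.
  have Ei := S i; have Ej := S j.
  rewrite /spread ik ip wi !mul1r add0r in Ei; rewrite /spread jk jp w'j !mul1r add0r in Ej.
  have wk : w k = w' k by have := w0 j; have := w'0 i; lra.
  move=> u; have := S u; rewrite /spread wk; case: eqP => [->|_ /addIr //].
  by rewrite wk.
have kE : k = 3%N by lia.
rewrite kE => sw sw'; rewrite !wsum_base // => E.
have one (u : nat -> R) : simplex 4 u -> u 0%N + u 1%N + u 2%N + u 3%N = 1.
  move=> su; have h : \sum_(i < N) u i * 1 = u 0%N * 1 + u 1%N * 1 + u 2%N * 1 + u 3%N * 1.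
    exact: (@wsum_base R^o u (fun=> 1) su).
  have [_ s1 _] := su; rewrite -s1; move: h; rewrite !mulr1 => <-.
  by apply: eq_bigr => i _; rewrite mulr1.
have o := one _ sw; have o' := one _ sw'.
have [||e0 e1 e2 e3] := @vol_indep _ _ _ _ _ (w 0%N - w' 0%N) (w 1%N - w' 1%N) (w 2%N - w' 2%N)
    (w 3%N - w' 3%N) p_base; first by lra.
  move/eqP: E; rewrite -subr_eq0 => /eqP <-.
  by apply: pointP; rewrite !cE; ring.
have [_ _ [f /facet4 -> fw]] := sw; have [_ _ [f' /facet4 -> fw']] := sw'.
move=> i; have [|ni] := boolP (i \in [:: 0; 1; 2; 3]%N); last by rewrite fw // fw'.
by rewrite !inE => /or4P[] /eqP ->; lra.
Qed.

Definition adj u v : bool :=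
  [&& u != v, (u < N)%N, (v < N)%N & (maxn u v < 4)%N || (minn u v \in par (maxn u v))].

Lemma adj_sym : symmetric adj.
Proof. by move=> u v; rewrite /adj eq_sym maxnC minnC; case: (u < N)%N; case: (v < N)%N. Qed.

(** Allowing equality lets statements about triples cover vertices, edges and triangles alike. *)
Definition near_adj u v : bool := (u == v) || adj u v.

Lemma near_adj_par u k : (4 <= k)%N -> (u < k)%N -> near_adj u k -> u \in par k.
Proof.
move=> k4 uk; rewrite /near_adj /adj => /orP[/eqP E|/and4P[_ _ _]]; first by lia.
by rewrite (maxn_idPr (ltnW uk)) (minn_idPl (ltnW uk)) ltnNge k4.
Qed.

(** By induction on the stage. If [k] occurs among the three, or if their common facet is the
    subdivided [par k], one of the four vertices of [par k] differs from all three, and the new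
    facet omitting it contains them. *)
Lemma clique_facet k x y z : (4 <= k <= N)%N -> (x < k)%N -> (y < k)%N -> (z < k)%N ->
  near_adj x y -> near_adj y z -> near_adj x z ->
  exists2 f, facet k f & [/\ x \in f, y \in f & z \in f].
Proof.
have sym u v : near_adj u v = near_adj v u by rewrite /near_adj eq_sym adj_sym.
elim: k x y z => [|k IH] x y z; first by lia.
case: (ltnP k 4) => [k3 kN|k4 kN] xk yk zk xy yz xz.
  exists [:: 0; 1; 2; 3]%N; last by rewrite !inE; split; lia.
  by exists 3%N; split; [lia|by []|move=> u; lia].
have k4N : (4 <= k < N)%N by lia.
have [srt sz lt fpar] := par_ok k4N.
have up : uniq (par k) := sorted_uniq ltn_trans ltnn srt.
have avoid (s : seq nat) : (size s <= 3)%N -> exists2 i, i \in par k & i \notin s.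
  move=> s3; have [/allP a|/allPn[i ip ni]] := boolP (all (mem s) (par k)); last by exists i.
  by have := leq_trans (uniq_leq_size up a) s3; rewrite sz.
have new i : i \in par k -> facet k.+1 (rcons (rem i (par k)) k).
  move=> ip; exists k; split; [lia| |by move=> u; lia].
  by rewrite /new_facet; case: eqP => [E|_]; [exfalso; lia|exists i].
have inpar u : (u < k.+1)%N -> near_adj u k -> (u == k) || (u \in par k).
  rewrite ltnS leq_eqVlt => /orP[->//|uk] a; apply/orP; right; exact: near_adj_par.
have innew i u : (u == k) || (u \in par k) -> u != i -> u \in rcons (rem i (par k)) k.
  by move=> h ui; rewrite mem_rcons inE mem_rem_uniq // !inE ui.
have top u v : (u < k.+1)%N -> (v < k.+1)%N -> near_adj u k -> near_adj v k ->
    exists2 f, facet k.+1 f & [/\ k \in f, u \in f & v \in f].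
  move=> uk vk ua va; have [//|i ip] := avoid [:: u; v; k].
  rewrite !inE !negb_or => /and3P[iu iv ik]; exists (rcons (rem i (par k)) k); first exact: new.
  split; apply: innew; rewrite ?eqxx // ?(eq_sym _ i) //; exact: inpar.
have [E|xk'] := eqVneq x k.
  by have [||||f ff [h1 h2 h3]] := top y z; rewrite // -?E 1?sym //; exists f; rewrite ?E.
have [E|yk'] := eqVneq y k.
  by have [||||f ff [h1 h2 h3]] := top x z; rewrite // -?E // 1?sym //; exists f; rewrite ?E.
have [E|zk'] := eqVneq z k.
  by have [||||f ff [h1 h2 h3]] := top x y; rewrite // -?E //; exists f; rewrite ?E.
have lt_k u : (u < k.+1)%N -> u != k -> (u < k)%N by rewrite ltnS ltn_neqAle => -> ->.
have kN' : (4 <= k <= N)%N by rewrite k4 ltnW //; case/andP: k4N.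
have [f ff [h1 h2 h3]] :=
  IH x y z kN' (lt_k x xk xk') (lt_k y yk yk') (lt_k z zk zk') xy yz xz.
have [E|fp] := eqVneq f (par k).
  have [//|i ip] := avoid [:: x; y; z].
  rewrite !inE !negb_or => /and3P[ix iy iz]; exists (rcons (rem i (par k)) k); first exact: new.
  by split; apply: innew; rewrite -?E ?h1 ?h2 ?h3 ?orbT // eq_sym.
exists f => //; case: ff => v [vk nf h]; exists v; split=> //.
  by have /andP[-> /= /ltnW] := vk.
move=> u uk; have [->|uk'] := eqVneq u k; first by apply/eqP; rewrite eq_sym.
by apply: h; move: uk => /andP[-> /=]; rewrite ltnS leq_eqVlt (negbTE uk').
Qed.

Definition w3 (l : R) x (m : R) y (n : R) z i : R :=
  l * (i == x)%:R + m * (i == y)%:R + n * (i == z)%:R.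

Lemma wsum_w3 (V : lmodType R) (q : nat -> V) l x m y n z :
  (x < N)%N -> (y < N)%N -> (z < N)%N ->
  wsum (w3 l x m y n z) q = l *: q x + m *: q y + n *: q z.
Proof.
move=> xN yN zN.
have one (c : R) u : (u < N)%N -> \sum_(i < N) (c * ((i : nat) == u)%:R) *: q i = c *: q u.
  move=> uN; rewrite (bigD1 (Ordinal uN)) //= eqxx mulr1 big1 ?addr0 // => i /eqP iu.
  by case: eqP => [E|_]; [case: iu; exact: val_inj|rewrite mulr0 scale0r].
rewrite -(one l x xN) -(one m y yN) -(one n z zN) -!big_split; apply: eq_bigr => i _.
by rewrite /w3 !scalerDl.
Qed.

Lemma simplex_w3 l x m y n z : (x < N)%N -> (y < N)%N -> (z < N)%N ->
  near_adj x y -> near_adj y z -> near_adj x z ->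
  0 <= l -> 0 <= m -> 0 <= n -> l + m + n = 1 -> simplex N (w3 l x m y n z).
Proof.
move=> xN yN zN xy yz xz l0 m0 n0 S; split.
- by move=> i; rewrite /w3 !addr_ge0 // mulr_ge0.
- have h : \sum_(i < N) w3 l x m y n z i * 1 = l * 1 + m * 1 + n * 1.
    exact: (@wsum_w3 R^o (fun=> 1) l x m y n z xN yN zN).
  by rewrite -S; move: h; rewrite !mulr1 => <-; apply: eq_bigr => i _; rewrite mulr1.
have [|||||||f ff [h1 h2 h3]] := @clique_facet N x y z; rewrite //; first by lia.
exists f => // i nf; rewrite /w3.
have ne u : u \in f -> (i == u) = false by move=> uf; apply/eqP => E; rewrite E uf in nf.
by rewrite !ne // !mulr0 !addr0.
Qed.

Lemma w3_inj (l : R) x m y n z l' x' m' y' n' z' :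
  (x < N)%N -> (y < N)%N -> (z < N)%N -> near_adj x y -> near_adj y z -> near_adj x z ->
  (x' < N)%N -> (y' < N)%N -> (z' < N)%N -> near_adj x' y' -> near_adj y' z' -> near_adj x' z' ->
  0 <= l -> 0 <= m -> 0 <= n -> l + m + n = 1 ->
  0 <= l' -> 0 <= m' -> 0 <= n' -> l' + m' + n' = 1 ->
  l *: p x + m *: p y + n *: p z = l' *: p x' + m' *: p y' + n' *: p z' ->
  forall i, w3 l x m y n z i = w3 l' x' m' y' n' z' i.
Proof.
move=> *; apply: (@simplex_inj N); rewrite ?wsum_w3 //; first by rewrite N4 leqnn.
  exact: simplex_w3.
exact: simplex_w3.
Qed.

Lemma near_refl u : near_adj u u. Proof. by rewrite /near_adj eqxx. Qed.

Lemma adj_near u v : adj u v -> near_adj u v.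
Proof. by rewrite /near_adj => ->; rewrite orbT. Qed.

Lemma adj_lt u v : adj u v -> [/\ (u < N)%N, (v < N)%N & u != v].
Proof. by move=> /and4P[]. Qed.

Lemma stack_p_inj u v : (u < N)%N -> (v < N)%N -> p u = p v -> u = v.
Proof.
move=> uN vN E; have := @w3_inj 1 u 0 u 0 u 1 v 0 v 0 v.
rewrite !near_refl uN vN !scale0r !addr0 !scale1r => /(_ isT isT isT isT isT isT isT isT isT isT isT isT).
move=> /(_ ler01 (lexx 0) (lexx 0) erefl ler01 (lexx 0) (lexx 0) erefl E u).
by rewrite /w3 eqxx !mul0r !addr0 !mul1r; case: eqP => // _ /eqP; rewrite oner_eq0.
Qed.

(** An affine relation, scaled by [d], is added to the barycentric weights 1/3. Both weight vectors
    describe the same point, so the relation vanishes. [M] exceeds the coefficients, which keeps the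
    weights nonnegative. *)
Lemma stack_nondeg x y z : adj x y -> adj y z -> adj x z -> nondeg (p x) (p y) (p z).
Proof.
move=> /[dup] /adj_lt[xN yN nxy] /adj_near xy /[dup] /adj_lt[_ zN nyz] /adj_near yz.
move=> /[dup] /adj_lt[_ _ nxz] /adj_near xz l m n S E.
pose M := `|l| + `|m| + `|n| + 1; pose d := (3 * M)^-1.
have M1 : 1 <= M by rewrite /M lerDr !addr_ge0.
have dM : 3 * (d * M) = 1 by rewrite /d; field; lra.
have d0 : 0 < d by rewrite /d invr_gt0; lra.
have b (c : R) : `|c| <= M -> 0 <= 3^-1 + d * c.
  rewrite ler_norml => /andP[k1 _].
  have : d * - M <= d * c by rewrite ler_pM2l.
  by lra.
have nl := normr_ge0 l; have nm := normr_ge0 m; have nn := normr_ge0 n.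
have bl := b l; have bm := b m; have bn := b n.
have key := @w3_inj (3^-1 + d * l) x (3^-1 + d * m) y (3^-1 + d * n) z 3^-1 x 3^-1 y 3^-1 z
   xN yN zN xy yz xz xN yN zN xy yz xz.
have {}key : forall i,
      w3 (3^-1 + d * l) x (3^-1 + d * m) y (3^-1 + d * n) z i = w3 3^-1 x 3^-1 y 3^-1 z i.
  apply: key; rewrite ?invr_ge0 ?ler0n //.
  - by apply: bl; rewrite /M; lra.
  - by apply: bm; rewrite /M; lra.
  - by apply: bn; rewrite /M; lra.
  - rewrite (_ : _ + _ + _ = 1 + d * (l + m + n)); last by field.
    by rewrite S mulr0 addr0.
  - by field.
  rewrite (_ : _ + _ + _ = 3^-1 *: p x + 3^-1 *: p y + 3^-1 *: p z +
    d *: (l *: p x + m *: p y + n *: p z)).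
    by rewrite E scaler0 addr0.
  by apply: pointP; rewrite !cE; ring.
have z_of (c : R) : 3^-1 + d * c = 3^-1 -> c = 0.
  move=> h; have : d * c = 0 by lra.
  by move/eqP; rewrite mulf_eq0 (gt_eqF d0) => /eqP.
by split; apply: z_of; [have := key x|have := key y|have := key z];
  rewrite /w3 ?eqxx ?(negbTE nxy) ?(negbTE nyz) ?(negbTE nxz) 1?eq_sym ?(negbTE nxy)
  1?[z == y]eq_sym ?(negbTE nyz) 1?[z == x]eq_sym ?(negbTE nxz) ?mulr0 ?mulr1 ?addr0 ?add0r.
Qed.

Lemma w3_seg_tri u v x y z (t l m n : R) : adj u v -> adj x y -> adj y z -> adj x z ->
  0 <= t <= 1 -> 0 <= l -> 0 <= m -> 0 <= n -> l + m + n = 1 ->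
  (1 - t) *: p u + t *: p v = l *: p x + m *: p y + n *: p z ->
  forall i, (1 - t) * (i == u)%:R + t * (i == v)%:R = w3 l x m y n z i.
Proof.
move=> /[dup] /adj_lt[uN vN nuv] /adj_near uv /[dup] /adj_lt[xN yN nxy] /adj_near xy.
move=> /[dup] /adj_lt[_ zN nyz] /adj_near yz /adj_near xz t01 l0 m0 n0 S E i.
have := @w3_inj (1 - t) u t v 0 v l x m y n z uN vN vN uv (near_refl v) uv xN yN zN xy yz xz.
rewrite scale0r !addr0 => h.
have {}h : forall i, w3 (1 - t) u t v 0 v i = w3 l x m y n z i by apply: h => //; lra.
by rewrite -h /w3 mul0r addr0.
Qed.

Lemma stack_edge_clear x y z u v : adj x y -> adj y z -> adj x z -> adj u v ->
  ~~ ((u \in [:: x; y; z]) && (v \in [:: x; y; z])) -> edge_clear p x y z u v.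
Proof.
move=> xy yz xz uv nin q [t t01 ->] [l [m [n [l0 m0 n0 S E]]]].
have h := w3_seg_tri uv xy yz xz t01 l0 m0 n0 S E.
have [_ _ nuv] := adj_lt uv.
have out (w : nat) : w \notin [:: x; y; z] -> w3 l x m y n z w = 0.
  rewrite !inE !negb_or => /and3P[/negbTE wx /negbTE wy /negbTE wz].
  by rewrite /w3 wx wy wz !mulr0 !addr0.
have [uin|/out u0] := boolP (u \in [:: x; y; z]).
  rewrite uin /= in nin; have := h v; rewrite out // eqxx eq_sym (negbTE nuv) mulr0 mulr1 add0r => t0.
  exists u; first exact: mem_head.
  by split=> //; rewrite t0 subr0 scale1r scale0r addr0.
have := h u; rewrite u0 eqxx (negbTE nuv) mulr0 mulr1 addr0 => t1.
have {}t1 : t = 1 by lra.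
have [vin|/out v0] := boolP (v \in [:: x; y; z]).
  exists v; first by rewrite !inE eqxx orbT.
  by split=> //; rewrite t1 subrr scale1r scale0r add0r.
have := h v; rewrite v0 t1 eqxx subrr mul0r add0r mulr1 => /eqP; by rewrite oner_eq0.
Qed.

Lemma stack_tri_disjoint x y z x' y' z' : adj x y -> adj y z -> adj x z ->
  adj x' y' -> adj y' z' -> adj x' z' ->
  (forall w : nat, w \in [:: x; y; z] -> w \notin [:: x'; y'; z']) ->
  forall q, tri (p x) (p y) (p z) q -> ~ tri (p x') (p y') (p z') q.
Proof.
move=> /[dup] /adj_lt[xN yN nxy] /adj_near xy /[dup] /adj_lt[_ zN nyz] /adj_near yz.
move=> /[dup] /adj_lt[_ _ nxz] /adj_near xz.
move=> /[dup] /adj_lt[x'N y'N _] /adj_near xy' /[dup] /adj_lt[_ z'N _] /adj_near yz' /adj_near xz'.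
move=> dis q [l [m [n [l0 m0 n0 S ->]]]] [l' [m' [n' [l'0 m'0 n'0 S' E]]]].
have h := w3_inj xN yN zN xy yz xz x'N y'N z'N xy' yz' xz' l0 m0 n0 S l'0 m'0 n'0 S' E.
have key (w : nat) : w \in [:: x; y; z] -> w3 l x m y n z w = 0.
  move=> win; rewrite h; have := dis w win; rewrite !inE !negb_or => /and3P[/negbTE e1 /negbTE e2 /negbTE e3].
  by rewrite /w3 e1 e2 e3 !mulr0 !addr0.
have hx := key x; have hy := key y; have hz := key z.
rewrite /w3 !inE !eqxx ?orbT /= in hx hy hz.
have {}hx := hx isT; have {}hy := hy isT; have {}hz := hz isT.
rewrite (negbTE nxy) (negbTE nxz) in hx; rewrite eq_sym (negbTE nxy) (negbTE nyz) in hy.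
rewrite (eq_sym z x) (negbTE nxz) (eq_sym z y) (negbTE nyz) in hz.
rewrite !mulr0 !mulr1 ?addr0 ?add0r in hx hy hz.
by lra.
Qed.

Lemma stack_disjoint_edges u v u' v' (t t' : R) : adj u v -> adj u' v' ->
  0 < t < 1 -> 0 <= t' <= 1 ->
  (1 - t) *: p u + t *: p v = (1 - t') *: p u' + t' *: p v' ->
  ((u == u') && (v == v') || (u == v') && (v == u')).
Proof.
move=> /[dup] /adj_lt[uN vN nuv] /adj_near uv /[dup] /adj_lt[u'N v'N nuv'] /adj_near uv' t01 t'01 E.
have := @w3_inj (1 - t) u t v 0 v (1 - t') u' t' v' 0 v' uN vN vN uv (near_refl v) uv
   u'N v'N v'N uv' (near_refl v') uv'.
rewrite !scale0r !addr0 => h.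
have {}h : forall i, w3 (1 - t) u t v 0 v i = w3 (1 - t') u' t' v' 0 v' i by apply: h => //; lra.
have hu := h u; have hv := h v.
rewrite /w3 !eqxx (negbTE nuv) [v == u]eq_sym (negbTE nuv) in hu hv.
move: hu hv; case: (eqVneq u u') => [E1|_]; case: (eqVneq v v') => [E2|_] //=;
  case: (eqVneq u v') => [E3|_]; case: (eqVneq v u') => [E4|_] //= hu hv;
  first [by lra | by exfalso; move: nuv; rewrite ?E1 ?E2 ?E3 ?E4 eqxx | by exfalso; move: nuv; rewrite E1 E4 eqxx].
Qed.

Lemma facet_clique k f x y : (4 <= k <= N)%N -> facet k f ->
  x \in f -> y \in f -> x != y -> adj x y.
Proof.
elim/ltn_ind: k f x y => k IH f x y kN [v [/andP[v3 vk] nf _]] xf yf xy.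
have small : (x < 4)%N -> (y < 4)%N -> adj x y.
  by move=> x4 y4; rewrite /adj xy gtn_max x4 y4 /=; lia.
move: nf; rewrite /new_facet; case: eqP => [_ fE|v3' [i ip fE]].
  by apply: small; [move: xf|move: yf]; rewrite fE !inE => /or4P[] /eqP ->.
have v4 : (4 <= v < N)%N by lia.
have [srt sz lt fp] := par_ok v4.
have topadj u : u \in par v -> adj u v.
  move=> up; have uv := lt _ up; rewrite /adj (maxn_idPr (ltnW uv)) (minn_idPl (ltnW uv)) up orbT.
  by have := uv; lia.
move: xf yf xy; rewrite fE !mem_rcons !inE => /orP[/eqP ->|/mem_rem xp] /orP[/eqP ->|/mem_rem yp].
- by rewrite eqxx.
- by move=> _; rewrite adj_sym; exact: topadj.
- by move=> _; exact: topadj.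
- by move=> xy'; apply: (IH v vk (par v)) => //; lia.
Qed.

(** From label 4 on, the earlier neighbours of [y] lie in [par y], which is a facet and hence a
    clique. *)
Lemma earlier_nbrs_adj x y z : adj x y -> adj z y -> (x < y)%N -> (z < y)%N -> x != z -> adj x z.
Proof.
move=> xy zy xlt zlt xz; have [_ yN _] := adj_lt xy.
case: (ltnP y 4) => y4.
  by rewrite /adj xz gtn_max (ltn_trans xlt y4) (ltn_trans zlt y4); lia.
have y4N : (4 <= y < N)%N by lia.
have [_ _ _ fp] := par_ok y4N.
apply: (@facet_clique y (par y)) => //; first by lia.
- by apply: near_adj_par => //; exact: adj_near.
- by apply: near_adj_par => //; exact: adj_near.
Qed.

Lemma stack_corner s1 s2 : uniq s1 -> (3 < size s1)%N -> cycle adj s1 -> cycle adj s2 ->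
  uniq s2 -> (forall w : nat, w \in s1 -> w \notin s2) ->
  exists s, [/\ size s = (size s1).-1, uniq s, cycle adj s, {subset s <= s1} &
    isotopic (polygon p s1) (polygon p s2) (polygon p s) (polygon p s2)].
Proof.
move=> U1 sz c1 c2 U2 dis.
have [y ys1 ymax] : exists2 y, y \in s1 & {in s1, forall x, (x <= y)%N}.
  case: s1 sz {U1 c1 dis} => // a s1 _; exists (foldr maxn a s1).
    elim: s1 => [|b s1 IH] /=; first exact: mem_head.
    rewrite /maxn; case: ifP => _; last by rewrite !inE eqxx orbT.
    by move: IH; rewrite !inE => /orP[->//|->]; rewrite !orbT.
  elim: s1 => [|b s1 IH] x; first by rewrite inE => /eqP ->.
  rewrite !inE /= leq_max => /or3P[/eqP ->|/eqP ->|xs].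
  - by rewrite IH ?mem_head ?orbT.
  - by rewrite leqnn.
  - by rewrite IH ?orbT // inE xs orbT.
have [j s' sE] := rot_to ys1.
have sz' : size s1 = (size s').+1 by rewrite -(size_rot j) sE.
case: s' => [|z s''] in sE sz'; first by rewrite sz' in sz.
case: (lastP s'') => [|l x] in sE sz'; first by rewrite sz' in sz.
(* The predecessor [x] of the greatest label [y] comes to the front, so that [y] is the second
   entry, as [corner_move] expects. *)
have sE' : rotr 1 (rot j s1) = [:: x, y, z & l] by rewrite sE (rotr1_rcons x (y :: z :: l)).
have Uxyz : uniq [:: x, y, z & l] by rewrite -sE' rotr_uniq rot_uniq.
have mE : [:: x, y, z & l] =i s1 by move=> w; rewrite -sE' mem_rotr mem_rot.
have cxyz : cycle adj [:: x, y, z & l] by rewrite -sE' rotr_cycle rot_cycle.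
have l0 : l != [::] by move: sz; rewrite sz' /= size_rcons; case: (l).
have pE : polygon p s1 = polygon p [:: x, y, z & l].
  by rewrite -sE' /rotr polygon_rot ?rot_uniq // polygon_rot.
have [xy yz] : adj x y /\ adj y z by move: cxyz => /= /and3P[].
have nxz : x != z by move: Uxyz; rewrite /= !inE !negb_or => /andP[/and3P[]].
have xz : adj x z.
  have [_ _ nxy] := adj_lt xy; have [_ _ nyz] := adj_lt yz.
  apply: (@earlier_nbrs_adj x y z) => //; first by rewrite adj_sym.
    by rewrite ltn_neqAle nxy ymax // -mE mem_head.
  by rewrite ltn_neqAle eq_sym nyz ymax // -mE !inE eqxx !orbT.
have cxz : cycle adj [:: x, z & l].
  by move: cxyz => /= /and3P[_ _ h]; rewrite xz.
exists [:: x, z & l]; split=> //.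
- by rewrite sz' /= size_rcons.
- by move: Uxyz => /=; rewrite !inE !negb_or => /andP[/and3P[_ -> ->] /andP[_ ->]].
- by move=> w; rewrite -mE !inE => /orP[->|/orP[->|->]]; rewrite ?orbT.
have edge_adj s u v : cycle adj s -> uniq s -> (u, v) \in edges s -> adj u v.
  move=> cs us; rewrite edges_next // => /mapP[w ws [-> ->]].
  exact: next_cycle.
have Uxz : uniq [:: x, z & l].
  by move: Uxyz => /=; rewrite !inE !negb_or => /andP[/and3P[_ -> ->] /andP[_ ->]].
rewrite pE; apply: corner_move => //; first exact: stack_nondeg.
  move=> w ws2; apply/negP => wxyz.
  have : w \in s1 by rewrite -mE; move: wxyz; rewrite !inE => /or3P[] ->; rewrite ?orbT.
  by move=> /dis; rewrite ws2.
move=> u v uv nuv; apply: stack_edge_clear => //.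
  by move: uv; rewrite mem_cat => /orP[]; apply: edge_adj.
apply/negP => /andP[uin vin].
have in1 (w : nat) : w \in [:: x; y; z] -> w \in s1.
  by rewrite -mE !inE => /or3P[] ->; rewrite ?orbT.
move: uv; rewrite mem_cat => /orP[|/edges_mem[us2 _]]; last first.
  by have := dis _ (in1 _ uin); rewrite us2.
rewrite edges_cons /= inE (negbTE nuv) /= => uv; have [ul vl] := mem_zip_sides uv.
(* An edge with both ends in the triangle could only lead from [z] back to [x], which would force
   [l] to be empty. *)
move: Uxyz; rewrite /= !inE !negb_or -!andbA => /and5P[n1 n2 n3 n4 /and3P[n5 n6 _]].
have uz : u = z.
  move: uin ul; rewrite !inE => /or3P[/eqP ->|/eqP ->|/eqP -> //].
    by rewrite (negbTE n2) (negbTE n3).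
  by rewrite (negbTE n4) (negbTE n5).
have vx : v = x.
  move: vin vl; rewrite mem_rcons !inE => /or3P[/eqP -> //|/eqP ->|/eqP ->].
    by rewrite eq_sym (negbTE n1) (negbTE n5).
  by rewrite eq_sym (negbTE n2) (negbTE n6).
move: uv l0 n3 n6; rewrite uz vx; case: (l) => // h l' uv _ n3' n6'.
move: uv; rewrite /= inE => /orP[/eqP[xh]|/mem_zip_sides[zl _]].
  by move: n3'; rewrite xh mem_head.
by rewrite zl in n6'.
Qed.

Lemma stack_trivial m s1 s2 : (size s1 + size s2 <= m)%N ->
  uniq s1 -> uniq s2 -> (2 < size s1)%N -> (2 < size s2)%N -> cycle adj s1 -> cycle adj s2 ->
  (forall w : nat, w \in s1 -> w \notin s2) -> trivial_link (polygon p s1) (polygon p s2).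
Proof.
elim: m s1 s2 => [|m IH] s1 s2 szm U1 U2 z1 z2 c1 c2 dis; first by lia.
have dis' (w : nat) : w \in s2 -> w \notin s1 by move=> w2; apply/negP => /dis; rewrite w2.
case: (ltnP 3 (size s1)) => h1.
  have [s [sz U c sub i]] := stack_corner U1 h1 c1 c2 U2 dis.
  apply: (isotopic_trivial i); apply: IH => //; rewrite ?sz; try lia.
  by move=> w /sub /dis.
case: (ltnP 3 (size s2)) => h2.
  have [s [sz U c sub i]] := stack_corner U2 h2 c2 c1 U1 dis'.
  apply: (isotopic_trivial (isotopic_swap i)); apply: IH => //; rewrite ?sz; try lia.
  by move=> w w1; apply/negP => /sub; apply/negP; exact: dis.
case: s1 => [|x [|y [|z [|? ?]]]] // in U1 z1 c1 dis h1 szm dis' *.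
case: s2 => [|x' [|y' [|z' [|? ?]]]] // in U2 z2 c2 dis dis' h2 szm *.
move: c1 c2 => /= /and4P[xy yz zx _] /and4P[xy' yz' zx' _].
have xz : adj x z by rewrite adj_sym.
have xz' : adj x' z' by rewrite adj_sym.
rewrite !polygon3; apply: disjoint_triangles_unlinked; try exact: stack_nondeg.
exact: stack_tri_disjoint.
Qed.

End Stacked.

Lemma map_zip (A A' B B' : Type) (f : A -> A') (g : B -> B') s t :
  [seq (f x.1, g x.2) | x <- zip s t] = zip (map f s) (map g t).
Proof. by elim: s t => [|x s IH] [|y t] //=; rewrite IH. Qed.

(** * The drawing of a stacked complex is linkless *)

Section StackedLinkless.
Variables (R : realType) (par : nat -> seq nat).
Notation point := 'rV[R]_3.

Definition stack_point (k : nat) (q : seq point) : point :=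
  if (k < 4)%N then mkpt (k == 1)%:R (k == 2)%:R (k == 3)%:R
  else 4^-1 *: \sum_(j <- par k) nth 0 q j.

(** The whole list of earlier points is carried along because [par k] may refer to any of them. *)
Fixpoint stack_points (k : nat) : seq point :=
  if k is k'.+1 then rcons (stack_points k') (stack_point k' (stack_points k')) else [::].

Definition stack_pos (k : nat) : point := nth 0 (stack_points k.+1) k.

Lemma size_stack_points k : size (stack_points k) = k.
Proof. by elim: k => //= k IH; rewrite size_rcons IH. Qed.

Lemma nth_stack_points k j : (j < k)%N -> nth 0 (stack_points k) j = stack_pos j.
Proof.
elim: k => // k IH; rewrite ltnS leq_eqVlt => /orP[/eqP -> //|jk].
by rewrite /= nth_rcons size_stack_points jk IH.
Qed.

Lemma stack_posE k : stack_pos k = stack_point k (stack_points k).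
Proof. by rewrite /stack_pos /= nth_rcons size_stack_points ltnn eqxx. Qed.

Lemma stacked_linkless (N : nat) (e : rel 'I_N) : (4 <= N)%N ->
  (forall k, (4 <= k < N)%N -> [/\ sorted ltn (par k), size (par k) = 4,
     {in par k, forall j, (j < k)%N} & facet par k (par k)]) ->
  symmetric e -> irreflexive e -> (forall w, exists w', e w w') ->
  (forall u v, e u v -> adj par N u v) -> linklessly_embeddable R e.
Proof.
move=> N4 par_ok e_sym e_irr iso e_adj.
have base : vol (stack_pos 0) (stack_pos 1) (stack_pos 2) (stack_pos 3) != 0.
  rewrite !stack_posE /stack_point /=.
  by rewrite (_ : vol _ _ _ _ = 1) ?oner_eq0 // /vol /dot /cross !cE /=; ring.
have rec k : (4 <= k < N)%N -> stack_pos k = 4^-1 *: \sum_(j <- par k) stack_pos j.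
  move=> k4; rewrite stack_posE /stack_point ltnNge; have [-> _] := andP k4; rewrite /=.
  congr (_ *: _); rewrite !big_seq; apply: eq_bigr => j jp.
  by have [_ _ lt _] := par_ok k k4; rewrite nth_stack_points // lt.
pose q (v : 'I_N) : point := stack_pos v.
have qpoly s : polygon q s = polygon stack_pos (map val s).
  by rewrite /polygon /edges !map_zip -map_rot -!map_comp.
exists (straight e q); split.
  apply: straight_is_embedding => //.
  - move=> u v u' v' t t' /e_adj uv /e_adj uv' t01 t'01 E.
    exact: (stack_disjoint_edges N4 par_ok base rec uv uv' t01 t'01 E).
  - by move=> u v E; apply: val_inj; apply: (stack_p_inj N4 par_ok base rec) E; exact: ltn_ord.
move=> s1 s2 [c1 U1 z1] [c2 U2 z2] dis.
rewrite !cycle_image_polygon // !qpoly.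
have cyc s : cycle e s -> cycle (adj par N) (map val s).
  by move=> cs; rewrite cycle_map; apply: sub_cycle cs => u v; exact: e_adj.
apply: (@stack_trivial R par stack_pos N N4 par_ok base rec (size s1 + size s2)%N).
- by rewrite !size_map.
- by rewrite map_inj_uniq //; exact: val_inj.
- by rewrite map_inj_uniq //; exact: val_inj.
- by rewrite size_map.
- by rewrite size_map.
- exact: cyc.
- exact: cyc.
- move=> w /mapP[v vs1 ->]; apply/negP => /mapP[v' vs2 /val_inj E].
  by have := dis v vs1; rewrite E vs2.
Qed.

End StackedLinkless.

(* Vertices 0..N form a chain of stacked tetrahedra; each of the seven
   vertices after N subdivides a facet near one of the two ends. *)
Definition ladder_par (N k : nat) : seq nat :=
  if (k <= N)%N then [:: k - 4; k - 3; k - 2; k - 1]%N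
  else nth [::]
    [:: [:: 1; 2; 3; 5]; [:: 1; 2; 4; 5]; [:: 1; 3; 4; 5];
        [:: N - 4; N - 3; N - 2; N]; [:: N - 4; N - 3; N - 1; N];
        [:: N - 4; N - 2; N - 1; N]; [:: N - 3; N - 2; N - 1; N]]%N (k - N - 1).

(** Vertex 0 and the vertices after N are stars of degree 4. Chain edges have length 4, or length 1
    away from the ends; no three such lengths close up to a triangle, and the bounds leave out every
    pair inside the neighbourhood of a star. *)
Definition ladder_half (N u v : nat) : bool :=
  [|| (u == 0) && (1 <= v <= 4), (N < v) && (u \in ladder_par N v),
      [&& v == u + 4, 2 <= u & v < N] | [&& v == u + 1, 5 <= u & v <= N - 4]]%N.

Definition ladder (N : nat) : rel 'I_(N + 8) :=
  fun u v => ladder_half N u v || ladder_half N v u.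

(** * The ladder lies in a stacked complex *)

Section Ladder.
Variable N : nat.
Hypothesis N6 : (6 <= N)%N.
Implicit Types (u v k : nat).

Variant star_spec k : seq nat -> Type :=
| Star1 of k = (N + 1)%N : star_spec k [:: 1; 2; 3; 5]%N
| Star2 of k = (N + 2)%N : star_spec k [:: 1; 2; 4; 5]%N
| Star3 of k = (N + 3)%N : star_spec k [:: 1; 3; 4; 5]%N
| Star4 of k = (N + 4)%N : star_spec k [:: N - 4; N - 3; N - 2; N]%N
| Star5 of k = (N + 5)%N : star_spec k [:: N - 4; N - 3; N - 1; N]%N
| Star6 of k = (N + 6)%N : star_spec k [:: N - 4; N - 2; N - 1; N]%N
| Star7 of k = (N + 7)%N : star_spec k [:: N - 3; N - 2; N - 1; N]%N.

Lemma starP k : (N < k < N + 8)%N -> star_spec k (ladder_par N k).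
Proof.
move=> k8; rewrite /ladder_par ifF; last by lia.
have : (k - N - 1 < 7)%N by lia.
case E: (k - N - 1)%N => [|[|[|[|[|[|[|d]]]]]]] // _ /=.
- by apply: Star1; lia.
- by apply: Star2; lia.
- by apply: Star3; lia.
- by apply: Star4; lia.
- by apply: Star5; lia.
- by apply: Star6; lia.
- by apply: Star7; lia.
Qed.

Lemma chain_par k : (k <= N)%N -> ladder_par N k = [:: k - 4; k - 3; k - 2; k - 1]%N.
Proof. by rewrite /ladder_par => ->. Qed.

Lemma chain_facet k i : (4 <= k <= N)%N -> i \in ladder_par N k ->
  new_facet (ladder_par N) k (rcons (rem i (ladder_par N k)) k).
Proof.
by move=> k4 ip; rewrite /new_facet ifF; [exists i|lia].
Qed.

(** The vertices N + 1 to N + 3 subdivide facets created by 5, whose fourth facet 2, 3, 4, 5 is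
    taken by 6; the last four vertices subdivide the four facets created by N. *)
Lemma ladder_par_ok k : (4 <= k < N + 8)%N ->
  [/\ sorted ltn (ladder_par N k), size (ladder_par N k) = 4,
      {in ladder_par N k, forall j, (j < k)%N} & facet (ladder_par N) k (ladder_par N k)].
Proof.
move=> k4; have [kN|kN] := leqP k N.
  split=> //; first by rewrite chain_par //=; lia.
  - by rewrite chain_par.
  - by move=> j; rewrite chain_par // !inE; lia.
  rewrite chain_par //; have [->|k5] := eqVneq k 4%N.
    by exists 3%N; split=> // u; lia.
  exists k.-1; split; [lia| |lia].
  have := @chain_facet k.-1 (k - 5)%N.
  rewrite !chain_par; last lia.
  rewrite (_ : k.-1 - 4 = k - 5)%N ?mem_head; last lia.
  rewrite /= eqxx /= (_ : k.-1 - 3 = k - 4)%N; last lia.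
  rewrite (_ : k.-1 - 2 = k - 3)%N; last lia.
  rewrite (_ : k.-1 - 1 = k - 2)%N; last lia.
  rewrite (_ : k.-1 = k - 1)%N; last lia.
  by apply=> //; lia.
have k8 : (N < k < N + 8)%N by lia.
have distinct u : (4 < u < k)%N -> ladder_par N u <> ladder_par N k.
  move=> uk; have [uN'|uN'] := leqP u N.
    by rewrite chain_par //; case: (starP k8) => // _ [] *; lia.
  have u8 : (N < u < N + 8)%N by lia.
  by case: (starP u8) => // uE; case: (starP k8) => // kE; try lia; move=> [] *; lia.
split; [by case: (starP k8) => //= _; lia|by case: (starP k8)|
        by case: (starP k8) => // kE j; rewrite !inE; lia|].
have cut v i : (4 < v <= N)%N -> i \in ladder_par N v ->
    ladder_par N k = rcons (rem i (ladder_par N v)) v -> facet (ladder_par N) k (ladder_par N k).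
  move=> v5 iv E; exists v; split; [lia| |by move=> u uv; apply: distinct; lia].
  by rewrite E; apply: chain_facet => //; lia.
have P5 : ladder_par N 5 = [:: 1; 2; 3; 4]%N by rewrite chain_par //; lia.
have PN : ladder_par N N = [:: N - 4; N - 3; N - 2; N - 1]%N by rewrite chain_par.
have lt5 : (4 < 5 <= N)%N by lia.
have ltN : (4 < N <= N)%N by lia.
have ne (i j : nat) : (i < 5)%N -> (j < i)%N -> (N - i == N - j)%N = false by lia.
have mN i : (1 <= i <= 4)%N -> (N - i)%N \in ladder_par N N.
  by rewrite PN !inE; case: i => [|[|[|[|[|i]]]]] //; rewrite eqxx ?orbT.
by case: (starP k8) (cut) => _ C;
  [apply: (C 5%N 4%N)|apply: (C 5%N 3%N)|apply: (C 5%N 2%N)|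
   apply: (C N (N - 1)%N)|apply: (C N (N - 2)%N)|
   apply: (C N (N - 3)%N)|apply: (C N (N - 4)%N)] => //; rewrite ?P5 ?mN //= PN /= ?eqxx ?ne.
Qed.

Lemma ladder_half_par u v : ladder_half N u v -> (v < N + 8)%N ->
  (u < v)%N /\ ((v < 4)%N || (u \in ladder_par N v)).
Proof.
move=> h v8; case/or4P: h.
- move=> /andP[/eqP -> v4]; split; first lia.
  by have [->|v3] := eqVneq v 4%N; [rewrite chain_par //; lia|apply/orP; left; lia].
- move=> /andP[Nv uv]; have v4 : (4 <= v < N + 8)%N by lia.
  by have [_ _ lt _] := ladder_par_ok v4; rewrite uv orbT lt.
- move=> /andP[/eqP -> v4]; split; first lia.
  by rewrite chain_par ?inE; lia.
move=> /andP[/eqP -> v4]; split; first lia.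
by rewrite chain_par ?inE; lia.
Qed.

Lemma ladder_sym : symmetric (@ladder N).
Proof. by move=> u v; rewrite /ladder orbC. Qed.

Lemma ladder_irr : irreflexive (@ladder N).
Proof.
move=> u; rewrite /ladder orbb; apply/negP => h.
by have [] := ladder_half_par h (ltn_ord u); rewrite ltnn.
Qed.

Lemma ladder_adj (u v : 'I_(N + 8)) : ladder u v -> adj (ladder_par N) (N + 8) u v.
Proof.
wlog h : u v / ladder_half N u v => [W|_].
  by case/orP => h; [|rewrite adj_sym]; apply: W => //; rewrite /ladder h ?orbT.
have [uv] := ladder_half_par h (ltn_ord v).
by rewrite /adj neq_ltn uv !ltn_ord (maxn_idPr (ltnW uv)) (minn_idPl (ltnW uv)).
Qed.
End Ladder.

Lemma k_connected_neighbour (T : finType) (e : rel T) : irreflexive e -> k_connected 4 e ->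
  forall w, exists w', e w w'.
Proof.
move=> e_irr [T4 conn] w.
have /card_gt1P[x [y [_ _ xy]]] : (1 < #|T|)%N by apply: leq_trans T4.
have [z zw] : exists z, z != w.
  by have [xw|] := eqVneq x w; [exists y; rewrite -xw eq_sym|exists x].
have := conn finset.set0; rewrite cards0 => /(_ isT w z); rewrite !inE => /(_ isT isT).
move=> /connectP[[|w' p] /=]; first by move=> _ E; rewrite E eqxx in zw.
by move=> /andP[/andP[ww' _] _] _; exists w'.
Qed.

(** * The ladder has no triangles *)

Section LadderTriangles.
Variable N : nat.
Hypothesis N6 : (6 <= N)%N.
Implicit Types (u v s : nat).

Definition ladder_edge u v := ladder_half N u v || ladder_half N v u.

Lemma ladder_edgeC u v : ladder_edge u v = ladder_edge v u.
Proof. exact: orbC. Qed.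

Lemma star_edge s u : (N < s < N + 8)%N -> (u < N + 8)%N ->
  ladder_edge s u = (u \in ladder_par N s).
Proof.
move=> s8 u8; rewrite /ladder_edge.
have -> : ladder_half N s u = false.
  apply/negP => /or4P[| | |]; try lia.
  move=> /andP[Nu]; have {}u8 : (N < u < N + 8)%N by lia.
  by case: (starP N6 u8) => _; rewrite !inE; lia.
apply/idP/idP => [|h]; last first.
  have Ns : (N < s)%N by lia.
  by rewrite /ladder_half h Ns /= orbT.
by case/or4P => [|/andP[]//| |]; try lia; case: (starP N6 s8) => _; rewrite !inE; lia.
Qed.

Lemma zero_edge u : (u < N + 8)%N -> ladder_edge 0 u = (1 <= u <= 4)%N.
Proof.
move=> u8; have [uN|uN] := leqP u N.
  rewrite /ladder_edge /ladder_half !(ltnNge N) uN /=.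
  lia.
rewrite ladder_edgeC star_edge; try lia.
have {}u8 : (N < u < N + 8)%N by lia.
by case: (starP N6 u8) => _; rewrite !inE; lia.
Qed.

Lemma chain_edge u v : (0 < u <= N)%N -> (0 < v <= N)%N ->
  ladder_edge u v = [|| [&& v == u + 4, 2 <= u & v < N], [&& v == u + 1, 5 <= u & v <= N - 4],
    [&& u == v + 4, 2 <= v & u < N] | [&& u == v + 1, 5 <= v & u <= N - 4]]%N.
Proof.
move=> u1 v1; rewrite /ladder_edge /ladder_half !(ltnNge N).
have [_ ->] := andP u1; have [_ ->] := andP v1.
by lia.
Qed.

(** The neighbours of a star lie in 1, ..., 5 or in N - 4, ..., N, and [chain_edge] admits no edge
    within either range. *)
Lemma independent_neighbours s u v : (s < N + 8)%N -> (u < N + 8)%N -> (v < N + 8)%N ->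
  (s == 0) || (N < s)%N -> ladder_edge s u -> ladder_edge s v -> ladder_edge u v = false.
Proof.
move=> s8 u8 v8 /orP[/eqP ->|Ns].
  rewrite !zero_edge // => u4 v4; rewrite chain_edge; lia.
have {}s8 : (N < s < N + 8)%N by lia.
rewrite (star_edge s8 u8) (star_edge s8 v8).
by case: (starP N6 s8) => _; rewrite !inE => uE vE; rewrite chain_edge; lia.
Qed.

Lemma ladder_triangle_free : triangle_free (@ladder N).
Proof.
move=> a b c; rewrite /ladder -!/(ladder_edge _ _) => /and3P[].
move: (ltn_ord a) (ltn_ord b) (ltn_ord c); move: (val a) (val b) (val c) => x y z x8 y8 z8 xy yz zx.
have key s u v := @independent_neighbours s u v.
have [xS|xC] := boolP ((x == 0) || (N < x)%N).
  by have := key x y z x8 y8 z8 xS xy; rewrite ladder_edgeC zx yz => /(_ isT).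
have [yS|yC] := boolP ((y == 0) || (N < y)%N).
  by have := key y z x y8 z8 x8 yS yz; rewrite ladder_edgeC xy zx => /(_ isT).
have [zS|zC] := boolP ((z == 0) || (N < z)%N).
  by have := key z x y z8 x8 y8 zS zx; rewrite ladder_edgeC yz xy => /(_ isT).
by move: xy yz zx; rewrite !chain_edge; lia.
Qed.

End LadderTriangles.

(** * The ladder is 4-connected *)

Section LadderConnectivity.
Variable N : nat.
Hypothesis N6 : (6 <= N)%N.
Implicit Types (a b c d u v w i j k : nat).
(** [good] stands for the vertices that survive a deletion and [K] for those already reached;
    [few_bad] expresses that at most three vertices are deleted. *)
Variables (good K : pred nat).
Local Notation edge := (ladder_edge N).
Hypothesis good_lt : forall v, good v -> (v < N + 8)%N.
Hypothesis few_bad : forall a b c d, uniq [:: a; b; c; d] ->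
  all (fun v => v < N + 8)%N [:: a; b; c; d] -> [|| good a, good b, good c | good d].
Hypothesis K_edge : forall u v, K u -> good v -> edge u v -> K v.

(** Prepared for [K_all], where [m] and [M] are the least and the greatest unreached vertex: it
    supplies neighbours of them outside the interval from [m] to [M]. *)
Lemma far_neighbours m M : (6 <= m <= M)%N -> (M < N)%N ->
  [/\ (m - 4 < m)%N, edge (m - 4) m, (m - 4 < N + 8)%N,
    forall k, (k < 4)%N -> (N + 7 - k < N + 8)%N /\ (N + 7 - k != m - 4)%N &
    (M < N - 4)%N -> [/\ (m - 1 < m)%N, edge (m - 1) m, edge (M + 1) M, edge (M + 4) M &
    uniq [:: m - 4; m - 1; M + 1; M + 4]%N &&
    all (fun v => v < N + 8)%N [:: m - 4; m - 1; M + 1; M + 4]%N]].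
Proof.
move=> m6 MN; split; [lia|by rewrite chain_edge; lia|lia|by move=> k; lia|].
by move=> MN4; split; rewrite ?chain_edge ?[uniq _]/= ?inE ?[all _ _]/=; lia.
Qed.

(* A block is a bipartite graph: faces [f i] against a centre [c] and terminals
   [t j], with [f i] adjacent to all of these except [t i]. *)
Lemma block_faces (c : nat) (t f : nat -> nat) i j :
  (forall k, (k < 4)%N -> edge (f k) c) ->
  (forall k l, (k < 4)%N -> (l < 4)%N -> k != l -> edge (f k) (t l)) ->
  (forall k, (k < 4)%N -> [&& c < N + 8, t k < N + 8, f k < N + 8, t k != c & f k != c]%N) ->
  (forall k l, (k < 4)%N -> (l < 4)%N -> (t k != f l) && ((k != l) ==> (t k != t l))) ->
  (i < 4)%N -> (j < 4)%N -> K (f i) -> good (f j) -> K (f j).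
Proof.
move=> fc ft lt dis i4 j4 Ki gj; have [<- //|ij] := eqVneq i j.
have [k [l [k4 l4 U]]] : exists k l, [/\ (k < 4)%N, (l < 4)%N & uniq [:: i; j; k; l]].
  by move: i i4 j j4 ij {Ki gj} => [|[|[|[|i]]]] // _ [|[|[|[|j]]]] // _ _;
    first [exists 0%N, 1%N; done|exists 0%N, 2%N; done|exists 0%N, 3%N; done|
             exists 1%N, 2%N; done|exists 1%N, 3%N; done|exists 2%N, 3%N; done].
move: U; rewrite /= !inE !negb_or => /and4P[/and3P[_ ik il] /andP[jk jl] kl _].
have step u v w : K u -> edge u w -> edge w v -> good w -> good v -> K v.
  by move=> Ku uw wv gw gv; apply: (K_edge (K_edge Ku gw uw) gv wv).
have back m x : (m < 4)%N -> (x < 4)%N -> m != x -> edge (t x) (f m).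
  by move=> *; rewrite ladder_edgeC; exact: ft.
have [gc|bc] := boolP (good c).
  by apply: (step _ _ c Ki) => //; [exact: fc|rewrite ladder_edgeC; exact: fc].
have [gk|bk] := boolP (good (t k)); first by apply: (step _ _ (t k) Ki); auto.
have [gl|bl] := boolP (good (t l)); first by apply: (step _ _ (t l) Ki); auto.
(* The deleted vertices are now exactly [c], [t k] and [t l], so the detour from [f i] over [t j],
   [f k] and [t i] to [f j] survives. *)
have rest x : (x < N + 8)%N -> uniq [:: c; t k; t l; x] -> good x.
  move=> x8 U; have := few_bad U; rewrite (negbTE bc) (negbTE bk) (negbTE bl) /=.
  by apply; rewrite x8; move: (lt k k4) (lt l l4); lia.
have tc m : (m < 4)%N -> c == t m = false.
  by move=> /lt /and5P[_ _ _ + _]; rewrite eq_sym => /negbTE.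
have tt m m' : (m < 4)%N -> (m' < 4)%N -> m != m' -> t m == t m' = false.
  by move=> m4 m'4 mm'; have /andP[_] := dis m m' m4 m'4; rewrite mm' => /negbTE.
have gt m : (m < 4)%N -> k != m -> l != m -> good (t m).
  move=> m4 km lm; apply: rest; first by case/and5P: (lt m m4).
  by rewrite /= !inE !tc // !tt.
have gf : good (f k).
  apply: rest; first by case/and5P: (lt k k4).
  have /and5P[_ _ _ _ fkc] := lt k k4; rewrite eq_sym in fkc.
  have /andP[/negbTE tk _] := dis k k k4 k4; have /andP[/negbTE tl _] := dis l k l4 k4.
  by rewrite /= !inE !tc // !tt // tk tl (negbTE fkc).
have Kk : K (f k) by apply: (step _ _ (t j) Ki) => //; 
  [by apply: ft; rewrite // eq_sym|by apply: back; rewrite // eq_sym|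
   by apply: gt; rewrite // eq_sym].
by apply: (step _ _ (t i) Kk) => //; 
  [by apply: ft; rewrite // eq_sym|by apply: back; rewrite // eq_sym|
   by apply: gt; rewrite // eq_sym].
Qed.

(** Numbered so that, among the terminals 2, ..., 5, face i misses exactly i + 2; vertex 0, which
    misses 5, is therefore face 3. *)
Definition top_face i := if i == 3 then 0%N else (N + 3 - i)%N.

Lemma top_edge k l : (k < 4)%N -> (l < 4)%N -> k != l -> edge (top_face k) (l + 2).
Proof.
move=> k4 l4 kl; rewrite /top_face; case: eqP => k3; first by rewrite zero_edge //; lia.
have s8 : (N < N + 3 - k < N + 8)%N by lia.
rewrite star_edge //; last lia.
by case: (starP N6 s8) => kE; rewrite !inE; lia.
Qed.

Lemma top_centre k : (k < 4)%N -> edge (top_face k) 1.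
Proof.
move=> k4; rewrite /top_face; case: eqP => k3; first by rewrite zero_edge //; lia.
have s8 : (N < N + 3 - k < N + 8)%N by lia.
rewrite star_edge //; last lia.
by case: (starP N6 s8) => kE; rewrite !inE; lia.
Qed.

Lemma bottom_edge k l : (k < 4)%N -> (l < 4)%N -> k != l -> edge (N + 7 - k) (N - 4 + l).
Proof.
move=> k4 l4 kl; have s8 : (N < N + 7 - k < N + 8)%N by lia.
rewrite star_edge //; last lia.
by case: (starP N6 s8) => kE; rewrite !inE; lia.
Qed.

Lemma bottom_centre k : (k < 4)%N -> edge (N + 7 - k) N.
Proof.
move=> k4; have s8 : (N < N + 7 - k < N + 8)%N by lia.
rewrite star_edge //; last lia.
by case: (starP N6 s8) => kE; rewrite !inE; lia.
Qed.

Lemma top_faces i j : (i < 4)%N -> (j < 4)%N -> K (top_face i) -> good (top_face j) ->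
  K (top_face j).
Proof.
apply: (@block_faces 1 (fun l => l + 2)%N); [exact: top_centre|exact: top_edge| |].
- by move=> k k4; rewrite /top_face; case: ifP; lia.
- by move=> k l k4 l4; rewrite /top_face; case: ifP; lia.
Qed.

Lemma bottom_faces i j : (i < 4)%N -> (j < 4)%N -> K (N + 7 - i)%N -> good (N + 7 - j)%N ->
  K (N + 7 - j)%N.
Proof.
apply: (@block_faces N (fun l => N - 4 + l)%N (fun i => N + 7 - i)%N);
  [exact: bottom_centre|exact: bottom_edge| |].
- by move=> k k4; lia.
- by move=> k l k4 l4; lia.
Qed.

(* Four disjoint paths from the top faces to the bottom faces, each following one
   residue class mod 4 of the chain. *)
Definition ladder_path j v : bool :=
  [|| v == top_face ((j + 3) %% 4), (2 <= v < N) && (v == j + 2 %[mod 4]) |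
      (N + 4 <= v < N + 8) && (v == j + 2 %[mod 4])]%N.

Lemma ladder_path_lt j v : ladder_path j v -> (v < N + 8)%N.
Proof. by rewrite /ladder_path /top_face; case: ifP; lia. Qed.

Lemma ladder_path_disjoint i j v : (i < 4)%N -> (j < 4)%N -> ladder_path i v -> ladder_path j v ->
  i = j.
Proof. by rewrite /ladder_path /top_face; do 2!case: ifP; lia. Qed.

(** Three deleted vertices cannot meet all four disjoint paths. *)
Lemma good_ladder_path : exists2 j, (j < 4)%N & forall v, ladder_path j v -> good v.
Proof.
apply: contrapT => none.
have bad j : (j < 4)%N -> exists2 v, ladder_path j v & ~~ good v.
  move=> j4; apply: contrapT => no; apply: none; exists j => // v pv.
  by apply: contrapT => /negP gv; apply: no; exists v.
have [a pa ba] := bad 0%N isT; have [b pb bb] := bad 1%N isT.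
have [c pc bc] := bad 2%N isT; have [d pd bd] := bad 3%N isT.
have ne u v i j : ladder_path i u -> ladder_path j v -> (i < 4)%N -> (j < 4)%N -> i != j -> u != v.
  move=> pu pv i4 j4; apply: contraNneq => E; rewrite E in pu.
  by rewrite (ladder_path_disjoint i4 j4 pu pv).
have := @few_bad a b c d.
rewrite (negbTE ba) (negbTE bb) (negbTE bc) (negbTE bd) /= !inE !negb_or.
rewrite (ne _ _ _ _ pa pb) // (ne _ _ _ _ pa pc) // (ne _ _ _ _ pa pd) //.
rewrite (ne _ _ _ _ pb pc) // (ne _ _ _ _ pb pd) // (ne _ _ _ _ pc pd) //.
by rewrite !(ladder_path_lt pa, ladder_path_lt pb, ladder_path_lt pc, ladder_path_lt pd) => /(_ isT isT).
Qed.

Section Reached.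
Variable j : nat.
Hypothesis j4 : (j < 4)%N.
Hypothesis path_good : forall v, ladder_path j v -> good v.
Hypothesis K_root : K (top_face ((j + 3) %% 4)).

Lemma K_strand m : (j + 2 + 4 * m < N)%N -> K (j + 2 + 4 * m)%N.
Proof.
elim: m => [|m IH] mN.
  rewrite muln0 addn0; apply: (K_edge K_root); last by apply: top_edge; lia.
  by apply: path_good; rewrite /ladder_path; lia.
apply: (K_edge (IH _)); first lia.
  by apply: path_good; rewrite /ladder_path; lia.
by rewrite chain_edge; lia.
Qed.

Lemma K_top i : (i < 4)%N -> good (top_face i) -> K (top_face i).
Proof. by move=> i4; apply: top_faces K_root => //; lia. Qed.

Lemma K_bottom i : (i < 4)%N -> good (N + 7 - i)%N -> K (N + 7 - i)%N.
Proof.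
move=> i4.
(* The offset is j + 2 - N modulo 4, written without subtraction. It selects the last chain vertex
   of path [j]; the path continues to the bottom face whose index is 3 minus the offset. *)
have lE : (N - 4 + (j + 6 + 3 * N) %% 4 =
  j + 2 + 4 * ((N - 4 + (j + 6 + 3 * N) %% 4 - (j + 2)) %/ 4))%N by lia.
apply: (@bottom_faces (3 - (j + 6 + 3 * N) %% 4)) => //; first lia.
apply: (@K_edge (N - 4 + (j + 6 + 3 * N) %% 4)%N).
- by rewrite lE; apply: K_strand; lia.
- by apply: path_good; rewrite /ladder_path; lia.
- by rewrite ladder_edgeC; apply: bottom_edge; lia.
Qed.

Lemma K_centre c (f : nat -> nat) : (forall i, (i < 4)%N -> edge (f i) c) ->
  (forall i, (i < 4)%N -> good (f i) -> K (f i)) -> uniq [:: f 0; f 1; f 2; f 3]%N ->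
  all (fun v => v < N + 8)%N [:: f 0; f 1; f 2; f 3]%N -> good c -> K c.
Proof.
move=> fc Kf U lt gc; have := few_bad U lt.
by case/or4P => g; [apply: (K_edge (Kf 0%N isT g))|apply: (K_edge (Kf 1%N isT g))|
  apply: (K_edge (Kf 2%N isT g))|apply: (K_edge (Kf 3%N isT g))]; auto.
Qed.

Lemma K_off_chain v : good v -> ~~ (2 <= v < N)%N -> K v.
Proof.
move=> gv v2; have v8 := good_lt gv.
have [v0|v0] := eqVneq v 0%N.
  by have := @K_top 3; rewrite /top_face /= -v0; apply.
have [v1|v1] := eqVneq v 1%N.
  rewrite v1 in gv *; apply: (@K_centre 1 top_face) gv => //.
  - exact: top_centre.
  - exact: K_top.
  - by rewrite /top_face /= !inE; lia.
  - by rewrite /top_face /=; lia.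
have [vN|vN] := eqVneq v N.
  rewrite vN in gv *; apply: (@K_centre N (fun i => N + 7 - i)%N) gv => //.
  - exact: bottom_centre.
  - exact: K_bottom.
  - by rewrite /= !inE; lia.
  - by rewrite /=; lia.
have [v4|v4] := leqP v (N + 3).
  have E : v = top_face (N + 3 - v) by rewrite /top_face; case: ifP; lia.
  by rewrite E; apply: K_top; rewrite -?E //; lia.
have E : v = (N + 7 - (N + 7 - v))%N by lia.
by rewrite E; apply: K_bottom; rewrite -?E //; lia.
Qed.

(* The least and the greatest vertex that is not reached have, outside the
   interval they span, at least four neighbours, all of them bad. *)
Lemma K_all v : good v -> K v.
Proof.
move=> gv; apply: contrapT => /negP Kv.
have ex : exists v, good v && ~~ K v by exists v; rewrite gv.
have bound u : good u && ~~ K u -> (u <= N + 8)%N by move=> /andP[/good_lt]; lia.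
have [m /andP[gm Km] m_min] := ex_minnP ex.
have [M /andP[gM KM] M_max] := ex_maxnP ex bound.
have mM : (m <= M)%N by apply: M_max; rewrite gm.
have m2 : (2 <= m < N)%N by apply: contraNT Km => *; exact: K_off_chain.
have M2 : (2 <= M < N)%N by apply: contraNT KM => *; exact: K_off_chain.
have top_inj : {in [pred k | k < 4]%N &, injective top_face}.
  by move=> k l; rewrite !inE /top_face; do 2!case: ifP; lia.
have bottom_inj : {in [pred k | k < 4]%N &, injective (fun k => N + 7 - k)%N}.
  by move=> k l; rewrite !inE; lia.
have bottom_off k : (k < 4)%N -> ~~ (2 <= N + 7 - k < N)%N by lia.
have low : (m <= 5)%N -> [/\ (m - 2 < 4)%N, (m - 2 + 2)%N = m &
    forall k, (k < 4)%N -> ~~ (2 <= top_face k < N)%N].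
  by move=> m5; split; [lia|lia|move=> k k4; rewrite /top_face; case: ifP; lia].
have top_lt x k : (k < 4)%N -> (2 <= x)%N -> (x < N)%N || (N + 4 <= x)%N ->
    (top_face k < N + 8)%N /\ top_face k != x.
  by move=> k4 x2 xN; rewrite /top_face; case: ifP; lia.
have upper : (M < N - 4)%N -> edge (M + 4) M by move=> MN; rewrite chain_edge; lia.
have lower : (N - 4 <= M)%N -> (M - (N - 4) < 4)%N by lia.
(* The index of a bottom face adjacent to [M] in case [M] is a bottom terminal. *)
have [k0 k0M] : exists k, (k < 4)%N && (k != M - (N - 4))%N.
  by exists ((M - (N - 4) + 1) %% 4)%N; lia.
have face_range : [&& 2 <= N + 7 - k0, N + 4 <= N + 7 - k0 & N + 7 - k0 < N + 8]%N by lia.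
have below u : (u < m)%N -> edge u m -> ~~ good u.
  move=> um e; apply/negP => gu; have := Km; apply/negP/negPn/(K_edge _ gm e).
  apply: contrapT => /negP Ku; by have := m_min u; rewrite gu Ku leqNgt um => /(_ isT).
have above u : (M < u)%N -> edge u M -> ~~ good u.
  move=> um e; apply/negP => gu; have := KM; apply/negP/negPn/(K_edge _ gM e).
  apply: contrapT => /negP Ku; by have := M_max u; rewrite gu Ku leqNgt um => /(_ isT).
have off u w : ~~ (2 <= u < N)%N -> edge u w -> good w -> ~~ K w -> ~~ good u.
  move=> u2 e gw Kw; apply: contraNN Kw => gu; apply: (K_edge _ gw e); exact: K_off_chain.
have four a b c d : ~~ good a -> ~~ good b -> ~~ good c -> ~~ good d ->
    uniq [:: a; b; c; d] -> all (fun v => v < N + 8)%N [:: a; b; c; d] -> False.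
  move=> /negbTE ba /negbTE bb /negbTE bc /negbTE bd U lt.
  by have := few_bad U lt; rewrite ba bb bc bd.
have top k : (m <= 5)%N -> (k < 4)%N -> k != (m - 2)%N -> ~~ good (top_face k).
  move=> m5 k4 km; have [m24 mE off_k] := low m5; apply: (off _ m) => //; first exact: off_k.
  by rewrite -mE; exact: top_edge.
have bottom k : (N - 4 <= M)%N -> (k < 4)%N -> k != (M - (N - 4))%N -> ~~ good (N + 7 - k)%N.
  move=> MN k4 km; apply: (off _ M) => //; first exact: bottom_off.
  by rewrite -(subnKC MN); apply: bottom_edge => //; exact: lower.
have three (f : nat -> nat) l x : (l < 4)%N -> (forall k, (k < 4)%N -> k != l -> ~~ good (f k)) ->
    (forall k, (k < 4)%N -> (f k < N + 8)%N /\ f k != x) ->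
    {in [pred k | k < 4]%N &, injective f} -> ~~ good x -> (x < N + 8)%N -> False.
  move=> l4 bf lt inj bx x8.
  have [a [b [c [a4 b4 c4]]]] : exists a b c,
      [/\ (a < 4)%N, (b < 4)%N, (c < 4)%N & uniq [:: l; a; b; c]].
    move: l l4 {bf} => [|[|[|[|l]]]] // _; [exists 1%N, 2%N, 3%N|exists 0%N, 2%N, 3%N|
      exists 0%N, 1%N, 3%N|exists 0%N, 1%N, 2%N] => //.
  rewrite /= !inE !negb_or => /and4P[/and3P[la lb lc] /andP[ab ac] bc _].
  have ne u w : (u < 4)%N -> (w < 4)%N -> u != w -> f u == f w = false.
    by move=> u4 w4; apply: contraNF => /eqP /inj ->.
  have [fa ax] := lt a a4; have [fb bx'] := lt b b4; have [fc cx] := lt c c4.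
  apply: (four (f a) (f b) (f c) x) => //; try by apply: bf; rewrite // eq_sym.
    by rewrite /= !inE !ne // (negbTE ax) (negbTE bx') (negbTE cx).
  by rewrite /= fa fb fc x8.
(* Here [m] is a top terminal, so three top faces are deleted; the fourth deleted vertex is a bottom
   face or [M + 4]. *)
have [m5|m6] := leqP m 5.
  have [m24 _ _] := low m5.
  have top' k : (k < 4)%N -> k != (m - 2)%N -> ~~ good (top_face k) by exact: top.
  have [MN|MN] := leqP (N - 4) M.
    have /and3P[x2 xN x8] := face_range; have /andP[k4 kM] := k0M.
    apply: (three top_face _ _ m24 top' _ top_inj (bottom _ MN k4 kM) x8) => k k4'.
    by apply: top_lt => //; rewrite xN orbT.
  have MN4 : (M + 4 < N)%N by rewrite addnC -ltn_subRL.
  apply: (three top_face _ _ m24 top' _ top_inj (above (M + 4)%N _ (upper MN))) => [k k4'||].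
  - by apply: top_lt; rewrite // ?MN4 // addn4.
  - by rewrite addn4 !ltnS -addn3 leq_addr.
  - by apply: ltn_addr.
(* Here [m - 4] is deleted, together with three bottom faces or with [m - 1], [M + 1] and
   [M + 4]. *)
have m6M : (6 <= m <= M)%N by rewrite m6.
have MN' : (M < N)%N by case/andP: M2.
have [b4 e4 lt4 bot_lt far'] := far_neighbours m6M MN'.
have b4' := below _ b4 e4.
have [MN|MN] := leqP (N - 4) M.
  exact: (three (fun k => N + 7 - k)%N _ _ (lower MN) (fun k => bottom k MN) bot_lt bottom_inj b4' lt4).
have [lt1 e1 a1 a4 /andP[U lt]] := far' MN.
have M1 : (M < M + 1)%N by rewrite addn1.
have M4 : (M < M + 4)%N by rewrite addn4 !ltnS -addn3 leq_addr.
exact: (four _ _ _ _ b4' (below _ lt1 e1) (above _ M1 a1) (above _ M4 a4) U lt).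
Qed.

End Reached.

End LadderConnectivity.

Lemma ladder_connected (N : nat) : (6 <= N)%N -> k_connected 4 (@ladder N).
Proof.
move=> N6; split=> [|X X4]; first by rewrite card_ord; lia.
pose bad := [seq val x | x <- enum X].
pose good v := (v < N + 8)%N && (v \notin bad).
have bad_val (x : 'I_(N + 8)) : (val x \in bad) = (x \in X).
  by rewrite mem_map ?mem_enum //; exact: val_inj.
have few a b c d : uniq [:: a; b; c; d] -> all (fun v => v < N + 8)%N [:: a; b; c; d] ->
    [|| good a, good b, good c | good d].
  move=> U lt; apply: contraTT X4; rewrite -leqNgt !negb_or => n.
  have : {subset [:: a; b; c; d] <= bad}.
    move: n; rewrite /good; move: lt => /= /and5P[-> -> -> -> _] /=; rewrite !negbK.
    by move=> /and4P[*] v; rewrite !inE => /or4P[] /eqP ->.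
  by move=> /(uniq_leq_size U); rewrite size_map -cardE.
have good_lt v : good v -> (v < N + 8)%N by case/andP.
pose e := [rel u v | [&& ladder u v, u \notin X & v \notin X]]; have e_sym : symmetric e.
  by move=> u v; rewrite /= ladder_sym [(u \notin X) && _]andbC.
have [j j4 pg] := good_ladder_path N6 few.
have gr : good (top_face N ((j + 3) %% 4)) by apply: pg; rewrite /ladder_path eqxx.
pose r : 'I_(N + 8) := Ordinal (good_lt _ gr).
have rX : r \notin X by rewrite -bad_val; case/andP: (gr).
have conn (x : 'I_(N + 8)) : x \notin X -> connect e r x.
  move=> xX; pose K v := [exists y : 'I_(N + 8), [&& val y == v, y \notin X & connect e r y]].
  have : K (val x).
    apply: (@K_all N N6 good K) j4 _ _ _ _ => //.
    - move=> u v /existsP[y /and3P[/eqP yu yX ry]] gv uv.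
      have v8 := good_lt _ gv; apply/existsP; exists (Ordinal v8).
      have vX : Ordinal v8 \notin X by rewrite -bad_val; case/andP: (gv).
      rewrite eqxx vX; apply: connect_trans ry (connect1 _).
      by rewrite /= yX vX !andbT /ladder yu.
    - by apply/existsP; exists r; rewrite eqxx rX connect0.
    - by rewrite /good ltn_ord bad_val.
  by move=> /existsP[y /and3P[/eqP /val_inj -> _]].
move=> x y xX yX; apply: connect_trans (conn y yX).
by rewrite (sym_connect_sym e_sym) conn.
Qed.

Lemma ladder_properties (R : realType) (N : nat) : (6 <= N)%N ->
  [/\ simple_graph (@ladder N), linklessly_embeddable R (@ladder N) & tutte4connected (@ladder N)].
Proof.
move=> N6; have conn := ladder_connected N6; split.
- by split; [exact: ladder_sym|exact: ladder_irr].
- apply: (@stacked_linkless R (ladder_par N)).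
  + by lia.
  + exact: ladder_par_ok.
  + exact: ladder_sym.
  + exact: ladder_irr.
  + by apply: k_connected_neighbour => //; exact: ladder_irr.
  + exact: ladder_adj.
- by split=> //; exact: ladder_triangle_free.
Qed.

Local Delimit Scope Z_scope with BZ.

(** * Data and search for C13(1,3) *)

Section Search13.
Local Open Scope nat_scope.

Definition nbrs13 (v : nat) : seq nat :=
  nth [::] [:: [:: 1; 3; 10; 12]; [:: 0; 2; 4; 11]; [:: 1; 3; 5; 12]; [:: 0; 2; 4; 6];
    [:: 1; 3; 5; 7]; [:: 2; 4; 6; 8]; [:: 3; 5; 7; 9]; [:: 4; 6; 8; 10]; [:: 5; 7; 9; 11];
    [:: 6; 8; 10; 12]; [:: 0; 7; 9; 11]; [:: 1; 8; 10; 12]; [:: 0; 2; 9; 11]] v.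

(* The drawing was found by computer search; so were the planes of [planes13]
   ([a x + b y + c z + d = 0]), which are just enough to separate the edges and
   triangles that the search below has to tell apart. *)
Definition points13 : seq (Z * Z * Z) :=
  [:: (22, 0, 4); (12, 6, 2); (10, 15, -6); (2, 24, 1); (-6, 14, 4); (-11, 10, -5);
      (-23, 5, -1); (-17, -4, 6); (-10, -9, -2); (-8, -21, -3); (2, -20, 6); (7, -9, -1);
      (19, -9, -6)]%BZ.

Definition planes13 : seq (Z * Z * Z * Z) :=
  [:: (-1, -2, -2, -6); (1, 0, -6, 1); (5, -2, 8, 27); (10, 57, -666, -720); (1, -7, -9, 38);
      (1, -1, -4, -3); (9, -12, -29, -83); (8, 17, -56, 42); (1, -1, 4, -3); (4, 0, -5, 18);
      (6, 2, -18, -43); (21, -23, -21, -377); (2, 0, 16, 63); (7, -4, -7, -51);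
      (2, 3, -4, -31); (-13, -5, -95, -367); (2, 1, -2, 26); (2, 2, -3, -31); (2, -2, 0, 43)]%BZ.

Definition eval_plane (f : Z * Z * Z * Z) (q : Z * Z * Z) : Z :=
  let: (a, b, c, d) := f in let: (x, y, z) := q in (a * x + b * y + c * z + d)%BZ.

(** The signs of all planes at all points are computed once, so that the search only looks up
    booleans. *)
Definition signs13 : seq (seq bool) :=
  Eval vm_compute in [seq [seq Z.ltb (eval_plane f q) 0 | q <- points13] | f <- planes13].

(** Because no point lies on a plane, a false entry of [signs13] means strictly positive. *)
Lemma planes_generic : all (fun f => all (fun q => ~~ Z.eqb (eval_plane f q) 0) points13) planes13.
Proof. by vm_compute. Qed.

(* Unlike [has], this does not evaluate the tail under call by value when the
   head already satisfies [P]. *)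
Fixpoint lazy_has (T : Type) (P : T -> bool) (s : seq T) : bool :=
  if s is x :: s' then (if P x then true else lazy_has P s') else false.

Definition all_neg (r : seq bool) (s : seq nat) := all (nth false r) s.
Definition all_pos (r : seq bool) (s : seq nat) := all (fun i => ~~ nth false r i) s.

Definition separated13 (s t : seq nat) : bool :=
  lazy_has (fun r =>
    if all_neg r s then all_pos r t else if all_pos r s then all_neg r t else false) signs13.

(** An edge with exactly one end in the triangle is clear by general position. Two ends in it are
    accepted only for the new side xz, and an edge with none has to be separated from the triangle
    by a plane. *)
Definition clear13 x y z (e : nat * nat) : bool :=
  let iu := e.1 \in [:: x; y; z] in let iv := e.2 \in [:: x; y; z] in
  if (e.1 == x) && (e.2 == z) then true else
  if iu then ~~ iv else if iv then true else separated13 [:: x; y; z] [:: e.1; e.2].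

(* The corner to be cut is the one at the second vertex of [s1]; the other corners
   are reached by rotating the list. *)
Definition cuttable13 (s1 s2 : seq nat) : bool :=
  if s1 is x :: y :: z :: w :: l then
    all (clear13 x y z) (edges [:: x, z, w & l] ++ edges s2)
  else false.

Definition cut13 (s : seq nat) : seq nat := if s is x :: y :: l then x :: l else s.

Definition unlinked3 (s1 s2 : seq nat) :=
  if (size s1 == 3) && (size s2 == 3) then separated13 s1 s2 else false.

Fixpoint reduces13 n s1 s2 : bool :=
  if unlinked3 s1 s2 then true else
  if n is n'.+1 then
    if lazy_has (fun i => let s := rot i s2 in
              if cuttable13 s s1 then reduces13 n' s1 (cut13 s) else false) (iota 0 (size s2))
    then true
    else lazy_has (fun i => let s := rot i s1 in
              if cuttable13 s s2 then reduces13 n' (cut13 s) s2 else false) (iota 0 (size s1))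
  else false.

(** Comparing the two neighbours of the first vertex selects one of the two orientations of a
    cycle. *)
Definition canonical13 (s : seq nat) : bool :=
  if s is x :: y :: z :: l then (y <= last z l) && (x \in nbrs13 (last z l)) else false.

(** [A] holds the vertices still available for extending the path [s]. *)
Fixpoint all_cycles13 (P : seq nat -> bool) n (A s : seq nat) : bool :=
  if (if canonical13 s then P s else true) then
    if n is n'.+1 then
      all (fun w => if w \in A then all_cycles13 P n' (rem w A) (rcons s w) else true)
        (nbrs13 (last 0 s))
    else true
  else false.

Definition after V x (s : seq nat) := [seq w <- V | (x < w) && (w \notin s)].

(* The cycles of the first kind start at their least vertex and have at most
   [m + 1] vertices; they are paired with the disjoint cycles that are not shorter. *)
Definition all_pairs (Q : seq nat -> seq nat -> bool) V m n : bool :=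
  all (fun x => all_cycles13 (fun s =>
    all (fun y => if y \in s then true else
      all_cycles13 (fun t => if size t < size s then true else Q s t)
        n (after V y s) [:: y]) V)
    m (after V x [::]) [:: x]) V.

(** Disjoint cycles have at most 13 vertices together, so the shorter one has at most five after its
    first. At most seven cuts lead to two triangles, well within the fuel of 20. *)
Lemma all_pairs13 : all_pairs (reduces13 20) (iota 0 13) 5 12.
Proof. by vm_compute. Qed.

Definition volume13 (p q r s : Z * Z * Z) : Z :=
  let: (px, py, pz) := p in let: (qx, qy, qz) := q in
  let: (rx, ry, rz) := r in let: (sx, sy, sz) := s in
  let: (ax, ay, az) := (qx - px, qy - py, qz - pz)%BZ in
  let: (bx, by', bz) := (rx - px, ry - py, rz - pz)%BZ in
  let: (cx, cy, cz) := (sx - px, sy - py, sz - pz)%BZ in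
  ((ay * bz - az * by') * cx + (az * bx - ax * bz) * cy + (ax * by' - ay * bx) * cz)%BZ.

Definition point13 i := nth (0, 0, 0)%BZ points13 i.

(** General position: no four of the points are coplanar. *)
Lemma volumes_nonzero : all (fun l => all (fun k => all (fun j => all (fun i =>
  ~~ Z.eqb (volume13 (point13 i) (point13 j) (point13 k) (point13 l)) 0)
    (iota 0 j)) (iota 0 k)) (iota 0 l)) (iota 0 13).
Proof. by vm_compute. Qed.

Lemma lazy_hasE (T : Type) (P : T -> bool) s : lazy_has P s = has P s.
Proof. by elim: s => //= x s ->; case: (P x). Qed.

End Search13.

(** * General position of the thirteen points *)

Section T13.
Variable R : realType.
Notation point := 'rV[R]_3.
Implicit Types (i j k u v x y z : nat) (s t : seq nat).

Definition zr (a : Z) : R := (int_of_Z a)%:~R.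

Lemma zrD a b : zr (a + b)%BZ = zr a + zr b.
Proof. by rewrite /zr -intrD; congr (_%:~R); lia. Qed.
Lemma zrM a b : zr (a * b)%BZ = zr a * zr b.
Proof. by rewrite /zr -intrM; congr (_%:~R); lia. Qed.
Lemma zrB a b : zr (a - b)%BZ = zr a - zr b.
Proof. by rewrite /zr -intrB; congr (_%:~R); lia. Qed.

Lemma zr_lt0 a : (zr a < 0) = Z.ltb a 0.
Proof. by rewrite /zr ltrz0; lia. Qed.

Lemma zr_eq0 a : (zr a == 0) = Z.eqb a 0.
Proof. by rewrite /zr intr_eq0; lia. Qed.

Definition real_point (q : Z * Z * Z) : point :=
  let: (x, y, z) := q in mkpt (zr x) (zr y) (zr z).

Definition pos i : point := real_point (point13 i).

Lemma vol_real (p q r s : Z * Z * Z) :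
  vol (real_point p) (real_point q) (real_point r) (real_point s) = zr (volume13 p q r s).
Proof.
case: p q r s => [[? ?] ?] [[? ?] ?] [[? ?] ?] [[? ?] ?].
by rewrite /vol /dot /cross /= !cE !(zrD, zrM, zrB); ring.
Qed.

Lemma vol_sorted i j k l : (i < j < k)%N -> (k < l < 13)%N ->
  vol (pos i) (pos j) (pos k) (pos l) != 0.
Proof.
move=> /andP[ij jk] /andP[kl l13]; rewrite vol_real zr_eq0.
have := volumes_nonzero; move=> /allP/(_ l); rewrite mem_iota => /(_ l13).
move=> /allP/(_ k); rewrite mem_iota => /(_ kl).
move=> /allP/(_ j); rewrite mem_iota => /(_ jk).
by move=> /allP/(_ i); rewrite mem_iota => /(_ ij).
Qed.

(** Transposing adjacent arguments changes the volume only by a sign, so an insertion sort reduces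
    the claim to [vol_sorted]. *)
Lemma vol_pos i j k l : uniq [:: i; j; k; l] -> all (fun v => v < 13)%N [:: i; j; k; l] ->
  vol (pos i) (pos j) (pos k) (pos l) != 0.
Proof.
pose nz i j k l := vol (pos i) (pos j) (pos k) (pos l) != 0; rewrite -/(nz i j k l).
have s12 i' j' k' l' : nz j' i' k' l' = nz i' j' k' l' by rewrite /nz vol_swap oppr_eq0.
have s34 i' j' k' l' : nz i' j' l' k' = nz i' j' k' l' by rewrite /nz vol_last oppr_eq0.
have s23 i' j' k' l' : nz i' k' j' l' = nz i' j' k' l'.
  by rewrite /nz (vol_rot (pos j')) vol_swap oppr_eq0.
have sorted3 i' j' k' l' : (i' < j' < k')%N -> (k' < 13)%N -> (l' < 13)%N ->
    l' != i' -> l' != j' -> l' != k' -> nz i' j' k' l'.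
  move=> ijk k13 l13 li lj lk; have [kl|lk'|E] := ltngtP k' l'; last by rewrite E eqxx in lk.
    by apply: vol_sorted => //; rewrite kl.
  rewrite -s34; have [jl|lj'|E] := ltngtP j' l'; last by rewrite E eqxx in lj.
    by apply: vol_sorted => //; lia.
  rewrite -s23; have [il|li'|E] := ltngtP i' l'; last by rewrite E eqxx in li.
    by apply: vol_sorted => //; lia.
  by rewrite -s12; apply: vol_sorted => //; lia.
have sorted2 i' j' k' l' : (i' < j' < 13)%N -> (k' < 13)%N -> (l' < 13)%N ->
    k' != i' -> k' != j' -> l' != i' -> l' != j' -> l' != k' -> nz i' j' k' l'.
  move=> ij k13 l13 ki kj li lj lk; have [jk|kj'|E] := ltngtP j' k'; last by rewrite E eqxx in kj.
    by apply: sorted3 => //; lia.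
  rewrite -s23; have [ik|ki'|E] := ltngtP i' k'; last by rewrite E eqxx in ki.
    by apply: sorted3 => //; lia.
  by rewrite -s12; apply: sorted3 => //; lia.
rewrite /= !inE !negb_or => /and4P[/and3P[ij ik il] /andP[jk jl] kl _] /and5P[i13 j13 k13 l13 _].
have [ij'|ji'|E] := ltngtP i j; last by rewrite E eqxx in ij.
  by apply: sorted2; rewrite // 1?eq_sym //; lia.
by rewrite -s12; apply: sorted2; rewrite // 1?eq_sym //; lia.
Qed.
End T13.

(** * Soundness of the reductions *)

Section Reduction13.
Variable R : realType.
Notation point := 'rV[R]_3.
Implicit Types (i j k u v x y z : nat) (s t : seq nat).
Local Notation pos := (pos R).
Local Notation small := (all (fun v => v < 13)%N).

Lemma separated13_aff s t : separated13 s t -> small s -> small t -> exists f : point * R,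
  (forall i, i \in s -> aff f (pos i) < 0) /\ (forall i, i \in t -> 0 < aff f (pos i)).
Proof.
rewrite /separated13 lazy_hasE => /hasP[r].
have -> : signs13 = [seq [seq Z.ltb (eval_plane f q) 0 | q <- points13] | f <- planes13].
  by vm_compute.
move=> /mapP[[[[a b] c] d] fp ->] sep ss st.
have [/allP gen _] := (allP planes_generic _ fp, I).
pose f : point * R := (mkpt (zr R a) (zr R b) (zr R c), zr R d).
have fE i : (i < 13)%N -> aff f (pos i) = zr R (eval_plane (a, b, c, d) (point13 i)).
  rewrite /pos; case: (point13 i) => [[x y] z] _.
  by rewrite /aff /dot /= !cE !(zrD, zrM).
have sgn i : (i < 13)%N -> aff f (pos i) != 0 /\
    nth false [seq Z.ltb (eval_plane (a, b, c, d) q) 0 | q <- points13] i = (aff f (pos i) < 0).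
  move=> i13; rewrite fE // zr_eq0 zr_lt0 (nth_map (0, 0, 0)%BZ) //; split=> //.
  by apply: gen; exact: mem_nth.
have neg l : small l -> all_neg [seq Z.ltb (eval_plane (a, b, c, d) q) 0 | q <- points13] l ->
    forall i, i \in l -> aff f (pos i) < 0.
  by move=> /allP sl /allP nl i il; have [_ <-] := sgn i (sl i il); exact: nl.
have pos l : small l -> all_pos [seq Z.ltb (eval_plane (a, b, c, d) q) 0 | q <- points13] l ->
    forall i, i \in l -> 0 < aff f (pos i).
  move=> /allP sl /allP nl i il; have [f0 E] := sgn i (sl i il).
  by have := nl i il; rewrite E -leNgt lt_def f0.
move: sep; case: ifP => [ns pt|_].
  by exists f; split; [exact: neg|exact: pos].
case: ifP => // ps nt; exists (opp_aff f); split=> i iI; rewrite aff_opp.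
  by rewrite oppr_lt0; exact: pos iI.
by rewrite oppr_gt0; exact: neg iI.
Qed.

Lemma pos_nondeg x y z : uniq [:: x; y; z] -> small [:: x; y; z] -> nondeg (pos x) (pos y) (pos z).
Proof.
move=> U S; have [w w13 wn] : exists2 w, (w < 13)%N & w \notin [:: x; y; z].
  have /allPn[w] : ~~ all (mem [:: x; y; z]) (iota 0 4).
    by apply/negP => /allP/(uniq_leq_size (iota_uniq 0 4)).
  by rewrite mem_iota => w4 wn; exists w => //; exact: leq_trans w4 _.
apply: (@vol_nondeg _ _ _ _ (pos w)); apply: vol_pos.
  by rewrite -[[:: x; y; z; w]]/(rcons [:: x; y; z] w) rcons_uniq wn.
by rewrite -[[:: x; y; z; w]]/(rcons [:: x; y; z] w) all_rcons w13.
Qed.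

(** By general position [v] is off the plane of the triangle, so the segment meets that plane only
    in [u]. *)
Lemma incident_clear x y z u v : uniq [:: x; y; z] -> small [:: x; y; z] -> (v < 13)%N ->
  u \in [:: x; y; z] -> v \notin [:: x; y; z] -> edge_clear pos x y z u v.
Proof.
move=> U S v13 ut vt q; have quad a b c : perm_eq [:: x; y; z] [:: a; b; c] ->
    vol (pos a) (pos b) (pos c) (pos v) != 0.
  move=> p; apply: vol_pos; rewrite -[[:: a; b; c; v]]/(rcons [:: a; b; c] v).
    by rewrite rcons_uniq -(perm_mem p) vt -(perm_uniq p).
  by rewrite all_rcons v13 -(perm_all _ p).
have base a b c : perm_eq [:: x; y; z] [:: a; b; c] -> seg (pos a) (pos v) q ->
    tri (pos a) (pos b) (pos c) q -> q = pos a.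
  by move=> /quad; exact: seg_tri_vol.
have rot1 : perm_eq [:: x; y; z] [:: y; z; x] 
  by have := perm_refl [:: y; z; x]; rewrite -{1}[[:: y; z; x]]/(rot 1 [:: x; y; z]) perm_rot.
have rot2 : perm_eq [:: x; y; z] [:: z; x; y] 
  by have := perm_refl [:: z; x; y]; rewrite -{1}[[:: z; x; y]]/(rot 2 [:: x; y; z]) perm_rot.
move=> us tq; exists u; first exact: mem_head.
split=> //; move: ut us; rewrite !inE => /or3P[] /eqP -> us.
- exact: (base x y z).
- by apply: (base y z x rot1 us); rewrite -tri_rot.
- by apply: (base z x y rot2 us); rewrite tri_rot.
Qed.

Lemma clear13_edge x y z u v : uniq [:: x; y; z] -> small [:: x; y; z] -> 
  (u < 13)%N -> (v < 13)%N -> clear13 x y z (u, v) -> (u, v) != (x, z) -> edge_clear pos x y z u v.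
Proof.
move=> U S u13 v13; rewrite /clear13 xpair_eqE /= => + /negbTE n; rewrite n.
case: ifP => [ui vi|/negbT nu]; first exact: incident_clear.
case: ifP => [vi _|/negbT nv].
  move=> q; rewrite segC => sq tq.
  have [w wuv [wt qE]] := incident_clear U S u13 vi nu sq tq.
  by exists w => //; move: wuv; rewrite !inE orbC.
move=> sep; have [|f [neg ps]] := separated13_aff sep S; first by rewrite /= u13 v13.
move=> q sq tq; exfalso.
have fq : aff f q < 0 by apply: (tri_neg _ _ _ tq); apply: neg; rewrite !inE eqxx ?orbT.
have : 0 <= aff f q by apply: (seg_nonneg _ _ sq); apply: ltW; apply: ps; rewrite !inE eqxx ?orbT.
by rewrite leNgt fq.
Qed.

Lemma cuttable_move s t : uniq s -> small s -> small t -> (forall v, v \in t -> v \notin s) ->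
  cuttable13 s t ->
  isotopic (polygon pos s) (polygon pos t) (polygon pos (cut13 s)) (polygon pos t).
Proof.
case: s => [|x [|y [|z [|w l]]]] // U S St dis /allP cl.
have U3 : uniq [:: x; y; z] by move: (U); rewrite (cat_uniq [:: x; y; z] (w :: l)) => /andP[].
have S3 : small [:: x; y; z] by move: (S); rewrite (all_cat _ [:: x; y; z] (w :: l)) => /andP[].
apply: corner_move => //; first exact: pos_nondeg.
  move=> v vt; apply: contra (dis v vt) => v3.
  by rewrite -[[:: x, y, z, w & l]]/([:: x; y; z] ++ w :: l) mem_cat v3.
move=> u v uv; have [u13 v13] : (u < 13)%N /\ (v < 13)%N.
  have S' : small [:: x, z, w & l] by move: S; rewrite /= => /and5P[-> _ -> -> ->].
  by move: uv; rewrite mem_cat => /orP[]/edges_mem[us vs]; split;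
    by [exact: (allP S')|exact: (allP St)].
by apply: clear13_edge => //; exact: cl.
Qed.

Lemma cut13_sub s : subseq (cut13 s) s.
Proof.
case: s => [|x [|y l]]; try exact: subseq_refl.
exact: (@cat_subseq _ [:: x] _ [:: x] _ (subseq_refl _) (subseq_cons l y)).
Qed.

(** [trivial_link] assigns the first set to the first circle. Both orders are carried along because
    the search cuts either cycle and lists only pairs whose first cycle is not the longer one. *)
Definition unlinked (K L : set point) : Prop := trivial_link K L /\ trivial_link L K.

Lemma isotopic_unlinked K L K' L' : isotopic K L K' L' -> unlinked K' L' -> unlinked K L.
Proof.
by move=> i [u1 u2]; split; [exact: isotopic_trivial u1|exact: isotopic_trivial (isotopic_swap i) u2].
Qed.

Lemma unlinkedC K L : unlinked K L -> unlinked L K.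
Proof. by case. Qed.

Lemma unlinked3_trivial s t : unlinked3 s t -> uniq s -> uniq t -> small s -> small t ->
  unlinked (polygon pos s) (polygon pos t).
Proof.
rewrite /unlinked3; case: ifP => // /andP[].
case: s => [|a [|b [|c [|? ?]]]] // _; case: t => [|a' [|b' [|c' [|? ?]]]] // _.
move=> sep U U' S S'; have [f [neg ps]] := separated13_aff sep S S'.
have f0 : f.1 <> 0.
  move=> f0; have fa := neg a (mem_head _ _); have fa' := ps a' (mem_head _ _).
  have E q : aff f q = f.2 by rewrite /aff f0 /dot !cE0; ring.
  by move: fa fa'; rewrite !E => fa /(lt_trans fa); rewrite ltxx.
have nf : tneg f (pos a) (pos b) (pos c) by split; apply: neg; rewrite !inE eqxx ?orbT.
have pf : tneg (opp_aff f) (pos a') (pos b') (pos c').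
  by split; rewrite aff_opp oppr_lt0; apply: ps; rewrite !inE eqxx ?orbT.
rewrite !polygon3; split; first by apply: (separated_triangles f0); try exact: pos_nondeg.
apply: (@separated_triangles _ (opp_aff f)); rewrite ?opp_affK //; try exact: pos_nondeg.
by rewrite /=; apply/eqP; rewrite oppr_eq0; apply/eqP.
Qed.

Lemma reduces13_trivial n s t : reduces13 n s t -> uniq s -> uniq t -> small s -> small t ->
  (forall v, v \in s -> v \notin t) -> unlinked (polygon pos s) (polygon pos t).
Proof.
elim: n s t => [|n IH] s t /=.
  have [un|//] := boolP (unlinked3 s t).
  by move=> _ *; exact: unlinked3_trivial.
have [un|_] := boolP (unlinked3 s t).
  by move=> _ *; exact: unlinked3_trivial.
move=> + Us Ut Ss St dis.
have dis' v : v \in t -> v \notin s by apply: contraL => /dis.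
have cut_ok i l : uniq l -> small l -> [/\ uniq (rot i l), small (rot i l),
    uniq (cut13 (rot i l)), small (cut13 (rot i l)) & {subset cut13 (rot i l) <= l}].
  move=> Ul Sl; have sub := cut13_sub (rot i l).
  have Ur : uniq (rot i l) by rewrite rot_uniq.
  have Sr : small (rot i l) by apply/allP => v; rewrite mem_rot; exact: (allP Sl).
  split=> //; first exact: subseq_uniq sub Ur.
    by apply/allP => v /(mem_subseq sub); exact: (allP Sr).
  by move=> v /(mem_subseq sub); rewrite mem_rot.
rewrite !lazy_hasE; case: hasP => [[i _] /= + _|_ /hasP[i _] /=]; case: ifP => // cu red.
  have [Ur Sr Uc Sc sub] := cut_ok i t Ut St.
  rewrite -(polygon_rot _ i Ut).
  apply: isotopic_unlinked (isotopic_swap (cuttable_move Ur Sr Ss _ cu)) _.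
    by move=> v /dis; rewrite mem_rot.
  by apply: IH => // v /dis; apply: contra => /sub.
have [Ur Sr Uc Sc sub] := cut_ok i s Us Ss.
rewrite -(polygon_rot _ i Us); apply: isotopic_unlinked (cuttable_move Ur Sr St _ cu) _.
  by move=> v /dis'; rewrite mem_rot.
by apply: IH => // v /sub /dis.
Qed.

End Reduction13.

(** * Every cycle of C13(1,3) is covered by the search *)

Definition adj13 : rel nat := fun u v => v \in nbrs13 u.

Lemma adj13_lt u v : adj13 u v -> (u < 13)%N && (v < 13)%N.
Proof.
have chk : all (fun u => all (fun v => v < 13)%N (nbrs13 u)) (iota 0 13) by [].
rewrite /adj13; have [u13 uv|u13] := ltnP u 13; last by rewrite /nbrs13 nth_default.
have := allP chk u; rewrite mem_iota => /(_ u13)/allP.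
exact.
Qed.

Lemma adj13_check (P : nat -> nat -> bool) :
  all (fun u => all (P u) (iota 0 13)) (iota 0 13) ->
  forall u v, (u < 13)%N -> (v < 13)%N -> P u v.
Proof.
move=> /allP C u v u13 v13; have := C u; rewrite mem_iota => /(_ u13)/allP/(_ v).
by rewrite mem_iota; apply.
Qed.

Lemma adj13_sym : symmetric adj13.
Proof.
have chk : forall u v, (u < 13)%N -> (v < 13)%N -> adj13 u v == adj13 v u.
  by apply: adj13_check; vm_compute.
move=> u v; apply/idP/idP => uv; have /andP[u13 v13] := adj13_lt uv.
  by rewrite -(eqP (chk u v _ _)).
by rewrite (eqP (chk u v _ _)).
Qed.

(** Here [t] is the rest of the cycle, beyond the path [s] built so far; the search follows it
    vertex by vertex. *)
Lemma all_cycles13P P n A s t : all_cycles13 P n A s -> path adj13 (last 0%N s) t -> uniq t ->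
  {subset t <= A} -> (size t <= n)%N -> canonical13 (s ++ t) -> P (s ++ t).
Proof.
elim: t n A s => [|w t IH] [|n] A s //=; rewrite ?cats0.
- by case: (canonical13 s) => //; case: (P s).
- by case: (canonical13 s) => //; case: (P s).
case: (if canonical13 s then P s else true) => // /allP C /andP[sw wt] /andP[wn Ut] sub tn can.
rewrite -cat_rcons; apply: (IH n (rem w A)) => //.
- by have := C w sw; rewrite sub // mem_head.
- by rewrite last_rcons.
- move=> v vt; apply: rem_mem; last by rewrite sub // inE vt orbT.
  by apply: contraNneq wn => <-.
- by rewrite cat_rcons.
Qed.

Lemma canonical13E x t : (1 < size t)%N ->
  canonical13 (x :: t) = (head 0 t <= last 0 t)%N && adj13 (last 0%N t) x.
Proof. by case: t => [|y [|z l]]. Qed.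

Lemma last_nonempty (T : Type) (x0 x1 : T) s : (0 < size s)%N -> last x0 s = last x1 s.
Proof. by case: s. Qed.

(** A rotation brings the least vertex to the front, and a reversal corrects the orientation where
    necessary; neither changes the polygon as a point set. *)
Lemma cycle13_canonical (R : realType) (s : seq nat) : uniq s -> cycle adj13 s -> (2 < size s)%N ->
  exists x t, [/\ canonical13 (x :: t), path adj13 x t, perm_eq (x :: t) s,
    {in t, forall w, (x < w)%N} & polygon (pos R) (x :: t) = polygon (pos R) s].
Proof.
move=> U cyc sz; have ex : exists x, x \in s.
  by case: s {U cyc} sz => // x s _; exists x; exact: mem_head.
have [x xs x_min] := ex_minnP ex; have [i t rE] := rot_to xs.
have p1 : perm_eq (x :: t) s by rewrite -rE perm_rot.
have U1 : uniq (x :: t) by rewrite (perm_uniq p1).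
have c1 : cycle adj13 (x :: t) by rewrite -rE rot_cycle.
have z1 : (1 < size t)%N by rewrite -ltnS -/(size (x :: t)) (perm_size p1).
have xt : {in t, forall w, (x < w)%N}.
  move=> w wt; rewrite ltn_neqAle x_min ?andbT; last by rewrite -(perm_mem p1) inE wt orbT.
  by apply: contraTneq U1 => ->; rewrite /= wt.
have e1 : polygon (pos R) (x :: t) = polygon (pos R) s by rewrite -rE polygon_rot.
have [yz|zy] := leqP (head 0 t) (last 0 t)%N.
  exists x, t; move: c1; rewrite /= rcons_path => /andP[pt lx].
  have can : canonical13 (x :: t) by rewrite canonical13E // yz (@last_nonempty _ _ x) // ltnW.
  by split; [exact: can| | | |].
exists x, (rev t); have c2 : cycle adj13 (x :: rev t).
  rewrite -(rot_cycle 1) rot1_cons -rev_cons rev_cycle.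
  by rewrite (eq_cycle (e' := adj13)) // => u v; exact: adj13_sym.
move: c2; rewrite /= rcons_path => /andP[pt lx].
have can : canonical13 (x :: rev t).
  rewrite canonical13E ?size_rev // (@last_nonempty _ 0%N x) ?size_rev ?(ltnW z1) // lx andbT.
  move: zy z1; case: (t) => // y l /= zy l0; rewrite rev_cons last_rcons.
  by case/lastP: l zy l0 => // l w; rewrite last_rcons rev_rcons /= => /ltnW.
split; [exact: can|exact: pt| | |].
- by apply: perm_trans p1; rewrite perm_cons perm_rev.
- by move=> w; rewrite mem_rev; exact: xt.
- by rewrite polygon_rev.
Qed.

Lemma all_pairsP Q V m n x s y t : all_pairs Q V m n -> canonical13 (x :: s) ->
  canonical13 (y :: t) -> path adj13 x s -> path adj13 y t -> uniq s -> uniq t ->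
  {in s, forall w, (x < w)%N} -> {in t, forall w, (y < w)%N} ->
  {subset x :: s <= V} -> {subset y :: t <= V} -> (forall v, v \in y :: t -> v \notin x :: s) ->
  (size s <= size t)%N -> (size s <= m)%N -> (size t <= n)%N -> Q (x :: s) (y :: t).
Proof.
move=> C cs ct ps pt Us Ut xs yt sV tV dis st sm tn.
have := allP C x (sV x (mem_head _ _)); move=> /all_cycles13P/(_ ps Us).
have sub : {subset s <= after V x [::]}.
  by move=> v vs; rewrite mem_filter xs //= sV // inE vs orbT.
move=> /(_ sub sm cs)/allP/(_ y (tV y (mem_head _ _))).
rewrite (negbTE (dis y (mem_head _ _))) => /all_cycles13P/(_ pt Ut).
have {}sub : {subset t <= after V y (x :: s)}.
  move=> v vt; have vt' : v \in y :: t by rewrite inE vt orbT.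
  by rewrite mem_filter yt // dis // tV.
by move=> /(_ sub tn ct); rewrite ltnNge /= ltnS st.
Qed.

Lemma cycles13_unlinked (R : realType) (s t : seq nat) : uniq s -> uniq t ->
  cycle adj13 s -> cycle adj13 t -> (2 < size s)%N -> (2 < size t)%N ->
  (forall v, v \in s -> v \notin t) -> unlinked (polygon (pos R) s) (polygon (pos R) t).
Proof.
wlog st : s t / (size s <= size t)%N => [W|] Us Ut cs ct zs zt dis.
  have [st|/ltnW ts] := leqP (size s) (size t); first exact: W.
  by apply/unlinkedC/W => // v; apply: contraL => /dis.
have [x [s' [cs' ps es xs <-]]] := cycle13_canonical R Us cs zs.
have [y [t' [ct' pt et yt <-]]] := cycle13_canonical R Ut ct zt.
have small l : cycle adj13 l -> all (fun v => v < 13)%N l.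
  move=> cl; apply/allP => v vl; have := next_cycle cl vl.
  by move=> /adj13_lt/andP[].
have Ss : all (fun v => v < 13)%N (x :: s') by rewrite (perm_all _ es) small.
have St : all (fun v => v < 13)%N (y :: t') by rewrite (perm_all _ et) small.
have Us' : uniq (x :: s') by rewrite (perm_uniq es).
have Ut' : uniq (y :: t') by rewrite (perm_uniq et).
have dis' v : v \in x :: s' -> v \notin y :: t' by rewrite (perm_mem es) (perm_mem et); exact: dis.
have mem13 v : (v \in iota 0 13) = (v < 13)%N by rewrite mem_iota.
have sz : (size (x :: s') <= size (y :: t'))%N by rewrite (perm_size es) (perm_size et).
have sum13 : (size ((x :: s') ++ (y :: t')) <= 13)%N.
  have U : uniq ((x :: s') ++ (y :: t')).
    rewrite cat_uniq Us' Ut' andbT; apply/hasPn => v; apply: contraL; exact: dis'.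
  rewrite -[13%N]/(size (iota 0 13)); apply: (uniq_leq_size U) => v.
  by rewrite mem13 mem_cat => /orP[]; [move/(allP Ss)|move/(allP St)].
have s5 : (size s' <= 5)%N.
  rewrite -ltnS -/(size (x :: s')) -ltnS -(ltn_pmul2r (isT : 0 < 2)%N) muln2 -addnn ltnS.
  by apply: leq_trans sum13; rewrite size_cat leq_add2l.
have t12 : (size t' <= 12)%N.
  by move: sum13; rewrite size_cat => /(leq_trans (leq_addl _ _)).
apply: (@reduces13_trivial _ 20) => //; apply: (all_pairsP all_pairs13) => //.
- by case/andP: Us'.
- by case/andP: Ut'.
- by move=> v /(allP Ss); rewrite mem13.
- by move=> v /(allP St); rewrite mem13.
- by move=> v; apply: contraL => /dis'.
Qed.

(** * The straight-line drawing of C13(1,3) *)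

Section Circulant.
Variable R : realType.

Definition circulant13 : rel 'I_13 := fun u v => adj13 u v.

Lemma circulant13_sym : symmetric circulant13.
Proof. by move=> u v; exact: adj13_sym. Qed.

Lemma circulant13_irr : irreflexive circulant13.
Proof.
have chk u v : (u < 13)%N -> (v < 13)%N -> (u == v) ==> ~~ adj13 u v.
  by move: u v; apply: adj13_check; vm_compute.
by move=> u; apply/negbTE; have := chk u u (ltn_ord u) (ltn_ord u); rewrite eqxx.
Qed.

Lemma circulant13_triangle_free : triangle_free circulant13.
Proof.
have chk u v : (u < 13)%N -> (v < 13)%N ->
    adj13 u v ==> all (fun w => ~~ (adj13 v w && adj13 w u)) (iota 0 13).
  by move: u v; apply: adj13_check; vm_compute.
move=> a b c; rewrite /circulant13 => /and3P[ab bc ca].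
have := chk a b (ltn_ord a) (ltn_ord b).
by rewrite ab => /allP/(_ (c : nat)); rewrite mem_iota ltn_ord bc ca => /(_ isT).
Qed.

Lemma pos_nondeg13 (i j k : 'I_13) : uniq [:: i; j; k] -> nondeg (pos R i) (pos R j) (pos R k).
Proof.
move=> U; apply: pos_nondeg; first by rewrite -(map_inj_uniq val_inj) in U.
by rewrite /= !ltn_ord.
Qed.

Lemma fresh13 (i j : 'I_13) : exists k, (k != i) && (k != j).
Proof.
have : (0 < #|~: [set i; j]%SET|)%N by rewrite cardsCs finset.setCK card_ord cards2; case: (i != j).
by move/card_gt0P => [k]; rewrite !inE negb_or; exists k.
Qed.

Lemma pos_inj (i j : 'I_13) : pos R i = pos R j -> i = j.
Proof.
move=> E; apply/eqP; apply: contraT => ij; have [k /andP[ki kj]] := fresh13 i j.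
have U : uniq [:: i; j; k] by rewrite /= !inE negb_or ij eq_sym ki eq_sym kj.
have [||/eqP] := pos_nondeg13 U (l := 1) (m := -1) (n := 0); first by ring.
  by rewrite E !scale1r scaleN1r subrr scale0r addr0.
by rewrite oner_eq0.
Qed.

Lemma circulant13_adjacent_edges (u v w : 'I_13) (t t' : R) : uniq [:: u; v; w] -> 0 < t ->
  (1 - t) *: pos R u + t *: pos R v <> (1 - t') *: pos R u + t' *: pos R w.
Proof.
move=> U t0 E; have [||_ tz _] := pos_nondeg13 U (l := t' - t) (m := t) (n := - t').
- by ring.
- have -> : (t' - t) *: pos R u + t *: pos R v + - t' *: pos R w =
      ((1 - t) *: pos R u + t *: pos R v) - ((1 - t') *: pos R u + t' *: pos R w).
    by apply: pointP; rewrite !cE; ring.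
  by rewrite E subrr.
by rewrite tz ltxx in t0.
Qed.

(** Edges with one common end become, after reversals, two sides of a nondegenerate triangle at that
    end. Edges without a common end are opposite edges of a nondegenerate tetrahedron. *)
Lemma circulant13_disjoint_edges (u v u' v' : 'I_13) (t t' : R) :
  circulant13 u v -> circulant13 u' v' -> 0 < t < 1 -> 0 <= t' <= 1 ->
  (1 - t) *: pos R u + t *: pos R v = (1 - t') *: pos R u' + t' *: pos R v' ->
  ((u == u') && (v == v') || (u == v') && (v == u')).
Proof.
move=> uv uv' /andP[t0 t1] _ E.
have ne (a b : 'I_13) : circulant13 a b -> a != b.
  by apply: contraTneq => ->; rewrite circulant13_irr.
have [n n'] := (ne _ _ uv, ne _ _ uv').
have s0 : 0 < 1 - t by rewrite subr_gt0.
have flip (a b : 'I_13) (s : R) :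
    (1 - s) *: pos R a + s *: pos R b = (1 - (1 - s)) *: pos R b + (1 - s) *: pos R a.
  by rewrite subKr addrC.
have U3 (a b c : 'I_13) : a != b -> a != c -> b != c -> uniq [:: a; b; c].
  by move=> ab ac bc; rewrite /= !inE negb_or ab ac bc.
have [uu|uu] := eqVneq u u'.
  have [//|vv] := eqVneq v v'; exfalso; subst u'.
  exact: (circulant13_adjacent_edges (U3 _ _ _ n n' vv) t0 E).
have [uv1|uv1] := eqVneq u v'.
  have [vu|vu] := eqVneq v u'; first by rewrite orbT.
  exfalso; subst v'; rewrite (flip u') in E.
  by apply: (circulant13_adjacent_edges (U3 _ _ _ n _ vu) t0 E); rewrite // eq_sym.
have [vu|vu] := eqVneq v u'.
  exfalso; subst u'; rewrite (flip u) in E.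
  by apply: (circulant13_adjacent_edges (U3 _ _ _ _ n' uv1) s0 E); rewrite // eq_sym.
have [vv|vv] := eqVneq v v'.
  exfalso; subst v'; rewrite (flip u) (flip u') in E.
  by apply: (circulant13_adjacent_edges (U3 _ _ _ _ _ uu) s0 E); rewrite // eq_sym.
exfalso; have : vol (pos R u) (pos R v) (pos R u') (pos R v') != 0.
  apply: vol_pos; last by rewrite /= !ltn_ord.
  rewrite -[[:: _; _; _; _]]/(map val [:: u; v; u'; v']) (map_inj_uniq val_inj).
  by rewrite /= !inE !negb_or n uu uv1 vu vv n'.
move/vol_indep => /(_ (1 - t) t (- (1 - t')) (- t')) [||_ tz _ _].
- by ring.
- by rewrite -addrA !scaleNr -opprD E subrr.
by rewrite tz ltxx in t0.
Qed.

End Circulant.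

(** * C13(1,3) is 4-connected *)

Section Reach13.
Local Open Scope nat_scope.

Definition reach_step (X S : seq nat) (v : nat) : seq nat :=
  if v \in S then S else if v \in X then S else
  if lazy_has (fun w => w \in S) (nbrs13 v) then v :: S else S.

(** The search starts from the first surviving vertex. Six sweeps are enough here, as the test in
    [connected13] confirms. *)
Definition reached13 (X : seq nat) : seq nat :=
  let S := take 1 [seq v <- iota 0 13 | v \notin X] in
  iter 6 (fun S => foldl (reach_step X) S (iota 0 13)) S.

Definition connected13 (X : seq nat) : bool :=
  let S := reached13 X in all (fun v => if v \in X then true else v \in S) (iota 0 13).

(** The triples may repeat entries, so they cover every nonempty deleted set of at most three
    vertices. *)
Lemma all_connected13 : connected13 [::] && all (fun a => all (fun b => all (fun c =>
  connected13 [:: a; b; c]) (iota 0 b.+1)) (iota 0 a.+1)) (iota 0 13).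
Proof. by vm_compute. Qed.

End Reach13.

Lemma connected13P (X : {set 'I_13}) (s : seq nat) :
  connected13 s -> (forall v : 'I_13, (val v \in s) = (v \in X)) ->
  connected_avoiding circulant13 X.
Proof.
move=> C sX; pose e := [rel u v | [&& circulant13 u v, u \notin X & v \notin X]].
have e_sym : symmetric e.
  by move=> u v; rewrite /= circulant13_sym [(u \notin X) && _]andbC.
pose inv (S : seq nat) := forall u v : 'I_13,
  val u \in S -> val v \in S -> [/\ u \notin X, v \notin X & connect e u v].
have step (S : seq nat) (v : nat) : inv S -> {subset S <= iota 0 13} -> v \in iota 0 13 ->
    inv (reach_step s S v) /\ {subset reach_step s S v <= iota 0 13}.
  move=> iS sS v13; rewrite /reach_step; case: ifP => // vS; case: ifP => // vs.
  rewrite lazy_hasE; case: hasP => // -[w vw wS]; split; last first.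
    by move=> u; rewrite inE => /orP[/eqP -> //|]; exact: sS.
  have w13 : (w < 13)%N by have := sS w wS; rewrite mem_iota.
  have {}v13 : (v < 13)%N by rewrite mem_iota in v13.
  have vX : Ordinal v13 \notin X by rewrite -sX vs.
  have key u : val u \in S -> u \notin X /\ connect e u (Ordinal v13).
    move=> uS; have [uX wX uw] := iS u (Ordinal w13) uS wS.
    split=> //; apply: connect_trans uw (connect1 _).
    by rewrite /= vX wX !andbT /circulant13 adj13_sym.
  move=> x y; rewrite !inE => /orP[/eqP xv|xS] /orP[/eqP yv|yS].
  - have -> : x = Ordinal v13 by apply: val_inj.
    by have -> : y = Ordinal v13 by apply: val_inj.
  - have -> : x = Ordinal v13 by apply: val_inj.
    by have [yX cy] := key y yS; split=> //; rewrite (sym_connect_sym e_sym).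
  - have -> : y = Ordinal v13 by apply: val_inj.
    by have [xX cx] := key x xS.
  - exact: iS.
have round (S l : seq nat) : inv S -> {subset S <= iota 0 13} -> {subset l <= iota 0 13} ->
    inv (foldl (reach_step s) S l) /\ {subset foldl (reach_step s) S l <= iota 0 13}.
  elim: l S => [|v l IH] S iS sS lS //=; have [iS' sS'] := step S v iS sS (lS v (mem_head _ _)).
  by apply: IH => // u ul; apply: lS; rewrite inE ul orbT.
have [iR _] : inv (reached13 s) /\ {subset reached13 s <= iota 0 13}.
  rewrite /reached13; set S0 := take 1 _.
  have init : inv S0 /\ {subset S0 <= iota 0 13}.
    have sub : {subset S0 <= [seq v <- iota 0 13 | v \notin s]} by exact: mem_take.
    split; last by move=> v /sub; rewrite mem_filter => /andP[].
    move=> u v uS vS; have out (x : 'I_13) : val x \in S0 -> x \notin X.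
      by move/sub; rewrite mem_filter -sX => /andP[].
    split; [exact: out|exact: out|]; suff -> : u = v by exact: connect0.
    apply: val_inj; move: uS vS; rewrite /S0; case: [seq _ <- _ | _] => // x l.
    by rewrite /= take0 !inE => /eqP -> /eqP ->.
  have rounds k : let S := iter k (fun S => foldl (reach_step s) S (iota 0 13)) S0 in
      inv S /\ {subset S <= iota 0 13}.
    by elim: k => [//|k [iS sS]]; rewrite iterS; exact: round.
  exact: (rounds 6%N).
move=> x y xX yX; have inR (v : 'I_13) : v \notin X -> val v \in reached13 s.
  move=> vX; have := allP C (val v); rewrite mem_iota ltn_ord sX (negbTE vX).
  exact.
by have [] := iR x y (inR x xX) (inR y yX).
Qed.

Lemma connected13_triple a b c : (a < 13)%N -> (b <= a)%N -> (c <= b)%N -> connected13 [:: a; b; c].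
Proof.
move=> a13 ba cb; have /andP[_ /allP/(_ a)] := all_connected13.
rewrite mem_iota => /(_ a13)/allP/(_ b); rewrite mem_iota => /(_ ba)/allP/(_ c).
by rewrite mem_iota; apply.
Qed.

Lemma circulant13_connected : k_connected 4 circulant13.
Proof.
split=> [|X X4]; first by rewrite card_ord.
pose s := sort geq [seq val v | v <- enum X].
have sX (v : 'I_13) : (val v \in s) = (v \in X).
  by rewrite mem_sort mem_map ?mem_enum //; exact: val_inj.
have s13 v : v \in s -> (v < 13)%N by rewrite mem_sort => /mapP[w _ ->]; exact: ltn_ord.
have srt : sorted geq s by apply: sort_sorted => a b; exact: leq_total.
have sz : (size s < 4)%N by rewrite size_sort size_map -cardE.
have [l Cl lE] : exists2 l, connected13 l & l =i s.
  case: (s) srt sz s13 => [|a [|b [|c [|d l]]]] //= srt _ lt.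
  - by exists [::] => //; case/andP: all_connected13.
  - exists [:: a; a; a]; last by move=> v; rewrite !inE !orbb.
    by apply: connected13_triple; rewrite ?lt ?mem_head.
  - exists [:: a; b; b]; last by move=> v; rewrite !inE orbb.
    by apply: connected13_triple; rewrite ?lt ?mem_head //; move: srt; rewrite andbT.
  - exists [:: a; b; c] => //; move: srt => /and3P[ba cb _].
    by apply: connected13_triple; rewrite ?lt ?mem_head.
by apply: connected13P Cl _ => v; rewrite lE.
Qed.

(** * C13(1,3) is linkless, and conclusion for all n *)

Lemma circulant13_linkless (R : realType) : linklessly_embeddable R circulant13.
Proof.
pose q (v : 'I_13) := pos R v.
have qpoly s : polygon q s = polygon (pos R) (map val s).
  by rewrite /polygon /edges !map_zip -map_rot -!map_comp.
exists (straight circulant13 q); split.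
  apply: straight_is_embedding.
  - exact: circulant13_irr.
  - exact: circulant13_disjoint_edges.
  - exact: pos_inj.
  - exact: k_connected_neighbour circulant13_irr circulant13_connected.
move=> s t [cs Us zs] [ct Ut zt] dis; rewrite !cycle_image_polygon // !qpoly.
have cyc (l : seq 'I_13) : cycle circulant13 l -> cycle adj13 (map val l) by rewrite cycle_map.
have [] // := @cycles13_unlinked R (map val s) (map val t).
- by rewrite map_inj_uniq //; exact: val_inj.
- by rewrite map_inj_uniq //; exact: val_inj.
- exact: cyc.
- exact: cyc.
- by rewrite size_map.
- by rewrite size_map.
move=> v /mapP[u us ->]; apply/negP => /mapP[w wt /val_inj uw].
by have := dis u us; rewrite uw wt.
Qed.

Theorem theorem1 :
  forall n : nat, (13 <= n)%N ->
    exists (T : finType) (e : rel T),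
      [/\ #|T| = n, simple_graph e,
          linklessly_embeddable Rdefinitions.R e & tutte4connected e].
Proof.
move=> n; rewrite leq_eqVlt => /orP[/eqP <-|n14].
  exists 'I_13, circulant13; split; first exact: card_ord.
  - by split; [exact: circulant13_sym|exact: circulant13_irr].
  - exact: circulant13_linkless.
  - by split; [exact: circulant13_connected|exact: circulant13_triangle_free].
have N6 : (6 <= n - 8)%N by rewrite leq_subRL //; exact: leq_trans n14.
have nE : (n - 8 + 8)%N = n by rewrite subnK //; exact: leq_trans n14.
have [s l t] := ladder_properties Rdefinitions.R N6.
by exists 'I_(n - 8 + 8), (@ladder (n - 8)); split=> //; rewrite card_ord.
Qed.
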